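(* Let $L>0$, $\eta>0$ and $K\ge0$ be given. Then there are constants $h_0>0$ and $C\ge0$ such that for all boundary conditions $q\colon\{0,L\}\to\mathbb{R}^m$, $N\colon\{0,L\}\to\mathbb{S}$ with $L/|q(L)-q(0)|-1=\eta$ and for each partition $T$ of $\Sigma=[0,L]$ with $h(T)\le h_0$ the following holds: every critical point $P\in\mathcal{C}_T$ of $\mathcal{E}_T$ subject to the constraint $\Phi_T(P)=0$ with $\mathcal{E}_T(P)\le K$ satisfies $$[P]_{w^{2,\infty}_P}\le C\quad\text{and}\quad[P]_{tv^3_P}\le C.$$ In particular, for a suitable constant $K_2\ge0$ independent of $T$, the set $\mathcal{M}_T$ of minimizers of $\mathcal{E}_T$ on $\mathcal{C}_T$ satisfies, for all partitions $T$ with $h(T)$ sufficiently small, $$\mathcal{M}_T\subset\mathcal{A}_T=\{P\in\mathcal{C}_T:[P]_{w^{2,\infty}_P}\le K_2,\ [P]_{tv^3_P}\le K_2\}.$$ If, in addition, only almost uniform partitions are considered, i.e. partitions $T$ satisfying $$\bigl|\log\bigl(\ell_0(I_{k+1})/\ell_0(I_k)\bigr)\bigr|\le C'\min\bigl(\ell_0(I_k),\ell_0(I_{k+1})\bigr)\quad\text{for every interior vertex } i_k$$ with a fixed constant $C'$, then one even has $[P]_{w^{3,\infty}_P}\le C$ (where $C$ may now also depend on $C'$).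
   Context: $\mathbb{S}\subset\mathbb{R}^m$ is the unit sphere. A partition $T$ of $\Sigma=[0,L]$ is a finite decomposition into compact intervals, with vertices $V(T)=\{0=i_0<\dots<i_n=L\}$ and edges $I_k=[i_{k-1},i_k]$, $k=1,\dots,n$; $E(T)$ is the set of edges and $V_{\rm int}(T)=\{i_1,\dots,i_{n-1}\}$. Let $\ell_0(I_k)=i_k-i_{k-1}$ and $h(T)=\max_k\ell_0(I_k)$. For $P\colon V(T)\to\mathbb{R}^m$ let $\ell_P(I_k)=|P(i_k)-P(i_{k-1})|$, $\bar\ell_P(i_k)=\frac12(\ell_P(I_k)+\ell_P(I_{k+1}))$ for interior vertices, $\sigma_P(I)=\log(\ell_P(I)/\ell_0(I))$. $\widetilde{\mathcal{C}}_T$ is the set of $P$ with $|\sigma_P(I)|<\infty$ for all edges. For $\varphi$ on vertices, $(\mathcal{D}_P\varphi)(I_k)=(\varphi(i_k)-\varphi(i_{k-1}))/\ell_P(I_k)$; for $\psi$ on edges, $(\mathcal{D}_P\psi)(i_k)=(\psi(I_{k+1})-\psi(I_k))/\bar\ell_P(i_k)$ (defined wherever both neighbours are in the domain). $\tau_P=\mathcal{D}_PP$; $\alpha_P(i_k)\in[0,\pi]$ is the angle between $\tau_P(I_k)$ and $\tau_P(I_{k+1})$; $\mathcal{E}_T(P)=\frac12\sum_{i\in V_{\rm int}(T)}\alpha_P(i)^2/\bar\ell_P(i)$. Constraints: $\Phi_T(P)=(P(0)-q(0),P(L)-q(L),\tau_P(I_1)-N(0),\tau_P(I_n)-N(L),\sigma_P)$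 and $\mathcal{C}_T=\{P\in\widetilde{\mathcal{C}}_T:\Phi_T(P)=0\}$. A critical point is a $P\in\mathcal{C}_T$ such that $D\mathcal{E}_T(P)u=0$ for all $u\in\ker D\Phi_T(P)$. Seminorms: $[P]_{w^{2,\infty}_P}=\max_{i\in V_{\rm int}(T)}|(\mathcal{D}_P^2P)(i)|$; $[P]_{w^{3,\infty}_P}=\max_{2\le k\le n-1}|(\mathcal{D}_P^3P)(I_k)|$; $[P]_{tv^3_P}=\sum_{k=2}^{n-1}|(\mathcal{D}_P^3P)(I_k)|\,\ell_P(I_k)$. If $q(0)=q(L)$, then $L/|q(L)-q(0)|-1$ is read as $+\infty$, and $\eta=\infty$ is allowed.
   Formalization: The inclusion of the minimizers M_T in A_T is stated only for m ≥ 2; for m = 1 it is false, since a polygon with |q(L)-q(0)| < L must make a turn of angle π, where |D_P^2 P| = 2/ℓ̄_P is unbounded as h(T) → 0. *)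

(* Defs.v *)
From HB Require Import structures.
From mathcomp Require Import all_boot all_order all_algebra.
From mathcomp Require Import all_classical all_reals all_analysis.

Set Implicit Arguments.
Unset Strict Implicit.
Unset Printing Implicit Defensive.

Import Order.TTheory GRing.Theory Num.Theory.
Import numFieldNormedType.Exports.

Local Open Scope classical_set_scope.
Local Open Scope ring_scope.

(* The library norm `|u| of a row vector is the sup norm, whence [enorm]. The
   library's differential does not depend on the choice of equivalent norm. *)
Section Euclidean.
Variables (R : realType) (m : nat).
Implicit Types u v : 'rV[R]_m.

Definition dot u v : R := \sum_(i < m) u 0 i * v 0 i.
Definition enorm u : R := Num.sqrt (dot u u).
Definition sphere : set 'rV[R]_m := [set u | enorm u = 1].
Definition angle u v : R := acos (dot u v / (enorm u * enorm v)).

End Euclidean.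

(* The vertices are vtx 0 < ... < vtx nedges; the values of vtx beyond nedges
   are irrelevant. The edge I_k, 1 <= k <= nedges, has endpoints vtx k.-1 and
   vtx k; the interior vertices are those of index 1 <= k < nedges. *)
Record interval_partition (R : realType) (L : R) := Partition {
  nedges : nat;
  vtx : nat -> R;
  vtx_first : vtx 0 = 0;
  vtx_last : vtx nedges = L;
  vtx_lt : forall k, (k < nedges)%N -> vtx k < vtx k.+1
}.

Section Polygons.
Variables (R : realType) (m : nat) (L : R) (T : interval_partition L).
Local Notation n := (nedges T).

Definition ell0 (k : nat) : R := vtx T k - vtx T k.-1.
Definition mesh : R := \big[Num.max/0]_(1 <= k < n.+1) ell0 k.

Definition almost_uniform (C' : R) : Prop :=
  forall k, (0 < k < n)%N ->
    `|ln (ell0 k.+1 / ell0 k)| <= C' * Num.min (ell0 k) (ell0 k.+1).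

(* A map V(T) -> R^m is a matrix whose k-th row is its value at the k-th
   vertex; this makes the space of such maps a normed module. *)
Definition polygon := 'M[R]_(n.+1, m).
Implicit Types P u : polygon.

Definition at_vtx P (k : nat) : 'rV[R]_m := row (inord k) P.

Definition ell P (k : nat) : R := enorm (at_vtx P k - at_vtx P k.-1).
Definition ellbar P (k : nat) : R := (ell P k + ell P k.+1) / 2.

(* The logarithm is extended real valued: log 0 = -oo. *)
Definition sigma P (k : nat) : \bar R := lne (ell P k / ell0 k)%:E.

Definition Ctilde : set polygon :=
  [set P | forall k, (1 <= k <= n)%N -> (`|sigma P k| < +oo)%E].

(* Functions on vertices and on edges are both indexed by nat, following the
   numbering of the vertices and edges of T. *)
Definition Dvtx P (phi : nat -> 'rV[R]_m) (k : nat) : 'rV[R]_m :=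
  (ell P k)^-1 *: (phi k - phi k.-1).
Definition Dedge P (psi : nat -> 'rV[R]_m) (k : nat) : 'rV[R]_m :=
  (ellbar P k)^-1 *: (psi k.+1 - psi k).

Definition tau P : nat -> 'rV[R]_m := Dvtx P (at_vtx P).
Definition D2 P : nat -> 'rV[R]_m := Dedge P (tau P).
Definition D3 P : nat -> 'rV[R]_m := Dvtx P (D2 P).

Definition alpha P (k : nat) : R := angle (tau P k) (tau P k.+1).

Definition energy P : R :=
  2^-1 * \sum_(1 <= k < n) alpha P k ^+ 2 / ellbar P k.

Definition semi_w2oo P : R := \big[Num.max/0]_(1 <= k < n) enorm (D2 P k).
Definition semi_w3oo P : R := \big[Num.max/0]_(2 <= k < n) enorm (D3 P k).
Definition semi_tv3 P : R := \sum_(2 <= k < n) enorm (D3 P k) * ell P k.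

Section Constraints.
Variables q0 qL N0 NL : 'rV[R]_m.

Definition Phi P : 'rV[R]_m * 'rV[R]_m * 'rV[R]_m * 'rV[R]_m * 'rV[R]_n :=
  (at_vtx P 0 - q0, at_vtx P n - qL, tau P 1 - N0, tau P n - NL,
   \row_(j < n) fine (sigma P j.+1)).

Definition feasible : set polygon := Ctilde `&` [set P | Phi P = 0].

(* The energy fails to be differentiable where some angle equals pi, so its
   differentiability at P is part of the definition. [Phi] is always
   differentiable on [Ctilde]. *)
Definition critical P : Prop :=
  [/\ feasible P, differentiable energy P
    & forall u, 'd Phi P u = 0 -> 'd energy P u = 0].

Definition minimizers : set polygon :=
  [set P | feasible P /\ forall Q, feasible Q -> energy P <= energy Q].

Definition apriori (K2 : R) : set polygon :=
  [set P | [/\ feasible P, semi_w2oo P <= K2 & semi_tv3 P <= K2]].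

End Constraints.
End Polygons.

Arguments feasible {R m L} T q0 qL N0 NL _.
Arguments minimizers {R m L} T q0 qL N0 NL _.
Arguments apriori {R m L} T q0 qL N0 NL K2 _.

(* L / |qL - q0| - 1, read as +oo if q0 = qL. *)
Definition excess (R : realType) (m : nat) (L : R) (q0 qL : 'rV[R]_m) : \bar R :=
  if q0 == qL then +oo%E else (L / enorm (qL - q0) - 1)%:E.

(* Main.v *)
(* A feasible polygon is determined by its unit tangents t_1, ..., t_n, which
   satisfy \sum_k l_k t_k = q(L) - q(0); its energy is a sum of
   arccos(t_k . t_(k+1))^2 / (2 lbar_k). At a critical point there is a
   multiplier Lam such that, tangentially to the sphere at t_k,
     curv_k e_k^+ + curv_(k-1) e_k^- = l_k Lam,    curv_k = alpha_k / lbar_k,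
   where e_k^+ and e_k^- are the unit directions towards t_(k+1) and t_(k-1).
   Hence |curv_k - curv_(k-1)| <= l_k |Lam|; as the energy bounds the mean
   square of curv_k, all the curv_k are bounded. This is the w^(2,oo) bound, and
   D^2 P(i_k) - D^2 P(i_(k-1)) differs from the left-hand side above by
   O(curv^2 (lbar_k + lbar_(k-1))), which gives the third order bounds.

   To bound Lam, test stationarity with the fields rho_k Pi_k Lam, where Pi_k
   projects onto the orthogonal complement of t_k and rho is the tent function
   vanishing at the first and the last edge. As |q(L) - q(0)| = r L with r < 1,
   the tangents, which vary slowly by the energy bound, cannot all be nearly
   parallel to Lam, so \sum_k l_k rho_k Pi_k is coercive, uniformly in T.

   The same operator is inverted in a contraction argument which restores the
   closing condition \sum_k l_k t_k = q(L) - q(0) after a small perturbation.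
   It yields admissible variations of minimizers, which are therefore stationary,
   and corrects a three-piece zigzag sampled on T to an admissible competitor
   whose energy is bounded independently of T. *)

(* Critical points and minimizers meet in one notion, [stationary], which speaks of tangents only.
   For a critical point the test curve may violate the closing condition to second order, since only
   the differential of the constraints counts; for a minimizer it must be feasible exactly, which is
   what the contraction provides. The correction is O(x^2) in the curve parameter x, so the velocity
   of the curve is unchanged, although nothing is known about the regularity of the correction in x.
   Hence derivatives are always obtained from explicit quadratic remainders.

   At a straight joint the product of neighbouring tangents is 1, where arccos has infinite slope;
   half its square has one-sided slope -1 there, and every estimate is arranged around that
   function. Smallness of the mesh makes every angle at most 1, because one term of the energy sum
   already controls alpha^2 / lbar; in particular no angle is near pi.

   The multiplier is explicit: the inverse of the coercive matrix, applied to the vector that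
   represents the work of the tent fields. All constants depend on L, K and r only, which is where
   uniformity in T comes from. *)
Require Import Defs.
From HB Require Import structures.
From mathcomp Require Import all_boot all_order all_algebra.
From mathcomp Require Import all_classical all_reals all_analysis.
From mathcomp Require Import ring lra zify.

Set Implicit Arguments.
Unset Strict Implicit.
Unset Printing Implicit Defensive.

Import Order.TTheory GRing.Theory Num.Theory.
Import numFieldNormedType.Exports.

Local Open Scope classical_set_scope.
Local Open Scope ring_scope.

(** * Euclidean vectors and arc cosine *)

Section DotProduct.
Variables (R : realType) (m : nat).
Implicit Types (u v w : 'rV[R]_m) (a b : R).

Lemma dotC u v : dot u v = dot v u.
Proof. by apply: eq_bigr => i _; rewrite mulrC. Qed.

Lemma dotDl u v w : dot (u + v) w = dot u w + dot v w.
Proof. by rewrite -big_split; apply: eq_bigr => i _; rewrite !mxE mulrDl. Qed.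

Lemma dotZl a u w : dot (a *: u) w = a * dot u w.
Proof. by rewrite mulr_sumr; apply: eq_bigr => i _; rewrite !mxE mulrA. Qed.

Lemma dotNl u w : dot (- u) w = - dot u w.
Proof. by rewrite -scaleN1r dotZl mulN1r. Qed.

Lemma dotBl u v w : dot (u - v) w = dot u w - dot v w.
Proof. by rewrite dotDl dotNl. Qed.

Lemma dot0l w : dot 0 w = 0.
Proof. by rewrite -(scale0r 0) dotZl mul0r. Qed.

Lemma dotDr u v w : dot w (u + v) = dot w u + dot w v.
Proof. by rewrite !(dotC w) dotDl. Qed.

Lemma dotZr a u w : dot w (a *: u) = a * dot w u.
Proof. by rewrite !(dotC w) dotZl. Qed.

Lemma dotNr u w : dot w (- u) = - dot w u.
Proof. by rewrite !(dotC w) dotNl. Qed.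

Lemma dotBr u v w : dot w (u - v) = dot w u - dot w v.
Proof. by rewrite !(dotC w) dotBl. Qed.

Lemma dot0r w : dot w 0 = 0.
Proof. by rewrite dotC dot0l. Qed.

Definition dotE := (dotDl, dotDr, dotBl, dotBr, dotZl, dotZr, dotNl, dotNr,
  dot0l, dot0r).

Lemma dot_suml (I : Type) (r : seq I) (P : pred I) (F : I -> 'rV[R]_m) w :
  dot (\sum_(i <- r | P i) F i) w = \sum_(i <- r | P i) dot (F i) w.
Proof. exact: (big_morph (fun u => dot u w) (fun u v => dotDl u v w) (dot0l w)). Qed.

Lemma dot_sumr (I : Type) (r : seq I) (P : pred I) (F : I -> 'rV[R]_m) w :
  dot w (\sum_(i <- r | P i) F i) = \sum_(i <- r | P i) dot w (F i).
Proof. by rewrite dotC dot_suml; apply: eq_bigr => i _; rewrite dotC. Qed.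

Lemma dot_ge0 u : 0 <= dot u u.
Proof. by apply: sumr_ge0 => i _; rewrite -expr2 sqr_ge0. Qed.

Lemma enorm_ge0 u : 0 <= enorm u. Proof. exact: sqrtr_ge0. Qed.

Lemma enorm_sqr u : enorm u ^+ 2 = dot u u.
Proof. by rewrite sqr_sqrtr // dot_ge0. Qed.

Lemma dot_eq0 u : dot u u = 0 -> u = 0.
Proof.
move=> /eqP; rewrite psumr_eq0; last by move=> i _; rewrite -expr2 sqr_ge0.
move=> /allP u0; apply/rowP => i; rewrite mxE.
by have := u0 i (mem_index_enum i); rewrite -expr2 sqrf_eq0 => /eqP.
Qed.

Lemma enorm_eq0 u : enorm u = 0 -> u = 0.
Proof. by move=> u0; apply: dot_eq0; rewrite -enorm_sqr u0 expr0n. Qed.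

Lemma enorm0 : enorm (0 : 'rV[R]_m) = 0.
Proof. by rewrite /enorm dot0l sqrtr0. Qed.

Lemma enormZ a u : enorm (a *: u) = `|a| * enorm u.
Proof.
by rewrite /enorm !dotE mulrA -expr2 sqrtrM ?sqr_ge0 // sqrtr_sqr.
Qed.

Lemma enormN u : enorm (- u) = enorm u.
Proof. by rewrite -scaleN1r enormZ normrN normr1 mul1r. Qed.

Lemma enormBC u v : enorm (u - v) = enorm (v - u).
Proof. by rewrite -enormN opprB. Qed.

Lemma enorm_le a u : 0 <= a -> (enorm u <= a) = (dot u u <= a ^+ 2).
Proof. by move=> a0; rewrite -enorm_sqr ler_sqr ?nnegrE ?enorm_ge0. Qed.

Lemma cauchy_schwarz_sqr u v : dot u v ^+ 2 <= dot u u * dot v v.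
Proof.
have [v0|v0] := eqVneq (dot v v) 0.
  by rewrite (dot_eq0 v0) !dotE expr0n mulr0.
have vp : 0 < dot v v by rewrite lt_neqAle eq_sym v0 dot_ge0.
have := dot_ge0 (dot v v *: u - dot u v *: v).
rewrite !dotE (dotC v u) => H.
have : 0 <= dot v v * (dot u u * dot v v - dot u v ^+ 2) by nra.
by rewrite pmulr_rge0 // subr_ge0.
Qed.

Lemma cauchy_schwarz u v : `|dot u v| <= enorm u * enorm v.
Proof.
rewrite -ler_sqr ?nnegrE ?mulr_ge0 ?enorm_ge0 //.
by rewrite real_normK ?num_real // exprMn !enorm_sqr cauchy_schwarz_sqr.
Qed.

Lemma dot_le u v : dot u v <= enorm u * enorm v.
Proof. exact: le_trans (ler_norm _) (cauchy_schwarz u v). Qed.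

Lemma enormD u v : enorm (u + v) <= enorm u + enorm v.
Proof.
rewrite enorm_le ?addr_ge0 ?enorm_ge0 // !dotE (dotC v u).
by rewrite -!enorm_sqr; have := dot_le u v; nra.
Qed.

Lemma enormB u v : enorm (u - v) <= enorm u + enorm v.
Proof. by rewrite -(enormN v) enormD. Qed.

Lemma ler_enormB u v : enorm u - enorm v <= enorm (u - v).
Proof. by rewrite lerBlDr; have := enormD (u - v) v; rewrite subrK. Qed.

Lemma ler_enorm_dist u v : `|enorm u - enorm v| <= enorm (u + v).
Proof.
rewrite ler_norml lerNl opprB; apply/andP; split.
  by have := ler_enormB v (- u); rewrite enormN opprK addrC [v + u]addrC addrC.
by have := ler_enormB u (- v); rewrite enormN opprK.
Qed.

Lemma enorm_sum (I : Type) (r : seq I) (P : pred I) (F : I -> 'rV[R]_m) :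
  enorm (\sum_(i <- r | P i) F i) <= \sum_(i <- r | P i) enorm (F i).
Proof.
elim/big_rec2: _ => [|i x y _ xy]; first by rewrite enorm0.
by apply: le_trans (enormD _ _) _; rewrite lerD2l.
Qed.

Lemma coord_le_enorm u i : `|u 0 i| <= enorm u.
Proof.
rewrite -ler_sqr ?nnegrE ?enorm_ge0 // real_normK ?num_real // enorm_sqr.
rewrite /dot (bigD1 i) //= -expr2 lerDl; apply: sumr_ge0 => j _.
by rewrite -expr2 sqr_ge0.
Qed.

Lemma norm_le_enorm u : `|u| <= enorm u.
Proof.
rewrite [`|u|]mx_normrE; apply: bigmax_le => [|[i j] _]; first exact: enorm_ge0.
by rewrite ord1 coord_le_enorm.
Qed.

Lemma enorm_le_norm u : enorm u <= m%:R * `|u|.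
Proof.
rewrite enorm_le ?mulr_ge0 // /dot.
apply: (@le_trans _ _ (\sum_(i < m) `|u| ^+ 2)).
  apply: ler_sum => i _; rewrite -expr2 -real_normK ?num_real //.
  rewrite ler_sqr ?nnegrE // [leRHS]mx_normrE.
  by apply: (le_bigmax _ (fun ij : 'I_1 * 'I_m => `|u ij.1 ij.2|) (0, i)).
rewrite sumr_const card_ord -[leLHS]mulr_natl exprMn ler_wpM2r ?sqr_ge0 //.
by rewrite -natrX ler_nat; case: (m) => // k; rewrite expnS leq_pmulr.
Qed.

End DotProduct.

Section Trigonometry.
Variable R : realType.
Implicit Types x y c : R.

(** By the mean value theorem. The Taylor bounds below follow one from another: each difference
    vanishes at 0, and the derivative of [cos_ge] and of [sin_ge] is the difference treated just
    before. *)
Lemma nonneg_of_derive (f df : R -> R) :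
  (forall x, is_derive x 1 f (df x)) -> (forall x, 0 <= x -> 0 <= df x) ->
  f 0 = 0 -> forall x, 0 <= x -> 0 <= f x.
Proof.
move=> fdf df0 f0 x x0.
have [| c ] := @MVT_segment R f df 0 x x0 (fun y _ => fdf y).
  apply: continuous_subspaceT => y.
  by apply: differentiable_continuous; apply/derivable1_diffP; have [] := fdf y.
rewrite in_itv/= f0 !subr0 => /andP[c0 _] ->.
by rewrite mulr_ge0 // df0.
Qed.

Lemma sin_le x : 0 <= x -> sin x <= x.
Proof.
move=> x0; rewrite -subr_ge0.
apply: (@nonneg_of_derive (fun x => x - sin x) (fun x => 1 - cos x)) => //.
- by rewrite sin0 subrr.
Qed.

Lemma cos_ge x : 0 <= x -> 1 - x ^+ 2 / 2 <= cos x.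
Proof.
move=> x0; rewrite -subr_ge0.
apply: (@nonneg_of_derive (fun x => cos x - (1 - x ^+ 2 / 2))
          (fun x => x - sin x)) => //.
- move=> y; apply: is_derive_eq; rewrite /GRing.scale/=; lra.
- by move=> y y0; rewrite subr_ge0 sin_le.
- by rewrite cos0; lra.
Qed.

Lemma sin_ge x : 0 <= x -> x - x ^+ 3 / 6 <= sin x.
Proof.
move=> x0; rewrite -subr_ge0.
apply: (@nonneg_of_derive (fun x => sin x - (x - x ^+ 3 / 6))
          (fun x => cos x - (1 - x ^+ 2 / 2))) => //.
- move=> y; apply: is_derive_eq; rewrite /GRing.scale/=; lra.
- by move=> y y0; rewrite subr_ge0 cos_ge.
- by rewrite sin0; lra.
Qed.

End Trigonometry.

(** Serves for curves that are known only up to a quadratic error, such as those corrected by a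
    fixed point, and for arccos squared at 1, where the chain rule fails. *)
Lemma is_derive_quadratic (R : realType) (V : normedModType R) (f : R -> V)
    (a d C : R) (u : V) : 0 < d ->
  (forall t, `|t| <= d -> `|f (a + t) - f a - t *: u| <= C * t ^+ 2) ->
  is_derive a 1 f u.
Proof.
move=> d0 fC.
suff L : (fun h => h^-1 *: ((f \o shift a) (h *: 1) - f a)) @ 0^' --> u.
  by apply: DeriveDef; [apply/cvg_ex; exists u | exact: cvg_lim].
have C0 : 0 <= C.
  have := fC d; rewrite (ger0_norm (ltW d0)) => /(_ (lexx _)) H.
  have := le_trans (normr_ge0 _) H.
  by rewrite (pmulr_lge0 C (exprn_gt0 2 d0)).
have C1 : 0 < C + 1 by lra.
apply/cvgrPdist_le => e e0; near=> h.
have h0 : h != 0 by near: h; exact: nbhs_dnbhs_neq.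
have hp : 0 < `|h| by rewrite normr_gt0.
have hd : `|h| <= d by near: h; exact: dnbhs0_le.
have he : `|h| <= e / (C + 1).
  by near: h; apply: dnbhs0_le; rewrite divr_gt0.
have -> : u - h^-1 *: ((f \o shift a) (h *: 1) - f a)
    = - h^-1 *: (f (a + h) - f a - h *: u).
  rewrite /= (_ : h *: 1 = h); last exact: mulr1.
  rewrite (addrC h) [RHS]scalerBr scalerA mulNr mulVf //.
  by rewrite scaleN1r opprK [in RHS]scaleNr [LHS]addrC.
rewrite normrZ normrN normfV ler_pdivrMl //.
apply: (le_trans (fC _ hd)); rewrite -real_normK ?num_real // expr2 mulrCA.
rewrite ler_pM2l //; move: he; rewrite ler_pdivlMr //.
by nra.
Unshelve. all: by end_near. Qed.

Section Arccosine.
Variable R : realType.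
Implicit Types c x : R.

Lemma pi_le4 : (pi : R) <= 4.
Proof. by have := @pihalf_lt2 R; lra. Qed.

(** Half angle: 1 - cos x = 2 sin(y)^2 with y = x / 2, into which [sin_ge] is inserted. The range up
    to 4 contains all values of [acos]; there y <= 2, whence sin y >= y / 3, and this gives the
    constant 18. *)
Lemma cos_le_quartic x : 0 <= x <= 4 ->
  x ^+ 2 <= 18 * (1 - cos x) /\ x ^+ 2 / 2 - x ^+ 4 / 24 <= 1 - cos x.
Proof.
move=> /andP[x0 x4]; have [y xy] : exists y, x = 2 * y by exists (x / 2); lra.
have -> : 1 - cos x = 2 * sin y ^+ 2.
  rewrite (_ : x = y *+ 2); last by rewrite mulr2n; lra.
  by rewrite cos_mulr2n cos2sin2 mulr2n; lra.
have y0 : 0 <= y by lra.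
have y2 : y <= 2 by lra.
have := sin_ge y0; move: (sin y) => s ys; rewrite {}xy {x x0 x4}.
have yq : y ^+ 2 <= 4 by nra.
have p0 : 0 <= y - y ^+ 3 / 6.
  rewrite (_ : y - _ = y * (1 - y ^+ 2 / 6)); last by field.
  by apply: mulr_ge0; lra.
have p3 : y / 3 <= y - y ^+ 3 / 6.
  have : 0 <= y * (4 - y ^+ 2) by apply: mulr_ge0; lra.
  rewrite (_ : y * _ = 4 * y - y ^+ 3); last by ring.
  lra.
have S : (y - y ^+ 3 / 6) ^+ 2 <= s ^+ 2 by rewrite ler_sqr ?nnegrE // (le_trans p0).
have S3 : (y / 3) ^+ 2 <= s ^+ 2.
  by rewrite ler_sqr ?nnegrE; lra.
split; first by nra.
apply: le_trans (_ : 2 * (y - y ^+ 3 / 6) ^+ 2 <= _); last by lra.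
rewrite (_ : 2 * (y - y ^+ 3 / 6) ^+ 2 =
  (2 * y) ^+ 2 / 2 - (2 * y) ^+ 4 / 24 + y ^+ 6 / 18); last by field.
by rewrite lerDl divr_ge0 // exprn_even_ge0.
Qed.

Lemma acos_sqr_ge c : -1 <= c <= 1 -> 2 * (1 - c) <= acos c ^+ 2.
Proof.
move=> c1; have := cos_ge (acos_ge0 c1).
by rewrite acosK ?in_itv //; lra.
Qed.

Lemma acos_in04 c : -1 <= c <= 1 -> 0 <= acos c <= 4.
Proof. by move=> c1; rewrite acos_ge0 // (le_trans (acos_lepi c1)) // pi_le4. Qed.

Lemma acos_sqr_le c : -1 <= c <= 1 -> acos c ^+ 2 <= 18 * (1 - c).
Proof.
by move=> c1; have [] := cos_le_quartic (acos_in04 c1); rewrite acosK ?in_itv.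
Qed.

(** The quartic term acos^4 / 24 is at most 18^2 / 24 = 27 / 2 times (1 - c)^2. *)
Lemma acos_sqr_taylor c : -1 <= c <= 1 ->
  `|acos c ^+ 2 / 2 - (1 - c)| <= 27 / 2 * (1 - c) ^+ 2.
Proof.
move=> c1; have [] := cos_le_quartic (acos_in04 c1).
rewrite acosK ?in_itv // => A B; have D := acos_sqr_ge c1.
rewrite ger0_norm; last by lra.
have E : (acos c ^+ 2) ^+ 2 <= (18 * (1 - c)) ^+ 2.
  by rewrite ler_sqr ?nnegrE ?sqr_ge0 //; lra.
by rewrite -exprM in E; lra.
Qed.

(* - acos_slope is the derivative of c |-> acos c ^ 2 / 2 on ]-1, 1], one-sided
   at c = 1; half_acos_sqr extends that function differentiably beyond 1. *)
Definition acos_slope c : R :=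
  if c == 1 then 1 else acos c / Num.sqrt (1 - c ^+ 2).

Definition half_acos_sqr c : R := if c <= 1 then acos c ^+ 2 / 2 else 1 - c.

Lemma sqrt_sqr_gt0 c : -1 < c < 1 -> 0 < Num.sqrt (1 - c ^+ 2).
Proof. by move=> /andP[? ?]; rewrite sqrtr_gt0; nra. Qed.

Lemma acos_slope_ge0 c : -1 < c <= 1 -> 0 <= acos_slope c.
Proof.
move=> /andP[c1 c2]; rewrite /acos_slope; case: ifP => // _.
by rewrite divr_ge0 ?sqrtr_ge0 // acos_ge0 // ltW.
Qed.

Lemma acos_slopeM c : -1 < c <= 1 ->
  acos_slope c * Num.sqrt (1 - c ^+ 2) = acos c.
Proof.
move=> /andP[c1 c2]; rewrite /acos_slope; case: eqVneq => [->|cn].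
  by rewrite expr1n subrr sqrtr0 mulr0 acos1.
by rewrite divfK // gt_eqF // sqrt_sqr_gt0 // c1 lt_neqAle cn.
Qed.

Lemma acos_sub_sin c : -1 <= c <= 1 -> acos c <= 1 ->
  0 <= acos c - Num.sqrt (1 - c ^+ 2) <= acos c ^+ 2.
Proof.
move=> c1 a1; have a0 := acos_ge0 c1.
rewrite -(sin_acos c1) subr_ge0 sin_le //=.
by have := sin_ge a0; nra.
Qed.

Lemma acos_slope_le2 c : -1 < c <= 1 -> acos c <= 1 -> acos_slope c <= 2.
Proof.
move=> c1 a1; have c1' : -1 <= c <= 1 by case/andP: c1 => /ltW -> ->.
have a0 := acos_ge0 c1'.
have [->|cn] := eqVneq c 1; first by rewrite /acos_slope eqxx; lra.
have s0 : 0 < Num.sqrt (1 - c ^+ 2).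
  by case/andP: c1 => ? ?; apply: sqrt_sqr_gt0; apply/andP; split; lra.
rewrite /acos_slope (negPf cn) ler_pdivrMr //.
by rewrite -(sin_acos c1'); have := sin_ge a0; nra.
Qed.

Lemma is_derive_half_acos_sqr c : -1 < c <= 1 ->
  is_derive c 1 half_acos_sqr (- acos_slope c).
Proof.
move=> /andP[c1 c2]; have [->|cn] := eqVneq c 1.
  rewrite /acos_slope eqxx.
  (* To the left of 1 the remainder is [acos_sqr_taylor]; to the right the extension is linear and
     the remainder is 0. *)
  apply: (@is_derive_quadratic _ _ _ _ 1 (27 / 2)) => // t t1.
  rewrite /half_acos_sqr lexx acos1 expr0n mul0r subr0 /GRing.scale /=.
  case: ifP => [t0|_].
    have := @acos_sqr_taylor (1 + t).
    have -> : -1 <= 1 + t <= 1 by rewrite t0 andbT; move: t1; rewrite ler_norml; lra.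
    move=> /(_ isT); rewrite (_ : (1 - (1 + t)) ^+ 2 = t ^+ 2); last by ring.
    by rewrite (_ : 1 - (1 + t) = t * - 1) //; ring.
  rewrite (_ : 1 - (1 + t) - t * -1 = 0); last by ring.
  by rewrite normr0 mulr_ge0 ?sqr_ge0 //; lra.
have c11 : -1 < c < 1 by rewrite c1 lt_neqAle cn.
have D := is_derive1_acos c11.
have H : is_derive c 1 (fun x => acos x ^+ 2 / 2) (- acos_slope c).
  apply: is_derive_eq; rewrite /acos_slope (negPf cn) /GRing.scale /=.
  by field; rewrite gt_eqF // sqrt_sqr_gt0.
apply: (near_eq_is_derive _ H).
have /near_in_itvoo cI : c \in `](-1), 1[ by rewrite in_itv.
near=> x; rewrite /half_acos_sqr ifT //.
suff : x \in `](-1), 1[ by rewrite in_itv => /andP[_ /ltW].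
by near: x.
Unshelve. all: by end_near. Qed.

End Arccosine.

(** * Partitions *)

Section PartitionLemmas.
Variables (R : realType) (L : R) (T : interval_partition L).
Local Notation n := (nedges T).

(* The left end point of the edge I_k: chains and cut-offs are sampled there. *)
Definition node (k : nat) : R := vtx T k.-1.
(** Distances are measured to [node n] and not to L, so that the value on the last edge, whose
    tangent is prescribed, is exactly 0. *)
Definition tent (k : nat) : R := Num.min (node k) (node n - node k).
Definition lbar (k : nat) : R := (ell0 T k + ell0 T k.+1) / 2.

Lemma ell0_gt0 k : (1 <= k <= n)%N -> 0 < ell0 T k.
Proof.
case: k => // k /andP[_ kn]; rewrite subr_gt0 /=.
exact: (vtx_lt (i := T)).
Qed.

Lemma ell0_le_mesh k : (1 <= k <= n)%N -> ell0 T k <= mesh T.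
Proof. by move=> kn; apply: le_bigmax_seq => //; rewrite mem_index_iota. Qed.

Lemma sum_ell0 k : \sum_(1 <= j < k.+1) ell0 T j = vtx T k.
Proof.
rewrite (@telescope_sumr_eq _ 1 k.+1 (fun j => vtx T j.-1)) //=.
by rewrite vtx_first subr0.
Qed.

Lemma vtx_le i j : (i <= j <= n)%N -> vtx T i <= vtx T j.
Proof.
move=> /andP[ij jn]; rewrite -(subnKC ij) in jn *; move: (j - i)%N jn => d.
elim: d => [|d IH] dn; first by rewrite addn0.
rewrite addnS; apply: (le_trans (IH _)); first by lia.
by apply/ltW/(vtx_lt (i := T)); lia.
Qed.

Lemma node_le i j : (1 <= i <= j)%N -> (j <= n)%N -> node i <= node j.
Proof. by move=> ij jn; apply: vtx_le; lia. Qed.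

Lemma nodeS k : (1 <= k)%N -> node k.+1 = node k + ell0 T k.
Proof. by case: k => // k _; rewrite /node /ell0 /=; ring. Qed.

Lemma node1 : node 1 = 0. Proof. exact: vtx_first. Qed.

Lemma node_ge0 k : (1 <= k <= n)%N -> 0 <= node k.
Proof. by move=> kn; rewrite -node1; apply: node_le; lia. Qed.

Lemma node_last : node n = L - ell0 T n.
Proof. by rewrite /node /ell0 vtx_last; ring. Qed.

Lemma tent_ge0 k : (1 <= k <= n)%N -> 0 <= tent k.
Proof.
move=> kn; rewrite le_min node_ge0 //= subr_ge0.
by apply: node_le; lia.
Qed.

Lemma tent_le k : (1 <= k <= n)%N -> tent k <= L.
Proof.
move=> kn; rewrite /tent; apply: (@le_trans _ _ (node k)); first by rewrite ge_min lexx.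
by rewrite -[leRHS](vtx_last T); apply: vtx_le; lia.
Qed.

Lemma tent_lipschitz k : (1 <= k < n)%N -> `|tent k.+1 - tent k| <= ell0 T k.
Proof.
move=> kn; have l0 := @ell0_gt0 k _; rewrite /tent nodeS; last by lia.
have {}l0 : 0 < ell0 T k by apply: l0; lia.
rewrite /Num.min ler_norml.
by case: ifP; case: ifP => *; apply/andP; split; lra.
Qed.

Lemma lbar_gt0 k : (1 <= k < n)%N -> 0 < lbar k.
Proof.
move=> kn; have := @ell0_gt0 k _; have := @ell0_gt0 k.+1 _.
rewrite /lbar => A B; apply: divr_gt0 => //; apply: addr_gt0; [apply: B|apply: A]; lia.
Qed.

Lemma ell0_le_lbar k : (1 <= k < n)%N -> ell0 T k <= 2 * lbar k.
Proof.
move=> kn; have : 0 < ell0 T k.+1 by apply: ell0_gt0; lia.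
by rewrite /lbar; lra.
Qed.

Lemma lbar_le_mesh k : (1 <= k < n)%N -> lbar k <= mesh T.
Proof.
move=> kn; have : ell0 T k <= mesh T by apply: ell0_le_mesh; lia.
have : ell0 T k.+1 <= mesh T by apply: ell0_le_mesh; lia.
by rewrite /lbar; lra.
Qed.

(** [lbar i] is the distance between the midpoints of I_i and I_(i+1), so the sum telescopes. *)
Lemma sum_lbar a b : (1 <= a <= b)%N ->
  \sum_(a <= i < b) lbar i = (node b - node a + (vtx T b - vtx T a)) / 2.
Proof.
move=> /andP[a1 ab].
rewrite (@telescope_sumr_eq _ a b (fun i => (node i + vtx T i) / 2)) //.
  by rewrite -mulrBl; congr (_ / _); ring.
by move=> i /andP[ai ib]; rewrite /lbar /node /ell0 /=; field.
Qed.

Hypothesis L0 : 0 < L.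

Lemma nedges_gt0 : (0 < n)%N.
Proof.
rewrite lt0n; apply/eqP => n0; have := vtx_last T.
by rewrite n0 vtx_first => /eqP; rewrite lt_eqF.
Qed.

Lemma mesh_gt0 : 0 < mesh T.
Proof.
have n1 := nedges_gt0.
by apply: lt_le_trans (@ell0_gt0 1 _) (@ell0_le_mesh 1 _); lia.
Qed.

Lemma tent_first : tent 1 = 0.
Proof.
have n1 := nedges_gt0.
by rewrite /tent node1 subr0; apply: min_l; apply: node_ge0; lia.
Qed.

Lemma tent_last : tent n = 0.
Proof.
have n1 := nedges_gt0.
by rewrite /tent subrr; apply: min_r; apply: node_ge0; lia.
Qed.

Lemma sum_lbar_le a b : (1 <= a <= b)%N -> (b <= n)%N ->
  \sum_(a <= i < b) lbar i <= node b - node a + mesh T.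
Proof.
move=> ab bn; rewrite sum_lbar //.
have : ell0 T b <= mesh T by apply: ell0_le_mesh; lia.
have : 0 < ell0 T a by apply: ell0_gt0; lia.
have := mesh_gt0; rewrite /ell0 /node; lra.
Qed.

Lemma sum_lbar_le_L : \sum_(1 <= i < n) lbar i <= L.
Proof.
have n1 := nedges_gt0.
have l1 : 0 < ell0 T 1 by apply: ell0_gt0; lia.
have ln : 0 < ell0 T n by apply: ell0_gt0; lia.
rewrite sum_lbar; last by lia.
move: l1 ln; rewrite node1 node_last /ell0 /= vtx_first vtx_last; lra.
Qed.

Lemma sum_lbar_ge : mesh T <= L / 2 -> L / 2 <= \sum_(1 <= i < n) lbar i.
Proof.
have n1 := nedges_gt0 => h.
have l1 : ell0 T 1 <= mesh T by apply: ell0_le_mesh; lia.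
have ln : ell0 T n <= mesh T by apply: ell0_le_mesh; lia.
rewrite sum_lbar; last by lia.
move: l1 ln; rewrite node1 node_last /ell0 /= vtx_first vtx_last; lra.
Qed.

(** The edges that start before a cover the part of [0, L] below a and overshoot a by at most one
    edge. *)
Lemma sum_ell0_below a : - mesh T <= a ->
  Num.min a L <= \sum_(1 <= k < n.+1 | node k < a) ell0 T k <= a + mesh T.
Proof.
move=> am; have mp := mesh_gt0.
(* Cutting both bounds off at [vtx T j] makes the claim inductive in the number of edges. *)
suff H j : (j <= n)%N -> Num.min a (vtx T j) <=
    \sum_(1 <= k < j.+1 | node k < a) ell0 T k <= Num.min (vtx T j) (a + mesh T).
  have /andP[A B] := H n (leqnn _); rewrite -[in Num.min a L](vtx_last T) A /=.
  by apply: le_trans B _; rewrite ge_min lexx orbT.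
elim: j => [_|j IH jn]; first by rewrite big_geq // vtx_first ge_min lexx orbT le_min lexx /=; lra.
have /andP[A B] := IH (ltnW jn).
have l0 : 0 < ell0 T j.+1 by apply: ell0_gt0; lia.
have lm : ell0 T j.+1 <= mesh T by apply: ell0_le_mesh; lia.
have vE : vtx T j.+1 = vtx T j + ell0 T j.+1 by rewrite /ell0 /=; ring.
rewrite big_mkcond /= big_nat_recr //= -big_mkcond /=.
move: (\sum_(1 <= k < j.+1 | _) _) A B => S; rewrite vE /node /=.
by rewrite /Num.min; repeat case: ifP => ?; lra.
Qed.

Lemma sum_ell0_between a b : 0 <= a -> a <= b -> b <= L ->
  b - a - mesh T <= \sum_(1 <= k < n.+1 | a <= node k < b) ell0 T k.
Proof.
move=> a0 ab bL; have mp := mesh_gt0.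
have /andP[_ A] : Num.min a L <= \sum_(1 <= k < n.+1 | node k < a) ell0 T k <= a + mesh T.
  by apply: sum_ell0_below; lra.
have /andP[B _] : Num.min b L <= \sum_(1 <= k < n.+1 | node k < b) ell0 T k <= b + mesh T.
  by apply: sum_ell0_below; lra.
rewrite min_l // in B.
suff : \sum_(1 <= k < n.+1 | node k < b) ell0 T k =
  \sum_(1 <= k < n.+1 | node k < a) ell0 T k +
  \sum_(1 <= k < n.+1 | a <= node k < b) ell0 T k by lra.
rewrite (bigID (fun k => node k < a)) /=; congr (_ + _); apply: eq_bigl => k.
  by case: (ltP (node k) a) => H; rewrite ?andbF // andbT; apply: lt_le_trans H ab.
by rewrite -leNgt andbC.
Qed.

End PartitionLemmas.

(** * Chains of unit vectors *)

Lemma ler_sum_natP (R : numDomainType) (a b : nat) (P : pred nat) (f g : nat -> R) :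
  (forall i, (a <= i < b)%N -> P i -> f i <= g i) ->
  \sum_(a <= i < b | P i) f i <= \sum_(a <= i < b | P i) g i.
Proof.
move=> fg; rewrite big_nat_cond [leRHS]big_nat_cond.
by apply: ler_sum => i /andP[/fg].
Qed.

Lemma ler_sum_nat0 (R : numDomainType) (a b : nat) (f g : nat -> R) :
  (forall i, (a <= i < b)%N -> f i <= g i) ->
  \sum_(a <= i < b) f i <= \sum_(a <= i < b) g i.
Proof. by move=> fg; apply: ler_sum_natP => i ? _; apply: fg. Qed.

Lemma ler_sum_nat_sub (R : numDomainType) (a b c d : nat) (f : nat -> R) :
  (a <= b <= c)%N -> (c <= d)%N -> (forall i, (a <= i < d)%N -> 0 <= f i) ->
  \sum_(b <= i < c) f i <= \sum_(a <= i < d) f i.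
Proof.
move=> /andP[ab bc] cd f0.
rewrite (@big_cat_nat _ _ _ b a d) //=; last exact: leq_trans cd.
rewrite (@big_cat_nat _ _ _ c b d) //= addrCA lerDl addr_ge0 //;
by rewrite big_nat_cond; apply: sumr_ge0 => i; rewrite andbT => H; apply: f0; lia.
Qed.

Section Chains.
Variables (R : realType) (m : nat) (L : R) (T : interval_partition L).
Local Notation n := (nedges T).
Local Notation l := (ell0 T).
Implicit Types (t w : nat -> 'rV[R]_m).

Definition unit_chain t := forall k, (1 <= k <= n)%N -> dot (t k) (t k) = 1.

Definition chain_energy t : R := 2^-1 *
  \sum_(1 <= k < n) acos (dot (t k) (t k.+1)) ^+ 2 / lbar T k.

Definition chain_sum t : 'rV[R]_m := \sum_(1 <= k < n.+1) l k *: t k.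

Lemma dot_unit_itv (u v : 'rV[R]_m) : dot u u = 1 -> dot v v = 1 ->
  -1 <= dot u v <= 1.
Proof.
move=> u1 v1; have := cauchy_schwarz u v.
by rewrite /enorm u1 v1 sqrtr1 mulr1 ler_norml.
Qed.

Lemma enorm_chord_le (u v : 'rV[R]_m) : dot u u = 1 -> dot v v = 1 ->
  enorm (v - u) <= acos (dot u v).
Proof.
move=> u1 v1; have uv := dot_unit_itv u1 v1.
rewrite enorm_le ?acos_ge0 // !dotE u1 v1 (dotC v u).
by have := acos_sqr_ge uv; lra.
Qed.

Lemma unit_chain_dot t k : unit_chain t -> (1 <= k < n)%N ->
  -1 <= dot (t k) (t k.+1) <= 1.
Proof. by move=> t1 kn; apply: dot_unit_itv; apply: t1; lia. Qed.

Hypothesis L0 : 0 < L.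

(** Young's inequality alpha <= theta alpha^2 / (2 lbar) + lbar / (2 theta), summed. The parameter
    stays free: a small theta makes the energy term small, after which short distances make the
    other one small. *)
Lemma sum_acos_le t K theta i j : unit_chain t -> chain_energy t <= K ->
  0 < theta -> (1 <= i <= j)%N -> (j <= n)%N ->
  \sum_(i <= k < j) acos (dot (t k) (t k.+1)) <=
  theta * K + (\sum_(i <= k < j) lbar T k) / (2 * theta).
Proof.
move=> t1 tK th ij jn; set a := fun k => acos (dot (t k) (t k.+1)).
have lb k : (1 <= k < n)%N -> 0 < lbar T k by move=> kn; apply: lbar_gt0.
apply: (@le_trans _ _ (\sum_(i <= k < j)
    (theta / 2 * (a k ^+ 2 / lbar T k) + lbar T k / (2 * theta)))).
  apply: ler_sum_nat0 => k kij; rewrite -/(a k).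
  have {}lb : 0 < lbar T k by apply: lb; lia.
  rewrite -subr_ge0.
  rewrite (_ : _ - _ = (theta * a k - lbar T k) ^+ 2 / (2 * theta * lbar T k)).
    by apply: divr_ge0; [exact: sqr_ge0 | nra].
  by field; apply/andP; split; apply: lt0r_neq0.
rewrite big_split /= -mulr_suml lerD2r -mulr_sumr.
have : \sum_(i <= k < j) a k ^+ 2 / lbar T k <= 2 * K.
  apply: (@le_trans _ _ (\sum_(1 <= k < n) a k ^+ 2 / lbar T k)).
    apply: ler_sum_nat_sub => // k kn.
    by apply: divr_ge0; [exact: sqr_ge0 | apply/ltW/lb].
  by move: tK; rewrite /chain_energy -/a; lra.
by move=> H; have := ler_wpM2l (ltW th) H; lra.
Qed.

(** Discrete form of the Hoelder continuity of a tangent with square integrable derivative: chords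
    are bounded by angles, and angles are summed. *)
Lemma chain_dist t K theta i j : unit_chain t -> chain_energy t <= K ->
  0 < theta -> (1 <= i <= j)%N -> (j <= n)%N ->
  enorm (t j - t i) <= theta * K + (node T j - node T i + mesh T) / (2 * theta).
Proof.
move=> t1 tK th ij jn.
rewrite -(@telescope_sumr _ i j t); last by case/andP: ij.
apply: (le_trans (enorm_sum _ _ _)).
apply: (@le_trans _ _ (\sum_(i <= k < j) acos (dot (t k) (t k.+1)))).
  by apply: ler_sum_nat0 => k kij; apply: enorm_chord_le; apply: t1; lia.
apply: (le_trans (sum_acos_le t1 tK th ij jn)).
rewrite lerD2l ler_pM2r ?invr_gt0 ?mulr_gt0 //.
exact: sum_lbar_le.
Qed.

Lemma chain_dist_sym t K theta i j : unit_chain t -> chain_energy t <= K ->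
  0 < theta -> (1 <= i <= n)%N -> (1 <= j <= n)%N ->
  enorm (t j - t i) <= theta * K + (`|node T j - node T i| + mesh T) / (2 * theta).
Proof.
move=> t1 tK th iN jN; have [ij|ji] := leqP i j.
  rewrite ger0_norm ?subr_ge0 ?node_le; try lia.
  by apply: chain_dist => //; lia.
rewrite distrC enormBC ger0_norm ?subr_ge0 ?node_le; try lia.
by apply: chain_dist => //; lia.
Qed.

(** Otherwise every product t_k . s has modulus above r' |s|. Steps are at most mu |s| <= r' |s|, so
    the sign never changes, and summation gives |[chain_sum] . s| >= r' L |s| > r L |s|. *)
Lemma chain_not_aligned t (s : 'rV[R]_m) r r' mu : unit_chain t ->
  enorm (chain_sum t) <= r * L -> r < r' -> 0 <= r' -> mu <= r' ->
  (forall k, (1 <= k < n)%N -> enorm (t k.+1 - t k) <= mu) ->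
  exists2 k, (1 <= k <= n)%N & `|dot (t k) s| <= r' * enorm s.
Proof.
move=> t1 tr rr' r0 mur tmu; apply: contrapT => no.
have big k : (1 <= k <= n)%N -> r' * enorm s < `|dot (t k) s|.
  by move=> kn; rewrite ltNge; apply/negP => H; apply: no; exists k.
have n1 := nedges_gt0 T L0.
(* Stated for u so that it covers both s and -s, according to the sign of the first product. *)
have rs u : enorm u = enorm s -> (forall k, (1 <= k <= n)%N -> r' * enorm s < `|dot (t k) u|) ->
    0 < dot (t 1%N) u -> False.
  move=> us ubig u1.
  have pos k : (k < n)%N -> r' * enorm s < dot (t k.+1) u.
    elim: k => [|k IH] kn.
      by rewrite -[ltRHS](ger0_norm (ltW u1)); apply: ubig; lia.
    have := IH (ltnW kn); have := ubig k.+2 kn.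
    have := cauchy_schwarz (t k.+2 - t k.+1) u.
    have : enorm (t k.+2 - t k.+1) * enorm u <= mu * enorm s.
      by rewrite us; apply: ler_wpM2r; [exact: enorm_ge0 | apply: tmu; lia].
    have := ler_wpM2r (enorm_ge0 s) mur.
    rewrite dotBl ler_norml => A B /andP[C _] + E.
    by case: (ger0P (dot (t k.+2) u)) => F; lra.
  have : dot (chain_sum t) u <= r * L * enorm s.
    by apply: le_trans (dot_le _ _) _; rewrite us; apply: ler_wpM2r => //; apply: enorm_ge0.
  have : r' * enorm s * L <= dot (chain_sum t) u.
    rewrite /chain_sum dot_suml -[L in leLHS](vtx_last T) -sum_ell0 mulr_sumr.
    apply: ler_sum_nat0 => -[|k] kn; first by lia.
    rewrite dotZl mulrC; apply: ler_wpM2l; first by apply/ltW/ell0_gt0.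
    by apply/ltW/pos; lia.
  have s0 : 0 < enorm s.
    rewrite lt_neqAle enorm_ge0 andbT eq_sym; apply/eqP => s0.
    move: u1; rewrite (_ : u = 0) ?dot0r ?ltxx //.
    by apply: enorm_eq0; rewrite us.
  by have := mulr_gt0 s0 L0; nra.
have := big 1%N; rewrite n1 => /(_ isT) b1.
have [p|p] := ltP 0 (dot (t 1%N) s); first exact: (rs s).
have [d0|d0] := eqVneq (dot (t 1%N) s) 0.
  by move: b1; rewrite d0 normr0 ltNge mulr_ge0 ?enorm_ge0.
apply: (rs (- s)); rewrite ?enormN ?dotNr ?oppr_gt0 //.
  by move=> k kn; rewrite dotNr normrN; apply: big.
by rewrite lt_neqAle d0.
Qed.

End Chains.

(** * Coercivity of the tent-weighted projections *)

Section Coercivity.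
Variables (R : realType) (L : R).
Hypothesis L0 : 0 < L.

(** For unit tangents the last factor is the squared length of the component of s orthogonal to t k:
    this is a lower bound for the quadratic form of [tent_mx]. *)
Definition tent_coercive m (T : interval_partition L) (t : nat -> 'rV[R]_m) c :=
  forall s, c * dot s s <=
    \sum_(1 <= k < (nedges T).+1)
      ell0 T k * tent T k * (dot s s - dot (t k) s ^+ 2).

Lemma unit_dot_sqr_le m (u s : 'rV[R]_m) : dot u u = 1 ->
  0 <= dot s s - dot u s ^+ 2.
Proof. by move=> u1; have := cauchy_schwarz_sqr u s; rewrite u1 mul1r subr_ge0. Qed.

Lemma tent_sum_ge m (T : interval_partition L) (t : nat -> 'rV[R]_m) a b d X s :
  unit_chain T t -> 0 <= a -> a <= b -> b <= L -> 0 <= d -> 0 <= X ->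
  (forall k, (1 <= k <= nedges T)%N -> a <= node T k < b ->
    d <= tent T k /\ X <= dot s s - dot (t k) s ^+ 2) ->
  (b - a - mesh T) * d * X <=
  \sum_(1 <= k < (nedges T).+1 | a <= node T k < b)
      ell0 T k * tent T k * (dot s s - dot (t k) s ^+ 2).
Proof.
move=> t1 a0 ab bL d0 X0 H.
apply: (@le_trans _ _ (\sum_(1 <= k < (nedges T).+1 | a <= node T k < b)
   ell0 T k * (d * X))).
  rewrite -mulr_suml -[leLHS]mulrA.
  apply: ler_wpM2r; first exact: mulr_ge0.
  exact: sum_ell0_between.
apply: ler_sum_natP => k kn /(H k)[|dk mk]; first by lia.
have l0 : 0 < ell0 T k by apply: ell0_gt0; lia.
by rewrite -mulrA; apply: ler_wpM2l; [exact: ltW | exact: ler_pM].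
Qed.

Lemma tent_sum_restrict m (T : interval_partition L) (t : nat -> 'rV[R]_m) s
    (P : pred nat) : unit_chain T t ->
  \sum_(1 <= k < (nedges T).+1 | P k)
      ell0 T k * tent T k * (dot s s - dot (t k) s ^+ 2) <=
  \sum_(1 <= k < (nedges T).+1)
      ell0 T k * tent T k * (dot s s - dot (t k) s ^+ 2).
Proof.
move=> t1; rewrite [leRHS](bigID P) /= lerDl big_nat_cond.
apply: sumr_ge0 => k /andP[kn _].
have l0 : 0 < ell0 T k by apply: ell0_gt0; lia.
have w0 : 0 <= tent T k by apply: tent_ge0; lia.
apply: mulr_ge0; first by apply: mulr_ge0 => //; exact: ltW.
by apply: unit_dot_sqr_le; apply: t1; lia.
Qed.

(** For each s some tangent makes a definite angle with s, and by [chain_dist_sym] so do all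
    tangents at distance at most D. This window has a length independent of T, and a part of it lies
    where the tent is at least D / 4. *)
Lemma bounded_energy_coercive (K r : R) : 0 <= K -> 0 <= r < 1 ->
  exists c h0 : R, [/\ 0 < c, 0 < h0 & forall m (T : interval_partition L)
    (t : nat -> 'rV[R]_m), mesh T <= h0 -> unit_chain T t ->
    chain_energy T t <= K -> enorm (chain_sum T t) <= r * L ->
    tent_coercive T t c].
Proof.
move=> K0 /andP[r0 r1].
(* mu is half the gap between r' and 1. The bound of [chain_dist_sym] splits into two halves of mu:
   theta makes theta K <= mu / 2, and distance plus mesh is at most 2 D <= mu theta. *)
have [r' r'E] : exists r', r' = (1 + r) / 2 by eexists.
have [mu muD] : exists mu, mu = (1 - r') / 2 by eexists.
have [th thE] : exists th, th = mu / (2 * K + 1) by eexists.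
have [D DE] : exists D, D = Num.min (mu * th / 2) (L / 4) by eexists.
have r'1 : r' < 1 by lra.
have rr' : r < r' by lra.
have r'h : 1 / 2 <= r' by lra.
have mu0 : 0 < mu by lra.
have mu1 : mu <= 1 / 4 by lra.
have muE : r' + mu = 1 - mu by lra.
have K1 : 0 < 2 * K + 1 by lra.
have th0 : 0 < th by rewrite thE divr_gt0.
have thK : th * K <= mu / 2.
  by rewrite thE mulrAC ler_pdivrMr //; nra.
have D0 : 0 < D by rewrite DE lt_min !divr_gt0 // mulr_gt0.
have DL : D <= L / 4 by rewrite DE ge_min lexx orbT.
have Dth : 2 * D <= mu * th.
  have : D <= mu * th / 2 by rewrite DE ge_min lexx.
  by lra.
clear r0 r'E muD thE DE.
(* Window length 3 D / 4 minus the mesh, times the minimum of the tent, times the share of |s|^2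
   orthogonal to the tangents. *)
exists (D / 2 * (D / 4) * mu), (D / 4); split; [by rewrite !mulr_gt0 // divr_gt0|lra|].
move=> m T t hT t1 tK tr s.
have close i j : (1 <= i <= nedges T)%N -> (1 <= j <= nedges T)%N ->
    `|node T j - node T i| <= D -> enorm (t j - t i) <= mu.
  move=> iN jN ijD; apply: (le_trans (chain_dist_sym L0 t1 tK th0 iN jN)).
  rewrite (_ : mu = mu / 2 + mu / 2); last by lra.
  apply: lerD => //; rewrite ler_pdivrMr; last by lra.
  have hT' : mesh T <= D by lra.
  by lra.
have [k kn gk] : exists2 k, (1 <= k <= nedges T)%N & `|dot (t k) s| <= r' * enorm s.
  apply: (@chain_not_aligned _ _ _ _ L0 _ _ r _ mu) => //; [lra ..|].
  move=> k kn; have k1 : (1 <= k <= nedges T)%N by clear -kn; lia.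
  have k2 : (1 <= k.+1 <= nedges T)%N by clear -kn; lia.
  apply: close => //.
  rewrite nodeS; last by case/andP: k1.
  have l0 := ell0_gt0 k1; have lm := ell0_le_mesh k1.
  by rewrite ger0_norm; lra.
have gj j : (1 <= j <= nedges T)%N -> `|node T j - node T k| <= D ->
    mu * dot s s <= dot s s - dot (t j) s ^+ 2.
  move=> jN jk; have := close _ _ kn jN jk => tjk.
  have : `|dot (t j) s| <= (r' + mu) * enorm s.
    rewrite mulrDl -(subrK (t k) (t j)) dotDl addrC.
    apply: (le_trans (ler_normD _ _)); apply: lerD => //.
    apply: (le_trans (cauchy_schwarz _ _)); apply: ler_wpM2r => //.
    exact: enorm_ge0.
  rewrite muE -ler_sqr ?nnegrE ?mulr_ge0 ?enorm_ge0 //; last by lra.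
  rewrite real_normK ?num_real // exprMn enorm_sqr => H.
  by have := dot_ge0 s; nra.
have hL : ell0 T (nedges T) <= mesh T.
  by apply: ell0_le_mesh; rewrite leqnn andbT nedges_gt0.
have ln0 : 0 < ell0 T (nedges T).
  by apply: ell0_gt0; rewrite leqnn andbT nedges_gt0.
have k0 := node_ge0 kn.
have kl : node T k <= node T (nedges T).
  by case/andP: kn => k1 kn; apply: node_le; rewrite ?k1 ?kn ?leqnn.
have lE := node_last T.
(* The tent may vanish at [node T k] itself, so the window starts D / 4 away from it and extends
   towards the middle of [0, L]; hence the two cases at the end. *)
have main a b : 0 <= a -> a <= b -> b <= L -> b - a = 3 / 4 * D ->
    (forall y, a <= y < b -> [/\ D / 4 <= y, D / 4 <= node T (nedges T) - y &
      `|y - node T k| <= D]) ->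
    D / 2 * (D / 4) * mu * dot s s <=
    \sum_(1 <= k < (nedges T).+1)
      ell0 T k * tent T k * (dot s s - dot (t k) s ^+ 2).
  move=> a0 ab bL abD H.
  apply: le_trans (tent_sum_restrict s (fun k => a <= node T k < b) t1).
  apply: (@le_trans _ _ ((b - a - mesh T) * (D / 4) * (mu * dot s s))).
    rewrite -[leLHS]mulrA; apply: ler_wpM2r; first by rewrite mulr_ge0 ?dot_ge0 // ltW.
    by apply: ler_wpM2r; lra.
  apply: tent_sum_ge => //; [lra | by rewrite mulr_ge0 ?dot_ge0 // ltW |].
  move=> j jN /H[j1 j2 j3]; split; last exact: gj.
  by rewrite /tent le_min j1 j2.
have [kL|kL] := leP (node T k) (L / 2).
  apply: (main (node T k + D / 4) (node T k + D)); try lra.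
  move=> y /andP[y1 y2]; split; [lra|lra|].
  by rewrite ger0_norm; lra.
apply: (main (node T k - D) (node T k - D / 4)); try lra.
move=> y /andP[y1 y2]; split; [lra|lra|].
by rewrite ler0_norm; lra.
Qed.

End Coercivity.

(** * Lagrange multipliers *)

Section CoerciveMatrix.
Variables (R : realType) (m : nat).
Implicit Types (u v s : 'rV[R]_m) (B : 'M[R]_m).

(** Cauchy-Schwarz turns coercivity into |s| <= |s B| / c, which is injectivity and the bound on the
    inverse at once. *)
Lemma coercive_inverse B c : 0 < c ->
  (forall s, c * dot s s <= dot (s *m B) s) ->
  exists B' : 'M[R]_m, (forall y : 'rV[R]_m, y *m B' *m B = y) /\
    forall y : 'rV[R]_m, enorm (y *m B') <= enorm y / c.
Proof.
move=> c0 Bc; have Be s : enorm s <= enorm (s *m B) / c.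
  rewrite ler_pdivlMr //; have [s0|s0] := eqVneq (enorm s) 0.
    by rewrite s0 mul0r enorm_ge0.
  have sp : 0 < enorm s by rewrite lt_neqAle eq_sym s0 enorm_ge0.
  rewrite -(ler_pM2r sp); apply: le_trans (dot_le _ _); apply: le_trans (Bc s).
  by rewrite -enorm_sqr mulrAC -expr2 mulrC.
have uB : B \in unitmx.
  rewrite -row_free_unit; apply: inj_row_free => v vB.
  by apply/enorm_eq0/le_anti; rewrite enorm_ge0 (le_trans (Be v)) // vB enorm0 mul0r.
exists (invmx B); split=> y; first by rewrite mulmxKV.
by apply: (le_trans (Be _)); rewrite mulmxKV.
Qed.

Definition tproj (u s : 'rV[R]_m) := s - dot u s *: u.

Lemma dot_tproj u s : dot u u = 1 -> dot u (tproj u s) = 0.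
Proof. by move=> u1; rewrite /tproj !dotE u1 mulr1 subrr. Qed.

Lemma dot_tproj_id u v s : dot u v = 0 -> dot v (tproj u s) = dot v s.
Proof. by move=> uv; rewrite /tproj !dotE (dotC v u) uv mulr0 subr0. Qed.

Lemma enorm_tproj u s : dot u u = 1 -> enorm (tproj u s) <= enorm s.
Proof.
move=> u1; rewrite enorm_le ?enorm_ge0 // enorm_sqr /tproj !dotE u1 (dotC s u).
by have := sqr_ge0 (dot u s); nra.
Qed.

Lemma enorm_tproj_unit u v : dot u u = 1 -> dot v v = 1 ->
  enorm (tproj u v) = Num.sqrt (1 - dot u v ^+ 2).
Proof.
move=> u1 v1; rewrite /enorm /tproj !dotE u1 v1 (dotC v u); congr Num.sqrt.
by ring.
Qed.

End CoerciveMatrix.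

Section Multiplier.
Variables (R : realType) (m : nat) (L : R) (T : interval_partition L).
Hypothesis L0 : 0 < L.
Local Notation n := (nedges T).
Local Notation l := (ell0 T).
Implicit Types (t w : nat -> 'rV[R]_m) (s v : 'rV[R]_m).

Definition pull t k : R := acos_slope (dot (t k) (t k.+1)) / lbar T k.

(* Minus the derivative of the energy in the direction w. *)
Definition pull_work t w : R := \sum_(1 <= k < n)
  pull t k * (dot (t k) (w k.+1) + dot (w k) (t k.+1)).

(** The test fields are the variations admissible to first order: tangent to the sphere, zero on the
    two clamped edges, and preserving the closing condition. *)
Definition stationary t : Prop := forall w,
  (forall k, (1 <= k <= n)%N -> dot (t k) (w k) = 0) -> w 1%N = 0 -> w n = 0 ->
  chain_sum T w = 0 -> pull_work t w = 0.

Definition tent_field t s k : 'rV[R]_m := tent T k *: tproj (t k) s.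

Definition tent_mx t : 'M[R]_m := \sum_(1 <= k < n.+1)
  (l k * tent T k) *: (1%:M - (t k)^T *m t k).

Lemma tent_mxE t s : s *m tent_mx t = chain_sum T (tent_field t s).
Proof.
rewrite /tent_mx /chain_sum mulmx_sumr; apply: eq_bigr => k _.
rewrite -scalemxAr mulmxBr mulmx1 mulmxA /tent_field scalerA; congr (_ *: (_ - _)).
rewrite [s *m _]mx11_scalar mul_scalar_mx mxE; congr (_ *: _).
by rewrite dotC; apply: eq_bigr => i _; rewrite mxE.
Qed.

Lemma dot_tent_mx t s v : dot (s *m tent_mx t) v = \sum_(1 <= k < n.+1)
  l k * tent T k * (dot s v - dot (t k) s * dot (t k) v).
Proof.
rewrite tent_mxE /chain_sum dot_suml; apply: eq_bigr => k _.
by rewrite /tent_field /tproj !dotE; ring.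
Qed.

Lemma tent_mx_sym t s v : dot (s *m tent_mx t) v = dot s (v *m tent_mx t).
Proof.
rewrite (dotC s) !dot_tent_mx; apply: eq_bigr => k _; rewrite (dotC s v); ring.
Qed.

Lemma tent_mx_coercive t c : tent_coercive T t c ->
  forall s, c * dot s s <= dot (s *m tent_mx t) s.
Proof. by move=> tc s; rewrite dot_tent_mx; apply: tc. Qed.

Lemma pull_workB t w w' :
  pull_work t (fun k => w k - w' k) = pull_work t w - pull_work t w'.
Proof.
rewrite /pull_work -sumrB; apply: eq_bigr => k _; rewrite !dotE; ring.
Qed.

Lemma pull_work_delta t j v : (2 <= j < n)%N ->
  pull_work t (fun k => if k == j then v else 0) =
  pull t j.-1 * dot (t j.-1) v + pull t j * dot v (t j.+1).
Proof.
move=> jn; rewrite /pull_work.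
under eq_bigr => k _ do rewrite mulrDr.
rewrite big_split /=; congr (_ + _).
  rewrite (eq_bigr (fun k => if k == j.-1 then pull t k * dot (t k) v else 0)); last first.
    move=> k _; rewrite (_ : (k.+1 == j) = (k == j.-1)); last by lia.
    by case: ifP => // _; rewrite dot0r mulr0.
  by rewrite -big_mkcond big_nat1_eq ifT //; lia.
rewrite (eq_bigr (fun k => if k == j then pull t k * dot v (t k.+1) else 0)); last first.
  by move=> k _; case: ifP => // _; rewrite dot0l mulr0.
by rewrite -big_mkcond big_nat1_eq ifT //; lia.
Qed.

(** A field concentrated on the edge j violates the closing condition by l_j v. Subtracting the tent
    field that compensates for this gives an admissible field; its work vanishes, and the work of
    the tent field is the multiplier term. *)
Lemma multiplier t c C1 : unit_chain T t -> 0 < c -> tent_coercive T t c ->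
  stationary t -> 0 <= C1 ->
  (forall s, pull_work t (tent_field t s) <= C1 * enorm s) ->
  exists Lam : 'rV[R]_m, enorm Lam <= C1 / c /\
    forall j v, (2 <= j < n)%N -> dot (t j) v = 0 ->
      pull t j.-1 * dot (t j.-1) v + pull t j * dot v (t j.+1) = l j * dot v Lam.
Proof.
move=> t1 c0 tc tst C10 tC1.
have [B' [gB _]] := coercive_inverse c0 (tent_mx_coercive tc).
(* N represents the linear functional s |-> work of [tent_field t s]. With Lam = N B' one gets c
   |Lam|^2 <= Lam . N <= C1 |Lam|. *)
pose N := \sum_(1 <= k < n) pull t k *:
  (tent T k.+1 *: tproj (t k.+1) (t k) + tent T k *: tproj (t k) (t k.+1)).
have NE s : pull_work t (tent_field t s) = dot s N.
  rewrite /N dot_sumr; apply: eq_bigr => k _.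
  rewrite /tent_field /tproj !dotE !(dotC s) !(dotC (t k.+1) (t k)); ring.
exists (N *m B'); split.
  rewrite ler_pdivlMr //; have [->|s0] := eqVneq (enorm (N *m B')) 0.
    by rewrite mul0r.
  have sp : 0 < enorm (N *m B') by rewrite lt_neqAle eq_sym s0 enorm_ge0.
  rewrite -(ler_pM2r sp); apply: le_trans (tC1 _); rewrite NE dotC.
  rewrite -[X in _ <= dot X _](gB N); apply: le_trans (tent_mx_coercive tc _).
  by rewrite -enorm_sqr mulrAC -expr2 mulrC.
move=> j v jn vj.
(* By symmetry of the tent matrix B, s . N = s . (Lam B) = (s B) . Lam = l_j v . Lam. *)
pose s := (l j *: v) *m B'.
pose w k := (if k == j then v else 0) - tent_field t s k.
have : pull_work t w = 0.
  apply: tst.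
  - move=> k kn; rewrite /w dotBr dotZr dot_tproj ?t1 // mulr0 subr0.
    by case: eqP => [->|_] //; rewrite dot0r.
  - rewrite /w /tent_field tent_first // scale0r ifF ?subrr //; lia.
  - rewrite /w /tent_field tent_last // scale0r ifF ?subrr //; lia.
  - rewrite /chain_sum /w; under eq_bigr => k _ do rewrite scalerBr.
    rewrite sumrB -/(chain_sum T (tent_field t s)) -tent_mxE gB.
    rewrite (eq_bigr (fun k => if k == j then l k *: v else 0)); last first.
      by move=> k _; case: ifP => // _; rewrite scaler0.
    by rewrite -big_mkcond big_nat1_eq ifT ?subrr //; lia.
rewrite pull_workB pull_work_delta // NE => /eqP; rewrite subr_eq0 => /eqP ->.
by rewrite -{1}(gB N) -tent_mx_sym gB dotZl.
Qed.

End Multiplier.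

(** * Estimates for stationary chains *)

Section Estimates.
Variables (R : realType) (m : nat) (L : R) (T : interval_partition L).
Hypothesis L0 : 0 < L.
Local Notation n := (nedges T).
Local Notation l := (ell0 T).
Implicit Types (t w : nat -> 'rV[R]_m) (s u v : 'rV[R]_m).

(** With equal weights the first-order parts cancel and a (1 - c) (u + v) . s remains, quadratic in
    the angle; the term linear in the angle carries the factor b - a. *)
Lemma pull_bracket_le u v s a b : dot u u = 1 -> dot v v = 1 ->
  -1 < dot u v -> acos (dot u v) <= 1 -> 0 <= a -> 
  `|dot u (b *: tproj v s) + dot (a *: tproj u s) v| <=
  (a * acos (dot u v) ^+ 2 + `|b - a| * acos (dot u v)) * enorm s.
Proof.
move=> u1 v1 c1 al1 a0; set c := dot u v.
have cI := dot_unit_itv u1 v1; have /andP[_ c2] := cI.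
rewrite [X in `|X|](_ : _ = a * (1 - c) * dot (u + v) s + (b - a) * dot (u - c *: v) s); last first.
  by rewrite /tproj !dotE -/c (dotC s v); ring.
have e0 := enorm_ge0 s.
apply: (le_trans (ler_normD _ _)); rewrite [leRHS]mulrDl; apply: lerD.
  rewrite normrM (ger0_norm (_ : 0 <= a * (1 - c))); last first.
    by apply: mulr_ge0 => //; rewrite subr_ge0.
  rewrite -[leLHS]mulrA -[leRHS]mulrA; apply: ler_wpM2l => //.
  apply: (@le_trans _ _ ((1 - c) * (2 * enorm s))).
    apply: ler_wpM2l; first by rewrite subr_ge0.
    apply: (le_trans (cauchy_schwarz _ _)); apply: ler_wpM2r => //.
    by apply: (le_trans (enormD _ _)); rewrite /enorm u1 v1 sqrtr1.
  by rewrite mulrA; apply: ler_wpM2r => //; rewrite mulrC; apply: acos_sqr_ge.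
rewrite normrM -[leRHS]mulrA; apply: ler_wpM2l; first exact: normr_ge0.
apply: (le_trans (cauchy_schwarz _ _)); apply: ler_wpM2r => //.
rewrite (_ : u - c *: v = tproj v u); last by rewrite /tproj dotC.
rewrite enorm_tproj_unit // dotC -/c.
by have /andP[+ _] := acos_sub_sin cI al1; rewrite subr_ge0.
Qed.

Variables (t : nat -> 'rV[R]_m) (K : R).
Hypotheses (t1 : unit_chain T t) (tK : chain_energy T t <= K)
  (hK : 2 * K * mesh T <= 1).
Local Notation ang k := (acos (dot (t k) (t k.+1))).

Lemma sum_angle_sqr_le : \sum_(1 <= k < n) ang k ^+ 2 / lbar T k <= 2 * K.
Proof. by move: tK; rewrite /chain_energy; lra. Qed.

(** A single term of the energy sum is at most 2 K and [lbar] is at most the mesh, so the squared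
    angle is at most 2 K [mesh T]. *)
Lemma angle_le1 k : (1 <= k < n)%N -> 0 <= ang k <= 1.
Proof.
move=> kn; have a0 : 0 <= ang k by exact: acos_ge0 (unit_chain_dot t1 kn).
rewrite a0 /= -(@ler_sqr _ _ 1) ?nnegrE // expr1n.
have lb := lbar_gt0 kn; have lm := lbar_le_mesh kn.
have mp := lt_le_trans lb lm.
apply: le_trans hK; rewrite -ler_pdivrMr //.
have : ang k ^+ 2 / mesh T <= ang k ^+ 2 / lbar T k.
  by apply: ler_wpM2l; [exact: sqr_ge0 | rewrite lef_pV2 ?posrE].
move=> /le_trans; apply; apply: le_trans sum_angle_sqr_le.
rewrite -[leLHS](@big_nat1 _ 0 +%R k (fun k => ang k ^+ 2 / lbar T k)).
apply: ler_sum_nat_sub; [by clear -kn; lia | by clear -kn; lia |].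
by move=> i i1; apply: divr_ge0; [exact: sqr_ge0 | apply/ltW/lbar_gt0].
Qed.

Lemma dot_gtN1 k : (1 <= k < n)%N -> -1 < dot (t k) (t k.+1) <= 1.
Proof.
move=> kn; have /andP[c1 ->] := unit_chain_dot t1 kn.
rewrite andbT lt_neqAle c1 andbT; apply/eqP => c.
have := angle_le1 kn; rewrite -c acosN1; have := @pi_ge2 R; lra.
Qed.

Lemma pull_ge0 k : (1 <= k < n)%N -> 0 <= pull T t k.
Proof.
move=> kn; apply: divr_ge0; last exact/ltW/lbar_gt0.
exact/acos_slope_ge0/dot_gtN1.
Qed.

Lemma pull_le k : (1 <= k < n)%N -> pull T t k <= 2 / lbar T k.
Proof.
move=> kn; apply: ler_wpM2r; first by rewrite invr_ge0; apply/ltW/lbar_gt0.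
by apply: acos_slope_le2; [exact: dot_gtN1 | case/andP: (angle_le1 kn)].
Qed.

(** The factor 2 / lbar of the pull is absorbed in both parts of [pull_bracket_le]: alpha^2 / lbar
    is summed by the energy, and the increment of the tent is at most 2 lbar. *)
Lemma tent_field_work s :
  pull_work T t (tent_field T t s) <= (4 * (L + 1) * K + 2 * L) * enorm s.
Proof.
apply: (@le_trans _ _ (\sum_(1 <= k < n)
   (2 * (L + 1) * (ang k ^+ 2 / lbar T k) + 2 * lbar T k) * enorm s)).
  apply: ler_sum_nat0 => k kn.
  have lb := lbar_gt0 kn; have [p0 p2] := (pull_ge0 kn, pull_le kn).
  have tl := tent_lipschitz kn; have ll := ell0_le_lbar kn.
  have k1 : (1 <= k <= n)%N by clear -kn; lia.
  have k2 : (1 <= k.+1 <= n)%N by clear -kn; lia.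
  have [w0 wL] := (tent_ge0 k1, tent_le k1).
  have /andP[a0 a1] := angle_le1 kn; have /andP[cN _] := dot_gtN1 kn.
  have := @pull_bracket_le (t k) (t k.+1) s (tent T k) (tent T k.+1) (t1 k1) (t1 k2) cN a1 w0.
  rewrite -/(tent_field T t s k.+1) -/(tent_field T t s k).
  move: (dot (t k) _ + _) => X /(le_trans (ler_norm _)) XH.
  apply: (le_trans (ler_wpM2l p0 XH)); rewrite [leLHS]mulrA.
  apply: ler_wpM2r; first exact: enorm_ge0.
  have Y0 : 0 <= tent T k * ang k ^+ 2 + `|tent T k.+1 - tent T k| * ang k.
    by rewrite addr_ge0 ?mulr_ge0 ?sqr_ge0.
  apply: (le_trans (ler_wpM2r Y0 p2)).
  apply: (@le_trans _ _ (2 / lbar T k * (L * ang k ^+ 2 + 2 * lbar T k * ang k))).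
    apply: ler_wpM2l; first by rewrite divr_ge0 // ltW.
    apply: lerD; first by apply: ler_wpM2r => //; exact: sqr_ge0.
    by apply: ler_wpM2r => //; apply: le_trans tl ll.
  (* The leftover 4 alpha is split as 4 alpha <= 2 alpha^2 / lbar + 2 lbar. *)
  rewrite -subr_ge0 (_ : _ - _ = 2 * (ang k - lbar T k) ^+ 2 / lbar T k).
    by apply: divr_ge0; [apply: mulr_ge0; rewrite ?sqr_ge0 | exact: ltW].
  by field; exact: lt0r_neq0.
rewrite -mulr_suml; apply: ler_wpM2r; first exact: enorm_ge0.
rewrite big_split /= -!mulr_sumr.
have A := sum_angle_sqr_le; have B := sum_lbar_le_L T L0.
have L1 : 0 <= 2 * (L + 1) by have := L0; lra.
by have := ler_wpM2l L1 A; lra.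
Qed.

Definition curv k : R := ang k / lbar T k.
(** [pullR k] and [pullL k] are curv_k e_k^+ and curv_(k-1) e_k^-. Written with [acos_slope] and a
    projection they make sense also when neighbouring tangents coincide and the unit directions do
    not exist. *)
Definition pullR k : 'rV[R]_m := pull T t k *: tproj (t k) (t k.+1).
Definition pullL k : 'rV[R]_m := pull T t k.-1 *: tproj (t k) (t k.-1).
Definition bend k : 'rV[R]_m := (lbar T k)^-1 *: (t k.+1 - t k).

Lemma curv_ge0 k : (1 <= k < n)%N -> 0 <= curv k.
Proof.
by move=> kn; apply: divr_ge0; [case/andP: (angle_le1 kn) | apply/ltW/lbar_gt0].
Qed.

Lemma curv_sqr k : (1 <= k < n)%N -> ang k ^+ 2 / lbar T k = curv k ^+ 2 * lbar T k.
Proof. by move=> kn; rewrite /curv; field; apply/lt0r_neq0/lbar_gt0. Qed.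

Lemma enorm_pullR k : (1 <= k < n)%N -> enorm (pullR k) = curv k.
Proof.
move=> kn; rewrite enormZ ger0_norm ?pull_ge0 // enorm_tproj_unit; first last.
- by apply: t1; clear -kn; lia.
- by apply: t1; clear -kn; lia.
by rewrite /pull mulrAC acos_slopeM // dot_gtN1.
Qed.

Lemma enorm_pullL k : (1 <= k.-1 < n)%N -> enorm (pullL k) = curv k.-1.
Proof.
move=> kn; rewrite enormZ ger0_norm ?pull_ge0 // enorm_tproj_unit; first last.
- by apply: t1; clear -kn; lia.
- by apply: t1; clear -kn; lia.
have kE : k.-1.+1 = k by clear -kn; lia.
have := dot_gtN1 kn; rewrite /pull /curv kE (dotC (t k)) => H.
by rewrite mulrAC acos_slopeM.
Qed.

(** v - u = [tproj u v] - (1 - c) u. The tangential error is angle minus sine, the normal one is 1 -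
    c; both are at most the squared angle. *)
Lemma pull_vs_chord u v b : dot u u = 1 -> dot v v = 1 -> 0 < b ->
  -1 < dot u v -> acos (dot u v) <= 1 ->
  enorm (b^-1 *: (v - u) - (acos_slope (dot u v) / b) *: tproj u v) <=
  2 * acos (dot u v) ^+ 2 / b.
Proof.
move=> u1 v1 b0 c1 a1; set c := dot u v.
have cI := dot_unit_itv u1 v1; have /andP[_ c2] := cI.
have cI' : -1 < dot u v <= 1 by rewrite c1.
rewrite (_ : _ - _ = b^-1 *: ((1 - acos_slope c) *: tproj u v - (1 - c) *: u)); last first.
  rewrite /tproj -/c; apply/rowP => i; rewrite !mxE; ring.
rewrite enormZ ger0_norm ?invr_ge0 ?(ltW b0) // [leLHS]mulrC.
apply: ler_wpM2r; first by rewrite invr_ge0 ltW.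
apply: (le_trans (enormB _ _)); rewrite mulr_natl mulr2n; apply: lerD.
  rewrite enormZ enorm_tproj_unit // -[Num.sqrt _]ger0_norm ?sqrtr_ge0 // -normrM.
  rewrite mulrBl mul1r -/c acos_slopeM // distrC.
  by have /andP[A B] := acos_sub_sin cI a1; rewrite ger0_norm.
rewrite enormZ /enorm u1 sqrtr1 mulr1 ger0_norm ?subr_ge0 //.
by have := acos_sqr_ge cI; rewrite -/c => H; have : c <= 1 by []; lra.
Qed.

Lemma bend_le k : (1 <= k < n)%N -> enorm (bend k) <= curv k.
Proof.
move=> kn; rewrite enormZ ger0_norm ?invr_ge0 ?(ltW (lbar_gt0 kn)) // [leLHS]mulrC.
apply: ler_wpM2r; first by rewrite invr_ge0; apply/ltW/lbar_gt0.
by apply: enorm_chord_le; apply: t1; clear -kn; lia.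
Qed.

Variable (Lam : 'rV[R]_m).
Hypothesis LamE : forall j v, (2 <= j < n)%N -> dot (t j) v = 0 ->
  pull T t j.-1 * dot (t j.-1) v + pull T t j * dot v (t j.+1) = l j * dot v Lam.

(** The multiplier equation is tested with the sum of the two pulls itself, whose squared length
    becomes l_j times its product with Lam. *)
Lemma pull_balance j : (2 <= j < n)%N ->
  enorm (pullR j + pullL j) <= l j * enorm Lam.
Proof.
move=> jn; set v := pullR j + pullL j.
have jN : (1 <= j <= n)%N by clear -jn; lia.
have tv : dot (t j) v = 0.
  by rewrite dotDr !dotZr !dot_tproj ?t1 // !mulr0 addr0.
have vv : dot v v = l j * dot v Lam.
  rewrite -(LamE jn tv) {2}/v dotDr !dotZr addrC; congr (_ * _ + _ * _).
    by rewrite dot_tproj_id // dotC.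
  by rewrite dot_tproj_id.
have [->|v0] := eqVneq (enorm v) 0.
  by rewrite mulr_ge0 ?enorm_ge0 // ltW // ell0_gt0.
have vp : 0 < enorm v by rewrite lt_neqAle eq_sym v0 enorm_ge0.
rewrite -(ler_pM2r vp) -expr2 enorm_sqr vv -mulrA.
by rewrite ler_pM2l ?ell0_gt0 // mulrC dot_le.
Qed.

(** Two vectors that nearly cancel have nearly the same length. *)
Lemma curv_step j : (2 <= j < n)%N -> `|curv j - curv j.-1| <= l j * enorm Lam.
Proof.
move=> jn; rewrite -enorm_pullR; last by clear -jn; lia.
rewrite -enorm_pullL; last by clear -jn; lia.
by apply: le_trans (ler_enorm_dist _ _) (pull_balance jn).
Qed.

Lemma curv_dist i j : (1 <= i <= j)%N -> (j < n)%N ->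
  `|curv j - curv i| <= L * enorm Lam.
Proof.
move=> ij jn; rewrite -(@telescope_sumr _ i j curv); last by case/andP: ij.
apply: (le_trans (ler_norm_sum _ _ _)).
apply: (@le_trans _ _ (\sum_(i <= k < j) l k.+1 * enorm Lam)).
  by apply: ler_sum_nat0 => k kij; apply: (@curv_step k.+1); clear -ij jn kij; lia.
rewrite -mulr_suml; apply: ler_wpM2r; first exact: enorm_ge0.
rewrite (@telescope_sumr_eq _ i j (vtx T)) //; last by case/andP: ij.
have : vtx T j <= vtx T n by apply: vtx_le; clear -jn; lia.
have : vtx T 0 <= vtx T i by apply: vtx_le; clear -ij jn; lia.
rewrite vtx_first vtx_last; lra.
Qed.

(** If one curvature exceeds the bound, [curv_dist] forces all of them above 1 + q with q = (4 K +
    1) / L. Then curv^2 >= q everywhere, and the energy sum is at least q L / 2 > 2 K. *)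
Lemma curv_le k : mesh T <= L / 2 -> (1 <= k < n)%N ->
  curv k <= 1 + (4 * K + 1) / L + L * enorm Lam.
Proof.
move=> hL kn; apply: contrapT => /negP; rewrite -ltNge => kbig.
have all_big i : (1 <= i < n)%N -> 1 + (4 * K + 1) / L <= curv i.
  move=> iN; suff : `|curv k - curv i| <= L * enorm Lam by rewrite ler_norml; lra.
  have [ik|ki] := leqP i k; first by apply: curv_dist; clear -ik kn iN; lia.
  by rewrite distrC; apply: curv_dist; clear -ki kn iN; lia.
have K0 : 0 <= 2 * K.
  apply: le_trans sum_angle_sqr_le; rewrite big_nat_cond; apply: sumr_ge0 => i.
  by rewrite andbT => iN; apply: divr_ge0; [exact: sqr_ge0 | apply/ltW/lbar_gt0].
set q := (4 * K + 1) / L in all_big kbig.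
have q0 : 0 <= q by apply: divr_ge0; [lra | exact: ltW].
have qL : q * L = 4 * K + 1 by rewrite /q divfK // lt0r_neq0.
have : q * (\sum_(1 <= i < n) lbar T i) <= 2 * K.
  apply: le_trans sum_angle_sqr_le; rewrite mulr_sumr; apply: ler_sum_nat0 => i iN.
  rewrite curv_sqr //; apply: ler_wpM2r; first exact/ltW/lbar_gt0.
  by have := all_big i iN; nra.
have := ler_wpM2l q0 (sum_lbar_ge L0 hL); lra.
Qed.

(** Both bends are compared with pulls tangent at the same vector t k. Since [pullL k] points
    backwards, [bend k.-1] is close to its negative, and the main part is the balanced sum
    [pullR k + pullL k]. *)
Lemma bend_diff_le M k : (forall i, (1 <= i < n)%N -> curv i <= M) ->
  (2 <= k < n)%N ->
  enorm (bend k - bend k.-1) <=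
  l k * enorm Lam + 2 * M ^+ 2 * (lbar T k + lbar T k.-1).
Proof.
move=> cM kn.
have k1 : (1 <= k < n)%N by clear -kn; lia.
have k2 : (1 <= k.-1 < n)%N by clear -kn; lia.
have kE : k.-1.+1 = k by clear -kn; lia.
have kN : (1 <= k <= n)%N by clear -kn; lia.
have kN2 : (1 <= k.-1 <= n)%N by clear -kn; lia.
have kN3 : (1 <= k.+1 <= n)%N by clear -kn; lia.
have sq i : (1 <= i < n)%N -> 2 * ang i ^+ 2 / lbar T i <= 2 * M ^+ 2 * lbar T i.
  move=> iN; rewrite -mulrA curv_sqr // -mulrA; apply: ler_wpM2l => //.
  apply: ler_wpM2r; first exact/ltW/lbar_gt0.
  have C0 := curv_ge0 iN; have CM := cM i iN.
  by rewrite ler_sqr ?nnegrE // (le_trans C0).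
rewrite (_ : bend k - bend k.-1 = (pullR k + pullL k) +
    ((bend k - pullR k) - (bend k.-1 + pullL k))); last first.
  by apply/rowP => i; rewrite !mxE; ring.
apply: (le_trans (enormD _ _)); apply: lerD; first exact: pull_balance.
apply: (le_trans (enormB _ _)); rewrite mulrDr; apply: lerD.
  apply: le_trans (sq k k1); apply: pull_vs_chord; rewrite ?t1 ?lbar_gt0 //.
    by case/andP: (dot_gtN1 k1).
  by case/andP: (angle_le1 k1).
apply: le_trans (sq k.-1 k2); rewrite -enormN.
rewrite (_ : - _ = (lbar T k.-1)^-1 *: (t k.-1 - t k) - pullL k); last first.
  by apply/rowP => i; rewrite /bend kE !mxE; ring.
have := angle_le1 k2; have := dot_gtN1 k2.
rewrite /pullL /pull kE dotC => /andP[? _] /andP[_ ?].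
by apply: pull_vs_chord; rewrite ?t1 ?lbar_gt0.
Qed.

End Estimates.

Lemma stationary_chain_estimate (R : realType) (L K r : R) : 0 < L -> 0 <= K ->
  0 <= r < 1 -> exists C h0 : R, [/\ 0 <= C, 0 < h0 &
    forall m (T : interval_partition L) (t : nat -> 'rV[R]_m), mesh T <= h0 ->
    unit_chain T t -> chain_energy T t <= K -> enorm (chain_sum T t) <= r * L ->
    stationary T t ->
    (forall k, (1 <= k < nedges T)%N -> enorm (bend T t k) <= C) /\
    (forall k, (2 <= k < nedges T)%N -> enorm (bend T t k - bend T t k.-1) <=
       C * (ell0 T k + lbar T k + lbar T k.-1))].
Proof.
move=> L0 K0 r01; have [c [h [c0 h0 coer]]] := bounded_energy_coercive L0 K0 r01.
pose C1 := 4 * (L + 1) * K + 2 * L.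
have C10 : 0 <= C1 by rewrite /C1 addr_ge0 ?mulr_ge0 ?addr_ge0 // ltW.
pose A := C1 / c; have A0 : 0 <= A by apply: divr_ge0 => //; exact: ltW.
pose M := 1 + (4 * K + 1) / L + L * A.
have M0 : 0 <= M.
  have : 0 <= (4 * K + 1) / L by apply: divr_ge0; lra.
  by have := mulr_ge0 (ltW L0) A0; rewrite /M; lra.
have S0 := sqr_ge0 M.
(* M bounds the curvature, A the multiplier, and 2 M^2 the chord errors. The three mesh bounds serve
   coercivity, the lower bound of the sum of [lbar], and angles at most 1. *)
exists (M + A + 2 * M ^+ 2), (Num.min h (Num.min (L / 2) (1 / (2 * K + 1)))).
split.
- by lra.
- by rewrite !lt_min h0 !divr_gt0 //; lra.
move=> m T t; rewrite !le_min => /andP[hT /andP[hL hK]] t1 tK tr tst.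
have {}hK : 2 * K * mesh T <= 1.
  have mp := mesh_gt0 T L0.
  by move: hK; rewrite ler_pdivlMr; lra.
have tc := coer m T t hT t1 tK tr.
have [Lam [LamA LamE]] := multiplier L0 t1 c0 tc tst C10 (tent_field_work L0 t1 tK hK).
have cM i : (1 <= i < nedges T)%N -> curv T t i <= M.
  move=> iN; apply: (le_trans (curv_le L0 t1 tK hK LamE hL iN)).
  by rewrite lerD2l; apply: ler_wpM2l => //; exact: ltW.
split=> k kn.
  apply: (le_trans (bend_le t1 kn)); apply: (le_trans (cM k kn)); lra.
apply: (le_trans (bend_diff_le t1 tK hK LamE cM kn)).
have l0 : 0 < ell0 T k by apply: ell0_gt0; clear -kn; lia.
have lb : 0 < lbar T k + lbar T k.-1.
  by apply: addr_gt0; apply: lbar_gt0; clear -kn; lia.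
have H1 : ell0 T k * enorm Lam <= A * ell0 T k by rewrite mulrC; apply: ler_wpM2r => //; exact: ltW.
have H2 := mulr_ge0 (addr_ge0 M0 A0) (ltW lb).
have H3 := mulr_ge0 (addr_ge0 M0 S0) (ltW l0).
have H4 := mulr_ge0 S0 (ltW l0).
by clear -H1 H2 H3 H4; nra.
Qed.

(** * Differentiating the energy *)

Lemma is_derive_sum_nat (R : realType) (f : nat -> R -> R) (df : nat -> R)
    (x : R) (a b : nat) :
  (forall k, (a <= k < b)%N -> is_derive x 1 (f k) (df k)) ->
  is_derive x 1 (fun y => \sum_(a <= k < b) f k y) (\sum_(a <= k < b) df k).
Proof.
elim: b => [|b IH] H.
  rewrite big_geq // (_ : (fun _ => _) = cst 0); first exact: is_derive_cst.
  by apply/funext => y; rewrite big_geq.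
have [ba|ab] := ltnP b a.
  rewrite big_geq // (_ : (fun _ => _) = cst 0); first exact: is_derive_cst.
  by apply/funext => y; rewrite big_geq.
rewrite big_nat_recr //.
rewrite (_ : (fun _ => _) = (fun y => \sum_(a <= k < b) f k y) + f b); last first.
  by apply/funext => y; rewrite big_nat_recr.
apply: is_deriveD; last by apply: H; rewrite ab /=.
by apply: IH => k /andP[ak kb]; apply: H; rewrite ak ltnW.
Qed.

Lemma dot_quadratic (R : realType) (m : nat) (p q u v a b : 'rV[R]_m) (x d C : R) :
  dot p p = 1 -> dot q q = 1 -> `|x| <= d -> 0 <= C ->
  enorm (a - p - x *: u) <= C * x ^+ 2 -> enorm (b - q - x *: v) <= C * x ^+ 2 ->
  `|dot a b - dot p q - x * (dot p v + dot u q)| <=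
  (enorm u * enorm v + 2 * C + d * C * (enorm u + enorm v) + C ^+ 2 * d ^+ 2) * x ^+ 2.
Proof.
move=> p1 q1 xd C0; set e := a - p - x *: u; set f := b - q - x *: v => eC fC.
have -> : dot a b - dot p q - x * (dot p v + dot u q) =
    x ^+ 2 * dot u v + (dot p f + dot e q) + x * (dot u f + dot e v) + dot e f.
  by rewrite /e /f !dotE; ring.
have d0 : 0 <= d := le_trans (normr_ge0 x) xd.
have pE : enorm p = 1 by rewrite /enorm p1 sqrtr1.
have qE : enorm q = 1 by rewrite /enorm q1 sqrtr1.
have e0 := enorm_ge0 e; have f0 := enorm_ge0 f.
have u0 := enorm_ge0 u; have v0 := enorm_ge0 v.
have x2 : 0 <= x ^+ 2 := sqr_ge0 x.
have x2d : x ^+ 2 <= d ^+ 2.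
  by rewrite -real_normK ?num_real // ler_sqr ?nnegrE.
have cs := @cauchy_schwarz R m.
have H1 : `|x ^+ 2 * dot u v| <= enorm u * enorm v * x ^+ 2.
  by rewrite normrM (ger0_norm x2) mulrC; apply: ler_wpM2r.
have H2 : `|dot p f + dot e q| <= 2 * C * x ^+ 2.
  apply: (le_trans (ler_normD _ _)); have := cs p f; have := cs e q.
  by rewrite pE qE; lra.
have H3 : `|x * (dot u f + dot e v)| <= d * C * (enorm u + enorm v) * x ^+ 2.
  rewrite normrM -!mulrA; apply: ler_pM => //.
  apply: (le_trans (ler_normD _ _)).
  apply: (@le_trans _ _ (enorm u * (C * x ^+ 2) + C * x ^+ 2 * enorm v)); last by lra.
  apply: lerD; apply: (le_trans (cs _ _)); first exact: ler_wpM2l.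
  exact: ler_wpM2r.
have H4 : `|dot e f| <= C ^+ 2 * d ^+ 2 * x ^+ 2.
  apply: (le_trans (cs _ _)).
  apply: (@le_trans _ _ (C * x ^+ 2 * (C * x ^+ 2))); first exact: ler_pM.
  rewrite (_ : C * _ * _ = C ^+ 2 * x ^+ 2 * x ^+ 2); last by ring.
  by apply: ler_wpM2r => //; apply: ler_wpM2l => //; exact: sqr_ge0.
rewrite ![(_ + _) * x ^+ 2]mulrDl.
apply: (le_trans (ler_normD _ _)); apply: lerD => //.
apply: (le_trans (ler_normD _ _)); apply: lerD => //.
by apply: (le_trans (ler_normD _ _)); apply: lerD.
Qed.

(** The chain rule is applied to [half_acos_sqr], differentiable also at 1; for |x| <= d the chains
    are unit, so their products are at most 1 and it agrees there with arccos squared over 2. *)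
Lemma is_derive_chain_energy (R : realType) (m : nat) (L : R)
    (T : interval_partition L) (t w : nat -> 'rV[R]_m) (F : R -> nat -> 'rV[R]_m)
    (d C : R) : 0 < d -> unit_chain T t ->
  (forall k, (1 <= k < nedges T)%N -> -1 < dot (t k) (t k.+1)) ->
  (forall x, `|x| <= d -> unit_chain T (F x)) ->
  (forall x k, `|x| <= d -> (1 <= k <= nedges T)%N ->
     enorm (F x k - t k - x *: w k) <= C * x ^+ 2) ->
  is_derive (0 : R) (1 : R) (fun x => chain_energy T (F x)) (- pull_work T t w).
Proof.
move=> d0 t1 tN F1 FC.
have F0 k : (1 <= k <= nedges T)%N -> F 0 k = t k.
  move=> kn; have := FC 0 k; rewrite normr0 (ltW d0) expr0n mulr0 scale0r subr0.
  move=> /(_ isT kn) H; apply/eqP; rewrite -subr_eq0; apply/eqP/enorm_eq0/le_anti.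
  by rewrite H enorm_ge0.
have C0 k : (1 <= k <= nedges T)%N -> 0 <= C.
  move=> kn; have := FC d k; rewrite ger0_norm ?(ltW d0) // lexx => /(_ isT kn) H.
  by have := le_trans (enorm_ge0 _) H; rewrite (pmulr_lge0 _ (exprn_gt0 2 d0)).
have D : is_derive (0 : R) (1 : R) (fun x => \sum_(1 <= k < nedges T)
    (lbar T k)^-1 * half_acos_sqr (dot (F x k) (F x k.+1))) (- pull_work T t w).
  rewrite /pull_work -sumrN; apply: is_derive_sum_nat => k kn.
  have k1 : (1 <= k <= nedges T)%N by clear -kn; lia.
  have k2 : (1 <= k.+1 <= nedges T)%N by clear -kn; lia.
  have Dc : is_derive (0 : R) (1 : R) (fun x => dot (F x k) (F x k.+1))
      (dot (t k) (w k.+1) + dot (w k) (t k.+1)).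
    apply: (is_derive_quadratic d0) => x xd; rewrite add0r !F0 //.
    by apply: (dot_quadratic _ _ xd (C0 _ k1)); rewrite ?t1 //; apply: FC.
  have tN' : -1 < dot (F 0 k) (F 0 k.+1) <= 1.
    by rewrite !F0 // tN //; case/andP: (unit_chain_dot t1 kn).
  have Dh := is_derive_half_acos_sqr tN'.
  have Dk := @is_derive1_comp _ (@half_acos_sqr R)
    (fun x => dot (F x k) (F x k.+1)) 0 _ _ Dh Dc.
  have := @is_deriveZ _ _ _ _ (lbar T k)^-1 _ _ _ Dk.
  rewrite !F0 // => Dz; apply: (is_derive_eq Dz).
  by rewrite /pull /GRing.scale /=; ring.
apply: (near_eq_is_derive _ D); near=> x.
have xd : `|x| <= d by near: x; exact: (@nbhs0_le R R^o d d0).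
rewrite /chain_energy mulr_sumr [LHS]big_nat_cond [RHS]big_nat_cond.
apply: eq_bigr => k; rewrite andbT => kn.
have /andP[_ c1] := unit_chain_dot (F1 x xd) kn.
by rewrite /half_acos_sqr c1; ring.
Unshelve. all: by end_near. Qed.

(** * Polygons and chains *)

Section PolygonsAndChains.
Variables (R : realType) (m : nat) (L : R) (T : interval_partition L).
Local Notation n := (nedges T).
Local Notation l := (ell0 T).
Implicit Types (P : polygon m T) (t w : nat -> 'rV[R]_m) (q : 'rV[R]_m).

Lemma unit_enorm (u : 'rV[R]_m) : dot u u = 1 -> enorm u = 1.
Proof. by rewrite /enorm => ->; rewrite sqrtr1. Qed.

Lemma sphere_dot (u : 'rV[R]_m) : sphere u -> dot u u = 1.
Proof. by rewrite -enorm_sqr => ->; rewrite expr1n. Qed.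

Definition chain_polygon q t : polygon m T :=
  \matrix_(i < n.+1) (q + \sum_(1 <= j < i.+1) l j *: t j).

Lemma at_vtx_chain q t k : (k <= n)%N ->
  at_vtx (chain_polygon q t) k = q + \sum_(1 <= j < k.+1) l j *: t j.
Proof. by move=> kn; rewrite /at_vtx rowK inordK. Qed.

Lemma edge_chain q t k : (1 <= k <= n)%N ->
  at_vtx (chain_polygon q t) k - at_vtx (chain_polygon q t) k.-1 = l k *: t k.
Proof.
case: k => // k /andP[_ kn]; rewrite !at_vtx_chain //=; last exact: ltnW.
by rewrite big_nat_recr //= addrA [LHS]addrC addKr.
Qed.

Lemma ell_chain q t k : unit_chain T t -> (1 <= k <= n)%N ->
  ell (chain_polygon q t) k = l k.
Proof.
move=> t1 kn; rewrite /ell edge_chain // enormZ unit_enorm ?t1 // mulr1.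
by rewrite gtr0_norm // ell0_gt0.
Qed.

Lemma tau_chain q t k : unit_chain T t -> (1 <= k <= n)%N ->
  tau (chain_polygon q t) k = t k.
Proof.
move=> t1 kn; rewrite /tau /Dvtx edge_chain // ell_chain // scalerA mulVf ?scale1r //.
by rewrite gt_eqF // ell0_gt0.
Qed.

Lemma at_vtx_last_chain q t :
  at_vtx (chain_polygon q t) n = q + chain_sum T t.
Proof. by rewrite at_vtx_chain. Qed.

Lemma at_vtx_first_chain q t : at_vtx (chain_polygon q t) 0 = q.
Proof. by rewrite at_vtx_chain // big_geq // addr0. Qed.

(** If the quotient is not positive, both sides take the default value 0. *)
Lemma fine_sigmaE P k : fine (sigma P k) = ln (ell P k / l k).
Proof. by rewrite /sigma /=; case: ifP => //= /ln0. Qed.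

Lemma Phi_chain q qL N0 NL t : unit_chain T t -> (0 < n)%N ->
  Phi q qL N0 NL (chain_polygon q t) =
  (0, q + chain_sum T t - qL, t 1%N - N0, t n - NL, 0).
Proof.
move=> t1 n0; rewrite /Phi at_vtx_first_chain at_vtx_last_chain subrr.
rewrite !tau_chain ?n0 ?leqnn //; congr (_, _, _, _, _).
apply/rowP => j; have jn : (1 <= j.+1 <= n)%N by rewrite /= ltn_ord.
by rewrite !mxE fine_sigmaE ell_chain // divff ?ln1 // gt_eqF // ell0_gt0.
Qed.

Lemma feasible_chain q qL N0 NL t : unit_chain T t -> (0 < n)%N ->
  t 1%N = N0 -> t n = NL -> q + chain_sum T t = qL ->
  feasible T q qL N0 NL (chain_polygon q t).
Proof.
move=> t1 n0 tN0 tNL tL; split=> [k kn|].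
  rewrite /sigma ell_chain // divff; last by rewrite gt_eqF // ell0_gt0.
  by rewrite lne1 abse0 ltry.
by rewrite /= Phi_chain // tN0 tNL tL !subrr.
Qed.

Section Feasible.
Variables (q0 qL N0 NL : 'rV[R]_m) (P : polygon m T).
Hypothesis fP : feasible T q0 qL N0 NL P.

Lemma feasible_ell k : (1 <= k <= n)%N -> ell P k = l k.
Proof.
move=> kn; have l0 := ell0_gt0 kn; have [/(_ k kn) sk /=] := fP.
rewrite /Phi => -[_ _ _ _ /rowP sE].
have kn' : (k.-1 < n)%N by clear -kn; lia.
have := sE (Ordinal kn'); rewrite !mxE /= (_ : k.-1.+1 = k); last by clear -kn; lia.
rewrite fine_sigmaE => /eqP.
(* The vanishing constraint alone would allow a degenerate edge, since [fine] maps -oo to 0;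
   finiteness of [sigma] excludes it. *)
have r0 : 0 < ell P k / l k.
  by move: sk; rewrite /sigma /= ltNge; case: (lerP (ell P k / l k) 0).
rewrite ln_eq0 // => /eqP /(congr1 (fun x => x * l k)).
by rewrite divfK ?mul1r // gt_eqF.
Qed.

Lemma feasible_edge k : (1 <= k <= n)%N ->
  at_vtx P k - at_vtx P k.-1 = l k *: tau P k.
Proof.
move=> kn; rewrite /tau /Dvtx feasible_ell // scalerA divff ?scale1r //.
by rewrite gt_eqF // ell0_gt0.
Qed.

Lemma feasible_unit : unit_chain T (tau P).
Proof.
move=> k kn; rewrite -enorm_sqr /tau /Dvtx enormZ -/(ell P k) feasible_ell //.
rewrite ger0_norm ?invr_ge0 ?(ltW (ell0_gt0 kn)) // mulVf ?expr1n //.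
by rewrite gt_eqF // ell0_gt0.
Qed.

Lemma feasible_ends :
  [/\ at_vtx P 0 = q0, at_vtx P n = qL, tau P 1 = N0 & tau P n = NL].
Proof.
have [_ /=] := fP; rewrite /Phi => -[/eqP + /eqP + /eqP + /eqP + _].
by rewrite !subr_eq0 => /eqP -> /eqP -> /eqP -> /eqP ->.
Qed.

Lemma feasible_partial_sum k : (k <= n)%N ->
  \sum_(1 <= j < k.+1) l j *: tau P j = at_vtx P k - q0.
Proof.
have [<- _ _ _] := feasible_ends; elim: k => [|k IH] kn.
  by rewrite big_geq // subrr.
rewrite big_nat_recr //= IH; last exact: ltnW.
by rewrite -feasible_edge ?kn //= [LHS]addrC subrKA.
Qed.

Lemma feasible_sum : chain_sum T (tau P) = qL - q0.
Proof. by rewrite /chain_sum feasible_partial_sum //; have [_ -> _ _] := feasible_ends. Qed.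

Lemma feasible_chain_polygon : chain_polygon q0 (tau P) = P.
Proof.
apply/row_matrixP => i; rewrite rowK feasible_partial_sum -1?ltnS //.
by rewrite addrC subrK /at_vtx inord_val.
Qed.

Lemma feasible_ellbar k : (1 <= k < n)%N -> ellbar P k = lbar T k.
Proof.
by move=> kn; rewrite /ellbar /lbar !feasible_ell //; clear -kn; lia.
Qed.

Lemma feasible_energy : energy P = chain_energy T (tau P).
Proof.
rewrite /energy /chain_energy; congr (_ * _); apply: eq_big_nat => k kn.
rewrite feasible_ellbar // /alpha /angle !unit_enorm ?mulr1 ?divr1 //;
by apply: feasible_unit; clear -kn; lia.
Qed.

Lemma feasible_bend k : (1 <= k < n)%N -> D2 P k = bend T (tau P) k.
Proof. by move=> kn; rewrite /D2 /Dedge feasible_ellbar. Qed.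

End Feasible.
End PolygonsAndChains.

(** * Differentiability of the constraint map *)

Section PhiDifferentiable.
Variable R : realType.

Lemma differentiable_rowP (V : normedModType R) p (f : V -> 'rV[R]_p) x :
  (forall j, differentiable (fun y => f y 0 j) x) -> differentiable f x.
Proof.
move=> fx.
rewrite (_ : f = \sum_(j < p) (fun y => f y 0 j *: delta_mx 0 j)).
  by apply: differentiable_sum => j; apply: differentiableZl.
by apply/funext => y; rewrite fct_sumE {1}[f y]row_sum_delta.
Qed.

Lemma differentiable_dot (V : normedModType R) p (f g : V -> 'rV[R]_p) x :
  (forall j, differentiable (fun y => f y 0 j) x) ->
  (forall j, differentiable (fun y => g y 0 j) x) ->
  differentiable (fun y => dot (f y) (g y)) x.
Proof.
move=> fx gx; rewrite /dot.
rewrite (_ : (fun _ => _) = \sum_(j < p) (fun y => f y 0 j * g y 0 j)).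
  by apply: differentiable_sum => j; apply: differentiableM.
by apply/funext => y; rewrite fct_sumE.
Qed.

Lemma differentiable_enorm (V : normedModType R) p (f : V -> 'rV[R]_p) x :
  (forall j, differentiable (fun y => f y 0 j) x) -> 0 < dot (f x) (f x) ->
  differentiable (fun y => enorm (f y)) x.
Proof.
move=> fx f0; apply: (@differentiable_comp _ _ _ _ (fun y => dot (f y) (f y)) Num.sqrt).
  exact: differentiable_dot.
by apply/derivable1_diffP; have [] := is_derive1_sqrt f0.
Qed.

Variables (m : nat) (L : R) (T : interval_partition L).
Local Notation n := (nedges T).

Lemma differentiable_at_vtx (P : polygon m T) k j :
  differentiable (fun Q : polygon m T => at_vtx Q k 0 j) P.
Proof.
rewrite (_ : (fun _ => _) = (fun Q : polygon m T => Q (inord k) j)).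
  exact: differentiable_coord.
by apply/funext => Q; rewrite mxE.
Qed.

Lemma differentiable_edge (P : polygon m T) k j :
  differentiable (fun Q : polygon m T => (at_vtx Q k - at_vtx Q k.-1) 0 j) P.
Proof.
rewrite (_ : (fun _ => _) = (fun Q : polygon m T => at_vtx Q k 0 j) -
   (fun Q : polygon m T => at_vtx Q k.-1 0 j)).
  by apply: differentiableB; apply: differentiable_at_vtx.
by apply/funext => Q; rewrite [LHS]mxE [X in _ + X = _]mxE.
Qed.

Lemma differentiable_ell (P : polygon m T) k : 0 < ell P k ->
  differentiable (fun Q : polygon m T => ell Q k) P.
Proof.
move=> l0; apply: differentiable_enorm => [j|]; first exact: differentiable_edge.
by rewrite -enorm_sqr exprn_gt0.
Qed.

Lemma differentiable_tau (P : polygon m T) k : 0 < ell P k ->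
  differentiable (fun Q : polygon m T => tau Q k) P.
Proof.
move=> l0; apply: differentiable_rowP => j.
rewrite (_ : (fun _ => _) = (fun Q : polygon m T =>
   (ell Q k)^-1 * (at_vtx Q k - at_vtx Q k.-1) 0 j)).
  apply: differentiableM; last exact: differentiable_edge.
  by apply: differentiableV; [exact: differentiable_ell | rewrite gt_eqF].
by apply/funext => Q; rewrite /tau /Dvtx mxE.
Qed.

Lemma differentiable_Phi q0 qL N0 NL (P : polygon m T) : (0 < n)%N ->
  (forall k, (1 <= k <= n)%N -> 0 < ell P k) ->
  differentiable (Phi q0 qL N0 NL : polygon m T -> _) P.
Proof.
move=> n0 l0.
have vtxB k q : differentiable (fun Q : polygon m T => at_vtx Q k - q) P.
  by apply: differentiableB => //; apply: differentiable_rowP => j; apply: differentiable_at_vtx.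
have tauB k q : (1 <= k <= n)%N -> differentiable (fun Q : polygon m T => tau Q k - q) P.
  by move=> kn; apply: differentiableB => //; apply: differentiable_tau; apply: l0.
apply: differentiable_pair; first apply: differentiable_pair; first apply: differentiable_pair;
  first apply: differentiable_pair.
- exact: vtxB.
- exact: vtxB.
- by apply: tauB; rewrite n0.
- by apply: tauB; rewrite n0 leqnn.
apply: differentiable_rowP => j.
rewrite (_ : (fun _ => _) = ((@ln R) \o (fun Q : polygon m T => ell Q j.+1 / ell0 T j.+1))).
  have jn : (1 <= j.+1 <= n)%N by rewrite /= ltn_ord.
  apply: differentiable_comp.
    by apply: differentiableM => //; apply: differentiable_ell; apply: l0.
  apply/derivable1_diffP; apply: ex_derive; apply: is_derive1_ln.
  by rewrite divr_gt0 // ?l0 // ell0_gt0.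
by apply/funext => Q; rewrite mxE fine_sigmaE.
Qed.

End PhiDifferentiable.

(** * Critical points are stationary *)

Section SphereChart.
Variables (R : realType) (m : nat).
Implicit Types (u z : 'rV[R]_m).

(* The graph chart of the unit sphere over its tangent space at u. *)
Definition cap u z : 'rV[R]_m := Num.sqrt (1 - dot z z) *: u + z.

Lemma cap0 u : cap u 0 = u.
Proof. by rewrite /cap dot0l subr0 sqrtr1 scale1r addr0. Qed.

Lemma cap_unit u z : dot u u = 1 -> dot u z = 0 -> dot z z <= 1 ->
  dot (cap u z) (cap u z) = 1.
Proof.
move=> u1 uz z1; rewrite /cap !dotE u1 (dotC z u) uz !mulr0 mulr1 addr0 add0r.
by rewrite -expr2 sqr_sqrtr ?subrK // subr_ge0.
Qed.

Lemma cap_err u z : dot u u = 1 -> dot z z <= 1 ->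
  enorm (cap u z - u - z) <= dot z z.
Proof.
move=> u1 z1; rewrite (_ : _ - z = (Num.sqrt (1 - dot z z) - 1) *: u); last first.
  by apply/rowP => i; rewrite !mxE; ring.
rewrite enormZ unit_enorm // mulr1.
have z0 := dot_ge0 z; have s0 := sqrtr_ge0 (1 - dot z z).
have s2 : Num.sqrt (1 - dot z z) ^+ 2 = 1 - dot z z by rewrite sqr_sqrtr // subr_ge0.
have s1 : Num.sqrt (1 - dot z z) <= 1.
  by rewrite -(@ler_sqr _ _ 1) ?nnegrE // s2 expr1n; lra.
by rewrite ler0_norm; nra.
Qed.

End SphereChart.

Section Critical.
Variables (R : realType) (m : nat) (L : R) (T : interval_partition L).
Hypothesis L0 : 0 < L.
Local Notation n := (nedges T).
Local Notation l := (ell0 T).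
Implicit Types (t w f : nat -> 'rV[R]_m).

Lemma enorm_partial_sum f (e : R) k : 0 <= e -> (k <= n)%N ->
  (forall j, (1 <= j <= n)%N -> enorm (f j) <= e) ->
  enorm (\sum_(1 <= j < k.+1) l j *: f j) <= L * e.
Proof.
move=> e0 kn fe; apply: (le_trans (enorm_sum _ _ _)).
apply: (@le_trans _ _ (\sum_(1 <= j < k.+1) l j * e)).
  apply: ler_sum_nat0 => j jk; have jn : (1 <= j <= n)%N by clear -jk kn; lia.
  have l0 := ell0_gt0 jn.
  by rewrite enormZ gtr0_norm //; apply: ler_wpM2l; [exact: ltW | exact: fe].
rewrite -mulr_suml sum_ell0; apply: ler_wpM2r => //.
by rewrite -[leRHS](vtx_last T); apply: vtx_le; rewrite kn leqnn.
Qed.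

Lemma chain_polygon_err q t w f (x e : R) : 0 <= e ->
  (forall j, (1 <= j <= n)%N -> enorm (f j - t j - x *: w j) <= e) ->
  `|chain_polygon T q f - chain_polygon T q t - x *: chain_polygon T 0 w| <= L * e.
Proof.
move=> e0 fe; rewrite [leLHS]mx_normrE; apply: bigmax_le => [|[i j] _] /=.
  by rewrite mulr_ge0 // ltW.
have E : row i (chain_polygon T q f - chain_polygon T q t - x *: chain_polygon T 0 w)
    = \sum_(1 <= k < i.+1) l k *: (f k - t k - x *: w k).
  rewrite !linearB linearZ /= !rowK add0r scaler_sumr opprD addrACA subrr add0r.
  rewrite -!sumrB; apply: eq_bigr => k _.
  by rewrite !scalerBr !scalerA mulrC.
have := coord_le_enorm (row i (chain_polygon T q f - chain_polygon T q t -
  x *: chain_polygon T 0 w)) j.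
rewrite {1}mxE => /le_trans; apply; rewrite E.
by apply: enorm_partial_sum => //; rewrite -ltnS.
Qed.

(** The curve x |-> [cap] (tau_k, x w_k) consists of unit chains with velocity w. The corresponding
    polygons have velocity U in the kernel of the differential of [Phi], so the derivative of the
    energy along them, which is minus the work of w, is zero. *)
Lemma critical_stationary q0 qL N0 NL (P : polygon m T) :
  critical q0 qL N0 NL P ->
  (forall k, (1 <= k < n)%N -> -1 < dot (tau P k) (tau P k.+1)) ->
  stationary T (tau P).
Proof.
move=> [fP dE crit] tN w tw w1 wn wS.
have n0 := nedges_gt0 T L0.
have t1 := feasible_unit fP.
have [PA PB tA tB] := feasible_ends fP.
pose W := \sum_(1 <= k < n.+1) dot (w k) (w k).
have wW k : (1 <= k <= n)%N -> dot (w k) (w k) <= W.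
  move=> kn; rewrite -[leLHS](@big_nat1 _ 0 +%R k (fun k => dot (w k) (w k))).
  apply: ler_sum_nat_sub; [by clear -kn; lia | by clear -kn; lia |].
  by move=> i _; exact: dot_ge0.
have W0 : 0 <= W by apply: sumr_ge0 => k _; exact: dot_ge0.
have W1 : 0 < 1 + W by lra.
(* This d keeps x w_k in the closed unit ball, the domain of the sphere chart, for |x| <= d. *)
have [d [d0 d1 dW]] : exists d : R, [/\ 0 < d, d <= 1 & d * (1 + W) = 1].
  exists (1 + W)^-1; rewrite invr_gt0 W1 mulVf ?gt_eqF //; split=> //.
  by rewrite invf_le1 // lerDl.
have xW x : `|x| <= d -> x ^+ 2 * W <= 1.
  move=> xd; rewrite -dW.
  apply: ler_pM => //; [exact: sqr_ge0 | | lra].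
  rewrite -real_normK ?num_real //; apply: le_trans (xd).
  by rewrite expr2 ler_piMl // (le_trans xd d1).
pose F (x : R) k := cap (tau P k) (x *: w k).
have zz x k : `|x| <= d -> (1 <= k <= n)%N -> dot (x *: w k) (x *: w k) <= W * x ^+ 2 /\
    dot (x *: w k) (x *: w k) <= 1.
  move=> xd kn; have H : dot (x *: w k) (x *: w k) <= W * x ^+ 2.
    rewrite !dotE mulrA -expr2 mulrC; apply: ler_wpM2r; first exact: sqr_ge0.
    exact: wW.
  by split => //; apply: le_trans H _; rewrite mulrC; exact: xW.
have F1 x : `|x| <= d -> unit_chain T (F x).
  move=> xd k kn; apply: cap_unit; first exact: t1.
    by rewrite dotZr tw // mulr0.
  by case: (zz x k xd kn).
have FW x k : `|x| <= d -> (1 <= k <= n)%N ->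
    enorm (F x k - tau P k - x *: w k) <= W * x ^+ 2.
  move=> xd kn; have [z1 z2] := zz x k xd kn.
  exact: le_trans (cap_err (t1 k kn) z2) z1.
have DE := is_derive_chain_energy d0 t1 tN F1 FW.
pose g (x : R) : polygon m T := chain_polygon T q0 (F x).
pose U : polygon m T := chain_polygon T 0 w.
have g0 : g 0 = P.
  rewrite /g -[RHS](feasible_chain_polygon fP); congr (chain_polygon T q0 _).
  by apply/funext => k; rewrite /F scale0r cap0.
have Dg : is_derive (0 : R) (1 : R) g U.
  apply: (@is_derive_quadratic _ _ _ _ d (L * W)) => // x xd.
  rewrite add0r g0 -{1}(feasible_chain_polygon fP) -mulrA.
  by apply: chain_polygon_err => [|j jn]; [rewrite mulr_ge0 ?sqr_ge0 | exact: FW].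
have dg : differentiable g 0 by apply/derivable1_diffP; case: Dg.
have dgU : 'd g 0 1 = U.
  by rewrite -deriveE //; case: Dg.
have dPhi : differentiable (Phi q0 qL N0 NL : polygon m T -> _) (g 0).
  rewrite g0; apply: differentiable_Phi => // k kn.
  by rewrite (feasible_ell fP) // ell0_gt0.
(* Edge lengths, left end and end tangents are kept exactly; the right end moves by O(x^2) because w
   satisfies the linear closing condition. *)
have DPhi : is_derive (0 : R) (1 : R) (Phi q0 qL N0 NL \o g) 0.
  apply: (@is_derive_quadratic _ _ _ _ d (L * W)) => // x xd.
  have F1N : F x 1%N = N0 by rewrite /F w1 scaler0 cap0.
  have FnN : F x n = NL by rewrite /F wn scaler0 cap0.
  rewrite add0r scaler0 subr0 /= g0; have [_ /= ->] := fP; rewrite subr0.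
  rewrite /g Phi_chain //; last exact: F1.
  rewrite F1N FnN !subrr.
  set v := _ - qL; suff vle : `|v| <= L * W * x ^+ 2.
    have X0 : 0 <= L * W * x ^+ 2 by apply: le_trans vle.
    by rewrite prod_normE /= prod_normE /= prod_normE /= prod_normE /= !normr0 !ge_max vle X0.
  apply: le_trans (norm_le_enorm _) _; rewrite -mulrA.
  rewrite (_ : v = \sum_(1 <= j < n.+1) l j *: (F x j - tau P j - x *: w j)).
    by apply: enorm_partial_sum => // [|j jn]; [rewrite mulr_ge0 ?sqr_ge0 | exact: FW].
  have wS' : \sum_(1 <= j < n.+1) l j *: (x *: w j) = 0.
    transitivity (x *: chain_sum T w); last by rewrite wS scaler0.
    by rewrite scaler_sumr; apply: eq_bigr => j _; rewrite !scalerA mulrC.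
  under [RHS]eq_bigr => j _ do rewrite !scalerBr.
  rewrite !sumrB wS' subr0 -/(chain_sum T (tau P)) (feasible_sum fP) /v.
  by rewrite opprB addrCA addrA.
have dU : 'd (Phi q0 qL N0 NL : polygon m T -> _) P U = 0.
  have E : 'd (Phi q0 qL N0 NL \o g) 0 = 'd (Phi q0 qL N0 NL) (g 0) \o 'd g 0 :> (R -> _).
    exact: diff_comp.
  rewrite -g0 -dgU; transitivity ('d (Phi q0 qL N0 NL \o g) 0 1); first by rewrite E.
  rewrite -deriveE; last exact: differentiable_comp.
  by case: DPhi.
have dEg : differentiable (@energy R m L T) (g 0) by rewrite g0.
have DEg : 'D_1 (@energy R m L T \o g) (0 : R) = 0.
  rewrite deriveE; last exact: differentiable_comp.
  by rewrite diff_comp //= dgU g0; apply: crit.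
suff : is_derive (0 : R) (1 : R) (@energy R m L T \o g) (- pull_work T (tau P) w).
  by case=> _; rewrite DEg => /esym/eqP; rewrite oppr_eq0 => /eqP.
apply: (near_eq_is_derive _ DE); near=> x.
have xd : `|x| <= d by near: x; exact: (@nbhs0_le R R^o d d0).
(* The polygon is feasible for a displaced right end, which suffices to express its energy through
   its tangents. *)
have fg : feasible T q0 (q0 + chain_sum T (F x)) N0 NL (g x).
  by apply: feasible_chain => //; [exact: F1 | rewrite /F w1 scaler0 cap0
    | rewrite /F wn scaler0 cap0].
rewrite /= (feasible_energy fg) /chain_energy; congr (_ * _).
apply: eq_big_nat => k kn; rewrite !tau_chain //; try exact: F1.
  by clear -kn; lia.
by clear -kn; lia.
Unshelve. all: by end_near. Qed.

End Critical.

(** * Minimizers are stationary *)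

(* The instance required by banach_fixed_point, missing in the library. *)
HB.instance Definition _ (R : realType) (m n : nat) := Complete.on 'M[R]_(m, n).

(** * Restoring the closing condition by a contraction *)

Section Correction.
Variables (R : realType) (m : nat).
Implicit Types (u z : 'rV[R]_m).

Lemma dot_le_sqr u a : enorm u <= a -> dot u u <= a ^+ 2.
Proof. by move=> ua; rewrite -enorm_le // (le_trans (enorm_ge0 u)). Qed.

Lemma sqrt_dist_le (a b : R) : a <= 1 / 4 -> b <= 1 / 4 ->
  `|Num.sqrt (1 - a) - Num.sqrt (1 - b)| <= `|a - b|.
Proof.
move=> a4 b4; have H (x : R) : x <= 1 / 4 -> 1 / 2 <= Num.sqrt (1 - x) /\
    Num.sqrt (1 - x) ^+ 2 = 1 - x.
  move=> x4; rewrite sqr_sqrtr; last by lra.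
  split=> //; rewrite -(@ler_sqr _ (1 / 2)) ?nnegrE ?sqrtr_ge0 //.
  by rewrite sqr_sqrtr; lra.
have [A A2] := H a a4; have [B B2] := H b b4.
move: (Num.sqrt (1 - a)) (Num.sqrt (1 - b)) A A2 B B2 => s r s2 sE r2 rE.
have -> : a - b = (r - s) * (r + s).
  by rewrite (_ : (r - s) * _ = r ^+ 2 - s ^+ 2); [lra | ring].
rewrite normrM distrC ler_peMr // ger0_norm; lra.
Qed.

Lemma closed_enorm_ball (a : R) : 0 <= a ->
  closed [set u : 'rV[R]_m | enorm u <= a].
Proof.
move=> a0; rewrite (_ : [set u | _] = (fun u => dot u u) @^-1` [set x | x <= a ^+ 2]).
  apply: (@preimage_closed _ _ _ _ _ (@closed_le R (a ^+ 2))) => v _.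
  apply: differentiable_continuous; apply: differentiable_dot => j;
    exact: differentiable_coord.
by apply/seteqP; split => u /=; rewrite enorm_le.
Qed.

Variables (L : R) (T : interval_partition L).
Hypothesis L0 : 0 < L.
Local Notation n := (nedges T).
Local Notation l := (ell0 T).
Implicit Types (t x : nat -> 'rV[R]_m).

Lemma enorm_tent_field t s k : unit_chain T t -> (1 <= k <= n)%N ->
  enorm (tent_field T t s k) <= L * enorm s.
Proof.
move=> t1 kn; rewrite enormZ ger0_norm ?tent_ge0 //.
by apply: ler_pM; rewrite ?tent_ge0 ?enorm_ge0 ?tent_le ?enorm_tproj ?t1.
Qed.

Lemma dot_tent_field t s k : unit_chain T t -> (1 <= k <= n)%N ->
  dot (t k) (tent_field T t s k) = 0.
Proof. by move=> t1 kn; rewrite dotZr dot_tproj ?t1 // mulr0. Qed.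

Lemma tent_fieldB t s s' k :
  tent_field T t s k - tent_field T t s' k = tent_field T t (s - s') k.
Proof.
rewrite /tent_field /tproj dotBr; apply/rowP => i; rewrite !mxE; ring.
Qed.

(** Since cap(t, z) = t + z + O(|z|^2) t, the equation for s reads s B = y - G(s), with B the tent
    matrix and G the quadratic part. The three bounds on eps + L rad, in this order, keep the square
    roots 1-Lipschitz, give the contraction factor 1/2, and map the ball of radius rad into
    itself. *)
Lemma closing_correction t x c (eps rad : R) (Delta : 'rV[R]_m) :
  unit_chain T t -> 0 < c -> tent_coercive T t c ->
  (forall k, (1 <= k <= n)%N -> dot (t k) (x k) = 0) ->
  (forall k, (1 <= k <= n)%N -> enorm (x k) <= eps) ->
  0 <= rad -> eps + L * rad <= 1 / 2 ->
  4 * m%:R * L ^+ 2 * (eps + L * rad) <= c ->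
  enorm (Delta - chain_sum T (fun k => t k + x k)) + L * (eps + L * rad) ^+ 2
    <= c * rad ->
  exists2 s, enorm s <= rad &
    chain_sum T (fun k => cap (t k) (x k + tent_field T t s k)) = Delta.
Proof.
move=> t1 c0 tc tx xe rad0; have Lp := L0.
have eps0 : 0 <= eps.
  have n1 := nedges_gt0 T L0.
  by apply: le_trans (enorm_ge0 (x 1%N)) (xe 1%N _); rewrite n1.
set rho := eps + L * rad => rh rc rr.
have rho0 : 0 <= rho by rewrite addr_ge0 // mulr_ge0 // ltW.
have [B' [B'B B'c]] := coercive_inverse c0 (tent_mx_coercive tc).
pose y := Delta - chain_sum T (fun k => t k + x k).
pose z s k := x k + tent_field T t s k.
pose G s := chain_sum T (fun k => (Num.sqrt (1 - dot (z s k) (z s k)) - 1) *: t k).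
pose f s := (y - G s) *m B'.
have zr s k : enorm s <= rad -> (1 <= k <= n)%N -> enorm (z s k) <= rho.
  move=> sr kn; apply: (le_trans (enormD _ _)); apply: lerD; first exact: xe.
  apply: (le_trans (enorm_tent_field s t1 kn)); apply: ler_wpM2l => //; exact: ltW.
have z4 s k : enorm s <= rad -> (1 <= k <= n)%N -> dot (z s k) (z s k) <= 1 / 4.
  by move=> sr kn; have := dot_le_sqr (zr s k sr kn); nra.
have fU s : enorm s <= rad -> enorm (f s) <= rad.
  move=> sr; apply: (le_trans (B'c _)); rewrite ler_pdivrMr // mulrC.
  apply: le_trans rr; apply: (le_trans (enormB _ _)); rewrite lerD2l.
  apply: enorm_partial_sum => //; first exact: sqr_ge0.
  move=> k kn; rewrite enormZ unit_enorm ?t1 // mulr1.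
  have := sqrt_dist_le (z4 s k sr kn) (_ : 0 <= 1 / 4); rewrite subr0 sqrtr1 subr0.
  rewrite (ger0_norm (dot_ge0 _)) => H; apply: (le_trans (H _)); first by lra.
  by apply: dot_le_sqr; apply: zr.
have Glip s s' : enorm s <= rad -> enorm s' <= rad ->
    enorm (G s - G s') <= L * (2 * rho * (L * enorm (s - s'))).
  move=> sr sr'; rewrite /G /chain_sum -sumrB.
  under eq_bigr => k _ do rewrite -scalerBr -scalerBl.
  apply: enorm_partial_sum => //.
    by rewrite !mulr_ge0 ?enorm_ge0 // ltW.
  move=> k kn; rewrite enormZ unit_enorm ?t1 // mulr1 opprB addrA subrK.
  apply: (le_trans (sqrt_dist_le (z4 s k sr kn) (z4 s' k sr' kn))).
  have -> : dot (z s k) (z s k) - dot (z s' k) (z s' k) =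
      dot (z s k + z s' k) (z s k - z s' k).
    by move: (z s k) (z s' k) => a b; rewrite !dotE (dotC b a); ring.
  apply: (le_trans (cauchy_schwarz _ _)); apply: ler_pM; rewrite ?enorm_ge0 //.
    by apply: (le_trans (enormD _ _)); rewrite mulr_natl mulr2n; apply: lerD; apply: zr.
  rewrite /z opprD addrACA subrr add0r tent_fieldB.
  exact: enorm_tent_field.
pose U := [set s : 'rV[R]_m | enorm s <= rad].
have fUU : {homo f : s / U s >-> U s} by move=> s; apply: fU.
have [s sU sE] : exists2 s, U s & s = f s.
  apply: (@banach_fixed_point R _ U (mkfun_fun fUU)).
  - exists (1 / 2)%:nng; split => /=; first by lra.
    move=> [s s'] /= [sU sU'].
    apply: (le_trans (norm_le_enorm _)); rewrite /mkfun_fun /mkfun /f -mulmxBl.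
    apply: (le_trans (B'c _)); rewrite ler_pdivrMr //.
    have -> : y - G s - (y - G s') = G s' - G s.
      by move: (G s) (G s') => a b; rewrite opprB addrCA addrAC subrr add0r.
    (* The fixed point theorem measures distances in the sup norm; the comparison with the Euclidean
       norm costs the factor m. *)
    apply: (le_trans _ (_ : L * (2 * rho * (L * (m%:R * `|s - s'|))) <= _)).
      rewrite enormBC; apply: (le_trans (Glip s s' sU sU')).
      do 2 (apply: ler_wpM2l; first by rewrite ?mulr_ge0 // ltW).
      by apply: ler_wpM2l; [exact: ltW | exact: enorm_le_norm].
    rewrite (_ : L * _ = 4 * m%:R * L ^+ 2 * rho * (1 / 2 * `|s - s'|)); last by field.
    by rewrite [leRHS]mulrC; apply: ler_wpM2r => //; apply: mulr_ge0 => //; lra.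
  - exact: closed_enorm_ball.
  - by exists 0; rewrite /U /= enorm0.
exists s => //.
have sB : chain_sum T (tent_field T t s) = y - G s by rewrite -tent_mxE {1}sE B'B.
rewrite (_ : Delta = y + chain_sum T (fun k => t k + x k)); last by rewrite subrK.
rewrite -(subrK (G s) y) -sB /G /chain_sum -!big_split /=.
apply: eq_bigr => k _; rewrite -!scalerDr; congr (_ *: _).
by rewrite /cap -/(z s k); apply/rowP => i; rewrite /z !mxE; ring.
Qed.

End Correction.

Lemma is_derive_local_min (R : realType) (f : R -> R) (b d : R) : 0 < d ->
  is_derive (0 : R) (1 : R) f b -> (forall x, `|x| <= d -> f 0 <= f x) -> b = 0.
Proof.
move=> d0 [fd fb] fmin; apply/eqP; rewrite -[_ == _]negbK; apply/negP => b0.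
have : (fun h => h^-1 *: ((f \o shift 0) (h *: 1) - f 0)) @ 0^' --> b.
  by rewrite -fb; exact: fd.
move/cvgrPdist_lt => /(_ `|b|); rewrite normr_gt0 => /(_ b0) [e /= e0 H].
(* With h of sign opposite to b, the quotient (f h - f 0) / h also has sign opposite to b or
   vanishes, so it is at distance at least |b| from b. *)
pose h := - Num.sg b * (Num.min e d / 2).
have m0 : 0 < Num.min e d by rewrite lt_min e0.
have sg1 : `|Num.sg b| = 1 by rewrite normr_sg b0.
have hE : `|h| = Num.min e d / 2.
  by rewrite normrM normrN sg1 mul1r ger0_norm // ltW // divr_gt0.
have he : `|h| < e.
  by rewrite hE; have : Num.min e d <= e by [rewrite ge_min lexx]; lra.
have hd : `|h| <= d.
  by rewrite hE; have : Num.min e d <= d by [rewrite ge_min lexx orbT]; lra.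
have h0 : h != 0 by rewrite -normr_gt0 hE divr_gt0.
have := H h; rewrite /= sub0r normrN => /(_ he h0).
rewrite /= addr0 [h *: 1]mulr1 /GRing.scale /=.
have := fmin h hd; rewrite -subr_ge0; set D := f h - f 0 => D0.
apply/negP; rewrite -leNgt.
have hb : h^-1 * D = - (Num.sg b * (`|h|^-1 * D)).
  rewrite hE /h invrM ?unitfE ?oppr_eq0 ?sgr_eq0 ?b0 ?gt_eqF ?divr_gt0 //.
  by rewrite invrN invr_sg; ring.
have X0 : 0 <= `|h|^-1 * D by rewrite mulr_ge0 // invr_ge0.
rewrite hb opprK; move: (`|h|^-1 * D) X0 => X X0.
rewrite (_ : b + _ = Num.sg b * (`|b| + X)); last by rewrite mulrDr mulr_sg_norm.
by rewrite normrM sg1 mul1r ger0_norm ?lerDl // addr_ge0.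
Qed.

Section Minimizers.
Variables (R : realType) (m : nat) (L : R) (T : interval_partition L).
Hypothesis L0 : 0 < L.
Local Notation n := (nedges T).
Local Notation l := (ell0 T).

(** Each admissible w is the velocity of a curve of feasible chains: x w is corrected by a tent
    field of size O(x^2). The energy along this curve is least at x = 0, so its derivative there
    vanishes. *)
Lemma minimizer_stationary q0 qL N0 NL (P : polygon m T) c :
  minimizers T q0 qL N0 NL P -> 0 < c -> tent_coercive T (tau P) c ->
  (forall k, (1 <= k < n)%N -> -1 < dot (tau P k) (tau P k.+1)) ->
  stationary T (tau P).
Proof.
move=> [fP minP] c0 tc tN w tw w1 wn wS; have Lp := L0.
have n0 := nedges_gt0 T L0.
have t1 := feasible_unit fP.
have [PA PB tA tB] := feasible_ends fP.
pose W := \sum_(1 <= k < n.+1) enorm (w k).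
have wW k : (1 <= k <= n)%N -> enorm (w k) <= W.
  move=> kn; rewrite -[leLHS](@big_nat1 _ 0 +%R k (fun k => enorm (w k))).
  apply: ler_sum_nat_sub; [by clear -kn; lia | by clear -kn; lia |].
  by move=> i _; exact: enorm_ge0.
have W0 : 0 <= W by apply: sumr_ge0 => k _; exact: enorm_ge0.
(* As soon as L C |x| <= 1, the total shift |x| W + L C x^2 is at most |x| (W + 1), and its
   quadratic defect at most L (W + 1)^2 x^2 = c (C x^2): the radius C x^2 is then large enough for
   the contraction. *)
have [C [C0 CE]] : exists C, 0 < C /\ c * C = L * (W + 1) ^+ 2.
  exists (L * (W + 1) ^+ 2 / c); split; last by field; exact: lt0r_neq0.
  by rewrite divr_gt0 // mulr_gt0 // exprn_gt0 //; lra.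
have [d [d0 d1 d2 d3]] : exists d : R, [/\ 0 < d, L * C * d <= 1,
    d * (W + 1) <= 1 / 2 & 4 * m%:R * L ^+ 2 * (d * (W + 1)) <= c].
  have LC : 0 < L * C by rewrite mulr_gt0.
  have mL : 0 <= 4 * m%:R * L ^+ 2 * (W + 1).
    by rewrite !mulr_ge0 ?sqr_ge0 //; lra.
  exists (Num.min (L * C)^-1 (Num.min (1 / 2 / (W + 1))
     (c / (4 * m%:R * L ^+ 2 * (W + 1) + 1)))).
  set d := Num.min _ _.
  have W1 : 0 < W + 1 by lra.
  have M1 : 0 < 4 * m%:R * L ^+ 2 * (W + 1) + 1 by lra.
  have d0 : 0 < d by rewrite !lt_min invr_gt0 LC !divr_gt0.
  have da : d <= (L * C)^-1 by rewrite ge_min lexx.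
  have db : d <= 1 / 2 / (W + 1) by rewrite !ge_min lexx !orbT.
  have dc : d <= c / (4 * m%:R * L ^+ 2 * (W + 1) + 1) by rewrite !ge_min lexx !orbT.
  clearbody d; split => //.
  - by rewrite mulrC -ler_pdivlMr // mul1r.
  - by rewrite -ler_pdivlMr.
  - by move: dc; rewrite ler_pdivlMr //; lra.
pose rad (x : R) := C * x ^+ 2.
have radE (x : R) : `|x| <= d -> `|x| * W + L * rad x <= `|x| * (W + 1).
  move=> xd; have X0 := normr_ge0 x.
  have H : L * C * `|x| <= 1 by apply: le_trans d1; apply: ler_wpM2l => //; rewrite mulr_ge0 // ltW.
  rewrite /rad -[x ^+ 2]real_normK ?num_real //.
  rewrite (_ : L * _ = L * C * `|x| * `|x|); last by ring.
  by have := ler_wpM2r X0 H; lra.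
have xW (x : R) : `|x| <= d -> `|x| * (W + 1) <= d * (W + 1).
  by move=> xd; apply: ler_wpM2r => //; lra.
(* Guarded by |x| <= d, so that [choice] yields a function of all real x; beyond d its value is a
   dummy. *)
have ex x : exists s : 'rV[R]_m, `|x| <= d -> enorm s <= rad x /\
    chain_sum T (fun k => cap (tau P k) (x *: w k + tent_field T (tau P) s k)) = qL - q0.
  have [xd|xd] := leP `|x| d; last by exists 0.
  have [||||||s s1 s2] := @closing_correction R m L T L0 (tau P) (fun k => x *: w k) c
    (`|x| * W) (rad x) (qL - q0) t1 c0 tc; last by exists s.
  - by move=> k kn; rewrite dotZr tw // mulr0.
  - by move=> k kn; rewrite enormZ; apply: ler_wpM2l => //; exact: wW.
  - by rewrite /rad mulr_ge0 ?sqr_ge0 // ltW.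
  - exact: le_trans (radE x xd) (le_trans (xW x xd) d2).
  - apply: le_trans d3; apply: ler_wpM2l; first by apply: mulr_ge0; rewrite ?sqr_ge0 ?mulr_ge0.
    by apply: le_trans (radE x xd) (xW x xd).
  - rewrite (_ : chain_sum T _ = qL - q0); last first.
      rewrite -(feasible_sum fP) /chain_sum.
      under eq_bigr => k _ do rewrite scalerDr scalerA (mulrC _ x) -scalerA.
      by rewrite big_split /= -scaler_sumr -/(chain_sum T w) wS scaler0 addr0.
    rewrite subrr enorm0 add0r /rad mulrA CE -mulrA; apply: ler_wpM2l; first exact: ltW.
    apply: (@le_trans _ _ ((`|x| * (W + 1)) ^+ 2)); last first.
      by rewrite exprMn real_normK ?num_real // mulrC.
    have H := radE x xd; have H0 : 0 <= `|x| * W + L * rad x.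
      apply: addr_ge0; first exact: mulr_ge0.
      by apply: mulr_ge0; [exact: ltW | apply: mulr_ge0; [exact: ltW | exact: sqr_ge0]].
    by rewrite ler_sqr ?nnegrE // (le_trans H0).
have [S SE] := choice ex.
pose F (x : R) k := cap (tau P k) (x *: w k + tent_field T (tau P) (S x) k).
have zle x k : `|x| <= d -> (1 <= k <= n)%N ->
    enorm (x *: w k + tent_field T (tau P) (S x) k) <= `|x| * (W + 1).
  move=> xd kn; apply: (le_trans (enormD _ _)); apply: le_trans (radE x xd).
  apply: lerD; first by rewrite enormZ; apply: ler_wpM2l => //; exact: wW.
  apply: (le_trans (enorm_tent_field _ t1 kn)); apply: ler_wpM2l; first exact: ltW.
  by case: (SE x xd).
have zz x k : `|x| <= d -> (1 <= k <= n)%N ->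
    let z := x *: w k + tent_field T (tau P) (S x) k in
    dot z z <= (W + 1) ^+ 2 * x ^+ 2 /\ dot z z <= 1.
  move=> xd kn z; have H := dot_le_sqr (zle x k xd kn).
  split; first by move: H; rewrite exprMn real_normK ?num_real // mulrC.
  apply: le_trans H _; rewrite expr_le1 ?mulr_ge0 //; last by lra.
  by have := xW x xd; lra.
have F1 x : `|x| <= d -> unit_chain T (F x).
  move=> xd k kn; apply: cap_unit; first exact: t1.
    by rewrite dotDr dot_tent_field // dotZr tw // mulr0 addr0.
  by case: (zz x k xd kn).
have FW x k : `|x| <= d -> (1 <= k <= n)%N ->
    enorm (F x k - tau P k - x *: w k) <= ((W + 1) ^+ 2 + L * C) * x ^+ 2.
  move=> xd kn; have [z1 z2] := zz x k xd kn.
  rewrite mulrDl; apply: le_trans (lerD (le_trans (cap_err (t1 k kn) z2) z1)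
    (_ : enorm (tent_field T (tau P) (S x) k) <= _)).
    apply: le_trans (enormD _ _); rewrite -/(F x k).
    move: (F x k) (tent_field _ _ _ _) => a b; rewrite le_eqVlt; apply/orP; left.
    by apply/eqP; congr enorm; apply/rowP => i; rewrite !mxE; ring.
  apply: (le_trans (enorm_tent_field _ t1 kn)); rewrite -mulrA.
  by apply: ler_wpM2l; [exact: ltW | case: (SE x xd)].
have DE := is_derive_chain_energy d0 t1 tN F1 FW.
suff : - pull_work T (tau P) w = 0 by move/eqP; rewrite oppr_eq0 => /eqP.
apply: (is_derive_local_min d0 DE) => x xd.
have F0E : chain_energy T (F 0) = chain_energy T (tau P).
  have F0 k : (1 <= k <= n)%N -> F 0 k = tau P k.
    move=> kn; have := FW 0 k; rewrite normr0 (ltW d0) expr0n mulr0 scale0r subr0.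
    move=> /(_ isT kn) H; apply/eqP; rewrite -subr_eq0; apply/eqP/enorm_eq0/le_anti.
    by rewrite H enorm_ge0.
  rewrite /chain_energy; congr (_ * _); apply: eq_big_nat => k kn.
  by rewrite !F0 //; clear -kn; lia.
have ends k : tent T k = 0 -> w k = 0 -> F x k = tau P k.
  by move=> tk wk; rewrite /F /tent_field tk wk scale0r scaler0 addr0 cap0.
have fQ : feasible T q0 qL N0 NL (chain_polygon T q0 (F x)).
  apply: feasible_chain => //; first exact: F1.
  - by rewrite ends ?tent_first.
  - by rewrite ends ?tent_last.
  - by have [_ ->] := SE x xd; rewrite addrC subrK.
have := minP _ fQ; rewrite F0E (feasible_energy fP) (feasible_energy fQ).
move=> /le_trans; apply; rewrite le_eqVlt; apply/orP; left; apply/eqP.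
rewrite /chain_energy; congr (_ * _); apply: eq_big_nat => k kn.
have k1 : (1 <= k <= n)%N by clear -kn; lia.
have k2 : (1 <= k.+1 <= n)%N by clear -kn; lia.
by rewrite !tau_chain //; exact: F1.
Qed.

End Minimizers.

(** * A competitor of bounded energy *)

Section SpherePaths.
Variables (R : realType) (m : nat).
Hypothesis m2 : (2 <= m)%N.
Implicit Types (u v g : 'rV[R]_m).

Lemma normalize u : u != 0 -> exists2 g, dot g g = 1 & u = enorm u *: g.
Proof.
move=> u0; have e0 : enorm u != 0 by apply: contra_neq u0 => /enorm_eq0.
exists ((enorm u)^-1 *: u); last by rewrite scalerA divff // scale1r.
by rewrite !dotE -enorm_sqr expr2 mulKf // mulVf.
Qed.

(** Two distinct basis vectors cannot both be multiples of u: being unit, they have nonzero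
    coefficients, yet they are orthogonal to each other. *)
Lemma exists_orthogonal u : dot u u = 1 -> exists2 g, dot g g = 1 & dot u g = 0.
Proof.
move=> u1; have [i0 [i1 i01]] : exists i0 i1 : 'I_m, i0 != i1.
  exists (Ordinal (ltnW m2)), (Ordinal m2); by [].
pose p i : 'rV[R]_m := delta_mx 0 i - dot u (delta_mx 0 i) *: u.
have up i : dot u (p i) = 0 by rewrite /p !dotE u1 mulr1 subrr.
suff [i pi0] : exists i, p i != 0.
  have [g g1 pE] := normalize pi0; exists g => //.
  move: (up i); rewrite pE dotZr => /eqP; rewrite mulf_eq0 => /orP[/eqP e0|/eqP //].
  by move: pi0; rewrite pE e0 scale0r eqxx.
apply: contrapT => np.
have pz i : p i = 0 by apply/eqP/negP => /negP pi0; apply: np; exists i.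
have dE i j : dot (delta_mx 0 i : 'rV[R]_m) (delta_mx 0 j) = (i == j)%:R.
  rewrite /dot (bigD1 i) //= big1 ?addr0 => [|k ki]; last by rewrite mxE (negPf ki) mul0r.
  by rewrite !mxE !eqxx mul1r.
have uE i : dot u (delta_mx 0 i) *: u = delta_mx 0 i.
  by apply/esym/eqP; rewrite -subr_eq0; apply/eqP/pz.
have := dE i0 i1; rewrite (negPf i01) -(uE i0) -(uE i1) dotZl dotZr u1 mulr1.
have := dE i0 i0; rewrite eqxx -(uE i0) dotZl dotZr u1 mulr1 => h0.
have := dE i1 i1; rewrite eqxx -(uE i1) dotZl dotZr u1 mulr1 => h1.
move=> /eqP; rewrite mulf_eq0 => /orP[] /eqP H.
  by move: h0; rewrite H mul0r => /esym/eqP; rewrite oner_eq0.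
by move: h1; rewrite H mul0r => /esym/eqP; rewrite oner_eq0.
Qed.

(** A great circle arc at constant speed; the speed is the angle, at most pi <= 4. *)
Lemma sphere_path u v : dot u u = 1 -> dot v v = 1 ->
  exists f : R -> 'rV[R]_m, [/\ f 0 = u, f 1 = v, forall x, dot (f x) (f x) = 1 &
    forall x y, enorm (f x - f y) <= 4 * `|x - y|].
Proof.
move=> u1 v1; pose p := v - dot u v *: u.
have up : dot u p = 0 by rewrite /p !dotE u1 mulr1 subrr.
have cI : -1 <= dot u v <= 1.
  have := cauchy_schwarz u v.
  by rewrite /enorm u1 v1 sqrtr1 mulr1 ler_norml.
have [g [g1 ug pE]] : exists g, [/\ dot g g = 1, dot u g = 0 & p = enorm p *: g].
  (* If v = u or v = -u, they determine no plane and any orthogonal direction will do; for antipodal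
     points this is where m >= 2 enters. *)
  have [p0|p0] := eqVneq p 0.
    have [g g1 ug] := exists_orthogonal u1; exists g; split => //.
    by rewrite p0 enorm0 scale0r.
  have [g g1 pE] := normalize p0; exists g; split => //.
  move: up; rewrite pE dotZr => /eqP; rewrite mulf_eq0 => /orP[/eqP e0|/eqP //].
  by move: p0; rewrite pE e0 scale0r eqxx.
have pn : enorm p = Num.sqrt (1 - dot u v ^+ 2).
  by rewrite /enorm /p !dotE u1 v1 (dotC v u); congr Num.sqrt; ring.
pose a := acos (dot u v).
have a04 : 0 <= a <= 4 by exact: acos_in04.
pose f x := cos (a * x) *: u + sin (a * x) *: g.
have ff x y : dot (f x) (f y) = cos (a * x - a * y).
  by rewrite /f !dotE u1 g1 (dotC g u) ug cosB; ring.
exists f; split.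
- by rewrite /f mulr0 cos0 sin0 scale1r scale0r addr0.
- rewrite /f mulr1 acosK ?in_itv // sin_acos // -pn -pE.
  by rewrite addrC subrK.
- by move=> x; rewrite ff subrr cos0.
- move=> x y; rewrite enorm_le; last by rewrite mulr_ge0.
  rewrite dotBl !dotBr !ff !subrr cos0.
  rewrite (_ : cos (a * y - a * x) = cos (a * x - a * y)); last by rewrite -cosN opprB.
  rewrite -mulrBr -cos_norm; set h := `|_|.
  have := cos_ge (normr_ge0 (a * (x - y))); rewrite -/h => ch.
  have hE : h <= 4 * `|x - y|.
    by rewrite /h normrM; apply: ler_wpM2r => //; case/andP: a04 => ? ?; rewrite ger0_norm.
  have h0 : 0 <= h by exact: normr_ge0.
  have : h ^+ 2 <= (4 * `|x - y|) ^+ 2 by rewrite ler_sqr ?nnegrE ?(le_trans h0 hE).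
  by lra.
Qed.

Definition clamp (x : R) : R := Num.max 0 (Num.min 1 x).

Lemma clamp_le0 x : x <= 0 -> clamp x = 0.
Proof.
move=> x0; have x1 : x <= 1 by lra.
by rewrite /clamp (min_r x1) max_l.
Qed.

Lemma clamp_ge1 x : 1 <= x -> clamp x = 1.
Proof. by move=> x1; rewrite /clamp (min_l x1) max_r. Qed.

Lemma clamp_lipschitz x y : `|clamp x - clamp y| <= `|x - y|.
Proof.
have A := ler_norm (x - y); have := ler_norm (- (x - y)); rewrite normrN => B.
rewrite ler_norml /clamp; case: (leP 1 x) => ?; case: (leP 1 y) => ?.
- by rewrite subrr; apply/andP; split; lra.
- by case: (leP 0 y) => ?; rewrite ?(max_r ler01); apply/andP; split; lra.
- by case: (leP 0 x) => ?; rewrite ?(max_r ler01); apply/andP; split; lra.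
- by case: (leP 0 x) => ?; case: (leP 0 y) => ?; apply/andP; split; lra.
Qed.

(** The directions A, e, v, w, B are taken in turn, with transitions of length d starting at d, L /
    3, 2 L / 3 and L - 2 d. Constant pieces at both ends secure the prescribed tangents after
    sampling on any mesh of size at most d. *)
Lemma base_curve L d (A e v w B : 'rV[R]_m) : 0 < d -> 9 * d <= L ->
  dot A A = 1 -> dot e e = 1 -> dot v v = 1 -> dot w w = 1 -> dot B B = 1 ->
  exists f : R -> 'rV[R]_m, (forall x, dot (f x) (f x) = 1) /\
    [/\ forall x y, enorm (f x - f y) <= 16 / d * `|x - y|,
        forall x, x <= d -> f x = A & forall x, L - d <= x -> f x = B] /\
    [/\ forall x, 2 * d <= x <= L / 3 -> f x = e,
        forall x, L / 3 + d <= x <= 2 * L / 3 -> f x = v &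
        forall x, 2 * L / 3 + d <= x <= L - 2 * d -> f x = w].
Proof.
move=> d0 dL A1 e1 v1 w1 B1.
have [p0 [p00 p01 p0u p0l]] := sphere_path A1 e1.
have [p1 [p10 p11 p1u p1l]] := sphere_path e1 v1.
have [p2 [p20 p21 p2u p2l]] := sphere_path v1 w1.
have [p3 [p30 p31 p3u p3l]] := sphere_path w1 B1.
pose s a x := clamp ((x - a) / d).
have s0 a x : x <= a -> s a x = 0.
  move=> xa; apply: clamp_le0; rewrite ler_pdivrMr //; lra.
have s1 a x : a + d <= x -> s a x = 1.
  move=> xa; apply: clamp_ge1; rewrite ler_pdivlMr //; lra.
have sl a x y : `|s a x - s a y| <= `|x - y| / d.
  apply: le_trans (clamp_lipschitz _ _) _; rewrite -mulrBl normrM.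
  rewrite (ger0_norm (_ : 0 <= d^-1)) ?invr_ge0 ?(ltW d0) //.
  by rewrite opprB addrA subrK.
(* Written as a sum of increments, the curve is globally Lipschitz as a sum of four terms of
   constant 4 / d, without a case analysis on the positions. *)
pose f x := p0 (s d x) + (p1 (s (L / 3) x) - e) + (p2 (s (2 * L / 3) x) - v) +
  (p3 (s (L - 2 * d) x) - w).
have f0 x : x <= L / 3 -> f x = p0 (s d x).
  move=> xL; rewrite /f (s0 (L / 3)) // (s0 (2 * L / 3)); last by lra.
  by rewrite (s0 (L - 2 * d)) ?p10 ?p20 ?p30 ?subrr ?addr0 //; lra.
have f1 x : L / 3 <= x <= 2 * L / 3 -> f x = p1 (s (L / 3) x).
  move=> /andP[x1 x2]; rewrite /f (s1 d); last by lra.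
  rewrite (s0 (2 * L / 3)) // (s0 (L - 2 * d)); last by lra.
  by rewrite p01 p20 p30 !subrr !addr0 addrC subrK.
have f2 x : 2 * L / 3 <= x <= L - 2 * d -> f x = p2 (s (2 * L / 3) x).
  move=> /andP[x1 x2]; rewrite /f (s1 d); last by lra.
  rewrite (s1 (L / 3)); last by lra.
  rewrite (s0 (L - 2 * d)) // p01 p11 p30 subrr addr0.
  by rewrite (addrC e) subrK addrC subrK.
have f3 x : L - 2 * d <= x -> f x = p3 (s (L - 2 * d) x).
  move=> x1; rewrite /f (s1 d); last by lra.
  rewrite (s1 (L / 3)); last by lra.
  rewrite (s1 (2 * L / 3)); last by lra.
  by rewrite p01 p11 p21 (addrC e) subrK (addrC v) subrK addrC subrK.
exists f; split; [|split; split].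
- move=> x; have [x1|x1] := leP x (L / 3); first by rewrite f0.
  have [x2|x2] := leP x (2 * L / 3); first by rewrite f1 // x2 ltW.
  have [x3|x3] := leP x (L - 2 * d); first by rewrite f2 // x3 ltW.
  by rewrite f3 // ltW.
- move=> x y.
  have step (p : R -> 'rV[R]_m) a : (forall x y, enorm (p x - p y) <= 4 * `|x - y|) ->
      enorm (p (s a x) - p (s a y)) <= 4 * (`|x - y| / d).
    move=> pl; apply: (le_trans (pl _ _)); apply: ler_wpM2l => //; exact: sl.
  have -> : f x - f y = (p0 (s d x) - p0 (s d y)) +
     (p1 (s (L / 3) x) - p1 (s (L / 3) y)) +
     (p2 (s (2 * L / 3) x) - p2 (s (2 * L / 3) y)) +
     (p3 (s (L - 2 * d) x) - p3 (s (L - 2 * d) y)).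
    by apply/rowP => i; rewrite /f !mxE; ring.
  rewrite (_ : 16 / d * _ = 4 * (`|x - y| / d) + 4 * (`|x - y| / d) +
    4 * (`|x - y| / d) + 4 * (`|x - y| / d)); last by field; exact: lt0r_neq0.
  do 3 (apply: (le_trans (enormD _ _)); apply: lerD; last exact: step).
  exact: step.
- by move=> x xd; rewrite f0 ?s0 //; lra.
- by move=> x xd; rewrite f3 ?s1 //; lra.
- by move=> x /andP[x1 x2]; rewrite f0 // s1 //; lra.
- by move=> x /andP[x1 x2]; rewrite f1 ?s1 //; lra.
- by move=> x /andP[x1 x2]; rewrite f2 ?s1 //; lra.
Qed.

End SpherePaths.

Section Competitor.
Variables (R : realType) (m : nat) (L : R).
Hypotheses (m2 : (2 <= m)%N) (L0 : 0 < L).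
Implicit Types (T : interval_partition L) (s u v : 'rV[R]_m).

Lemma sum_ell0_between_le T a b : 0 <= a -> a <= b -> b <= L ->
  \sum_(1 <= k < (nedges T).+1 | a <= node T k < b) ell0 T k <= b - a + mesh T.
Proof.
move=> a0 ab bL; have mp := mesh_gt0 T L0.
have /andP[A _] : Num.min a L <= \sum_(1 <= k < (nedges T).+1 | node T k < a) ell0 T k
    <= a + mesh T by apply: sum_ell0_below => //; lra.
have /andP[_ B] : Num.min b L <= \sum_(1 <= k < (nedges T).+1 | node T k < b) ell0 T k
    <= b + mesh T by apply: sum_ell0_below => //; lra.
rewrite min_l in A; last exact: le_trans bL.
suff : \sum_(1 <= k < (nedges T).+1 | node T k < b) ell0 T k =
  \sum_(1 <= k < (nedges T).+1 | node T k < a) ell0 T k +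
  \sum_(1 <= k < (nedges T).+1 | a <= node T k < b) ell0 T k by lra.
rewrite (bigID (fun k => node T k < a)) /=; congr (_ + _); apply: eq_bigl => k.
  by case: (ltP (node T k) a) => H; rewrite ?andbF // andbT; apply: lt_le_trans H ab.
by rewrite -leNgt andbC.
Qed.

Lemma sum_ell0_between_dist T a b : 0 <= a -> a <= b -> b <= L ->
  `|\sum_(1 <= k < (nedges T).+1 | a <= node T k < b) ell0 T k - (b - a)| <= mesh T.
Proof.
move=> a0 ab bL; have A := sum_ell0_between_le T a0 ab bL.
have B := @sum_ell0_between _ _ T L0 _ _ a0 ab bL.
by rewrite ler_norml; apply/andP; split; lra.
Qed.

(** 1 + |u . v| is the largest eigenvalue of the sum of the two projections. Cauchy-Schwarz is
    applied to s and its image under that sum. *)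
Lemma two_dir_sqr_le u v s : dot u u = 1 -> dot v v = 1 ->
  dot u s ^+ 2 + dot v s ^+ 2 <= (1 + `|dot u v|) * dot s s.
Proof.
move=> u1 v1; have := cauchy_schwarz_sqr s (dot u s *: u + dot v s *: v).
rewrite !dotE (dotC s u) (dotC s v) (dotC v u) u1 v1.
move: (dot u s) (dot v s) (dot u v) => a b c cs.
have c0 : 0 <= `|c| by exact: normr_ge0.
have cle : c * (2 * a * b) <= `|c| * (a ^+ 2 + b ^+ 2).
  apply: (le_trans (ler_norm _)); rewrite normrM; apply: ler_wpM2l => //.
  have [A B] := (sqr_ge0 (a - b), sqr_ge0 (a + b)).
  by rewrite ler_norml; apply/andP; split; nra.
have [Q QE] : exists Q, Q = a ^+ 2 + b ^+ 2 by eexists.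
rewrite -QE in cle *.
have Q0 : 0 <= Q by rewrite QE addr_ge0 ?sqr_ge0.
have s0 := dot_ge0 s.
have H : Q ^+ 2 <= dot s s * ((1 + `|c|) * Q).
  apply: (@le_trans _ _ (dot s s * (Q + c * (2 * a * b)))).
    by move: cs; rewrite QE; lra.
  by apply: ler_wpM2l => //; lra.
have [Qz|Qn] := eqVneq Q 0; first by rewrite Qz mulr_ge0 // addr_ge0.
have Qp : 0 < Q by rewrite lt_neqAle eq_sym Qn.
rewrite -(ler_pM2r Qp) -expr2; apply: (le_trans H); rewrite le_eqVlt; apply/orP; left.
by apply/eqP; ring.
Qed.

(** Two non-parallel plateaus already give coercivity, with a constant independent of the transition
    length d. [bounded_energy_coercive] would be circular here: d has to be small compared with c,
    while the energy bound of the sampled curve grows as d shrinks. *)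
Lemma plateaus_coercive T (t : nat -> 'rV[R]_m) d u v : unit_chain T t ->
  dot u u = 1 -> dot v v = 1 -> mesh T <= L / 12 -> 0 < d -> d <= L / 12 ->
  (forall k, (1 <= k <= nedges T)%N -> 2 * d <= node T k <= L / 3 -> t k = u) ->
  (forall k, (1 <= k <= nedges T)%N -> L / 3 + d <= node T k <= 2 * L / 3 -> t k = v) ->
  tent_coercive T t (L / 12 * (L / 6) * (1 - `|dot u v|)).
Proof.
move=> t1 u1 v1 hT d0 dL tu tv s; have Lp := L0.
have n1 := nedges_gt0 T L0.
have nN : (1 <= nedges T <= nedges T)%N by rewrite n1 leqnn.
have := node_last T; have := ell0_le_mesh nN => lm lE.
pose F k := ell0 T k * tent T k * (dot s s - dot (t k) s ^+ 2).
have tentL k : (1 <= k <= nedges T)%N -> L / 6 <= node T k < 2 * L / 3 -> L / 6 <= tent T k.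
  by move=> kn /andP[k1 k2]; rewrite /tent le_min k1 /=; lra.
have Hu : (L / 3 - L / 6 - mesh T) * (L / 6) * (dot s s - dot u s ^+ 2) <=
    \sum_(1 <= k < (nedges T).+1 | L / 6 <= node T k < L / 3) F k.
  apply: (tent_sum_ge L0) => //; try lra; first exact: unit_dot_sqr_le.
  move=> k kn /andP[k1 k2]; split; first by apply: tentL => //; apply/andP; split; lra.
  by rewrite (tu k kn) //; apply/andP; split; lra.
have Hv : (2 * L / 3 - L / 2 - mesh T) * (L / 6) * (dot s s - dot v s ^+ 2) <=
    \sum_(1 <= k < (nedges T).+1 | L / 2 <= node T k < 2 * L / 3) F k.
  apply: (tent_sum_ge L0) => //; try lra; first exact: unit_dot_sqr_le.
  move=> k kn /andP[k1 k2]; split; first by apply: tentL => //; apply/andP; split; lra.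
  by rewrite (tv k kn) //; apply/andP; split; lra.
apply: (@le_trans _ _ (\sum_(1 <= k < (nedges T).+1 | L / 6 <= node T k < L / 3) F k +
   \sum_(1 <= k < (nedges T).+1 | L / 2 <= node T k < 2 * L / 3) F k)); last first.
  rewrite big_mkcond [X in _ + X]big_mkcond -big_split /=.
  apply: ler_sum_nat0 => k kn; rewrite -/(F k).
  have kN : (1 <= k <= nedges T)%N by clear -kn; lia.
  have F0 : 0 <= F k.
    apply: mulr_ge0; last by apply: unit_dot_sqr_le; exact: t1.
    by apply: mulr_ge0; [apply/ltW/ell0_gt0 | apply: tent_ge0].
  case: ifP => [/andP[k1 k2]|_]; last by case: ifP => _; rewrite ?add0r ?addr0.
  rewrite ifF ?addr0 //; apply/negP => /andP[k3 _]; lra.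
apply: le_trans (lerD Hu Hv).
have Xu : 0 <= dot s s - dot u s ^+ 2 by exact: unit_dot_sqr_le.
have Xv : 0 <= dot s s - dot v s ^+ 2 by exact: unit_dot_sqr_le.
have X := two_dir_sqr_le s u1 v1.
apply: (@le_trans _ _ (L / 12 * (L / 6) * (dot s s - dot u s ^+ 2) +
  L / 12 * (L / 6) * (dot s s - dot v s ^+ 2))).
  rewrite -mulrA -mulrDr; apply: ler_wpM2l; last by lra.
  by rewrite mulr_ge0 //; lra.
by apply: lerD; (apply: ler_wpM2r; first by []); apply: ler_wpM2r; lra.
Qed.

(** Compared with the chain that equals e, v, w on the three thirds. Each third is measured up to
    one mesh, in all 3 d. The transition zones have total length 6 d plus four meshes, and unit
    vectors differ by at most 2 there, in all 20 d. *)
Lemma zigzag_sum_dist T (t : nat -> 'rV[R]_m) d e v w : unit_chain T t ->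
  dot e e = 1 -> dot v v = 1 -> dot w w = 1 ->
  mesh T <= d -> 0 < d -> 9 * d <= L ->
  (forall k, (1 <= k <= nedges T)%N -> 2 * d <= node T k <= L / 3 -> t k = e) ->
  (forall k, (1 <= k <= nedges T)%N -> L / 3 + d <= node T k <= 2 * L / 3 -> t k = v) ->
  (forall k, (1 <= k <= nedges T)%N -> 2 * L / 3 + d <= node T k <= L - 2 * d -> t k = w) ->
  enorm (L / 3 *: (e + v + w) - chain_sum T t) <= 23 * d.
Proof.
move=> t1 e1 v1 w1 hT d0 dL te tv tw; have Lp := L0.
pose M a b := \sum_(1 <= k < (nedges T).+1 | a <= node T k < b) ell0 T k.
pose ind a b k : R := if a <= node T k < b then 1 else 0.
have ME a b : M a b = \sum_(1 <= k < (nedges T).+1) ell0 T k * ind a b k.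
  rewrite /M big_mkcond; apply: eq_bigr => k _; rewrite /ind.
  by case: ifP => _; rewrite ?mulr1 ?mulr0.
pose g k : 'rV[R]_m := ind 0 (L / 3) k *: e + ind (L / 3) (2 * L / 3) k *: v +
   ind (2 * L / 3) L k *: w.
pose bad k := ind 0 (2 * d) k + ind (L / 3) (L / 3 + d) k +
  ind (2 * L / 3) (2 * L / 3 + d) k + ind (L - 2 * d) L k.
have gt k : (1 <= k <= nedges T)%N -> enorm (g k - t k) <= 2 * bad k.
  move=> kn.
  have en u : dot u u = 1 -> enorm (u - t k) <= 2.
    by move=> u1; apply: (le_trans (enormB _ _)); rewrite !unit_enorm ?t1.
  have y0 := node_ge0 kn; have yL : node T k < L.
    have l0 := ell0_gt0 kn; have : vtx T k <= L by rewrite -[leRHS](vtx_last T); apply: vtx_le; clear -kn; lia.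
    by move: l0; rewrite /ell0 /node; lra.
  have ind0 a b k' : 0 <= ind a b k' by rewrite /ind; case: ifP.
  have zero u : u = t k -> enorm (u - t k) <= 2 * bad k.
    move=> ->; rewrite subrr enorm0 mulr_ge0 // /bad.
    by rewrite !addr_ge0.
  have badle x : 1 <= bad k -> x <= 2 -> x <= 2 * bad k by lra.
  rewrite /g; have [y1|y1] := ltP (node T k) (L / 3).
    rewrite (_ : ind 0 _ k = 1); last by rewrite /ind y0 y1.
    rewrite (_ : ind (L / 3) _ k = 0); last by rewrite /ind ifF //; apply/negP => /andP[]; lra.
    rewrite (_ : ind (2 * L / 3) _ k = 0); last by rewrite /ind ifF //; apply/negP => /andP[]; lra.
    rewrite scale1r !scale0r !addr0; have [y2|y2] := ltP (node T k) (2 * d).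
      apply: badle; last exact: en.
      rewrite /bad (_ : ind 0 (2 * d) k = 1); last by rewrite /ind y0 y2.
      by rewrite -!addrA lerDl !addr_ge0.
    by apply: zero; rewrite (te k kn) // y2 ltW.
  rewrite (_ : ind 0 _ k = 0); last by rewrite /ind ifF //; apply/negP => /andP[]; lra.
  have [y2|y2] := ltP (node T k) (2 * L / 3).
    rewrite (_ : ind (L / 3) _ k = 1); last by rewrite /ind y1 y2.
    rewrite (_ : ind (2 * L / 3) _ k = 0); last by rewrite /ind ifF //; apply/negP => /andP[]; lra.
    rewrite scale1r !scale0r addr0 add0r; have [y3|y3] := ltP (node T k) (L / 3 + d).
      apply: badle; last exact: en.
      rewrite /bad (_ : ind (L / 3) (L / 3 + d) k = 1); last by rewrite /ind y1 y3.
      by have := ind0 0 (2 * d) k; have := ind0 (2 * L / 3) (2 * L / 3 + d) k;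
        have := ind0 (L - 2 * d) L k; lra.
    by apply: zero; rewrite (tv k kn) // y3 ltW.
  rewrite (_ : ind (L / 3) _ k = 0); last by rewrite /ind ifF //; apply/negP => /andP[]; lra.
  rewrite (_ : ind (2 * L / 3) L k = 1); last by rewrite /ind y2 yL.
  rewrite scale1r !scale0r !add0r.
  have [y3|y3] := ltP (node T k) (2 * L / 3 + d).
    apply: badle; last exact: en.
    rewrite /bad (_ : ind (2 * L / 3) (2 * L / 3 + d) k = 1); last by rewrite /ind y2 y3.
    by have := ind0 0 (2 * d) k; have := ind0 (L / 3) (L / 3 + d) k;
        have := ind0 (L - 2 * d) L k; lra.
  have [y4|y4] := leP (L - 2 * d) (node T k).
    apply: badle; last exact: en.
    rewrite /bad (_ : ind (L - 2 * d) L k = 1); last by rewrite /ind y4 yL.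
    by have := ind0 0 (2 * d) k; have := ind0 (L / 3) (L / 3 + d) k;
        have := ind0 (2 * L / 3) (2 * L / 3 + d) k; lra.
  by apply: zero; rewrite (tw k kn) // y3 ltW.
have gE : chain_sum T g = M 0 (L / 3) *: e + M (L / 3) (2 * L / 3) *: v + M (2 * L / 3) L *: w.
  rewrite /chain_sum !ME !scaler_suml -!big_split /=; apply: eq_bigr => k _.
  by rewrite /g !scalerDr !scalerA.
have Mle a b : 0 <= a -> a <= b -> b <= L -> `|M a b - (b - a)| <= d.
  by move=> a0 ab bL; apply: le_trans hT; apply: sum_ell0_between_dist.
rewrite -[L / 3 *: _](subrK (chain_sum T g)) -addrA.
apply: (le_trans (enormD _ _)).
apply: (@le_trans _ _ (3 * d + 20 * d)); last by lra.
apply: lerD.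
  rewrite enormBC gE.
  rewrite (_ : _ - _ = (M 0 (L / 3) - (L / 3 - 0)) *: e +
    (M (L / 3) (2 * L / 3) - (2 * L / 3 - L / 3)) *: v +
    (M (2 * L / 3) L - (L - 2 * L / 3)) *: w); last first.
    by apply/rowP => i; rewrite !mxE; field.
  apply: (le_trans (enormD _ _)); apply: (@le_trans _ _ ((d + d) + d)); last by lra.
  apply: lerD.
    apply: (le_trans (enormD _ _)); apply: lerD.
      by rewrite enormZ unit_enorm // mulr1; apply: Mle; lra.
    by rewrite enormZ unit_enorm // mulr1; apply: Mle; lra.
  by rewrite enormZ unit_enorm // mulr1; apply: Mle; lra.
rewrite /chain_sum -sumrB; apply: (le_trans (enorm_sum _ _ _)).
apply: (@le_trans _ _ (2 * (M 0 (2 * d) + M (L / 3) (L / 3 + d) +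
    M (2 * L / 3) (2 * L / 3 + d) + M (L - 2 * d) L))).
  rewrite !ME -!big_split /= mulr_sumr; apply: ler_sum_nat0 => k kn.
  have kN : (1 <= k <= nedges T)%N by clear -kn; lia.
  have l0 := ell0_gt0 kN.
  rewrite -scalerBr enormZ gtr0_norm //.
  apply: (le_trans (ler_wpM2l (ltW l0) (gt k kN))).
  by rewrite le_eqVlt; apply/orP; left; apply/eqP; rewrite /bad; ring.
have Mup a b : 0 <= a -> a <= b -> b <= L -> M a b <= b - a + d.
  by move=> a0 ab bL; have := Mle a b a0 ab bL; rewrite ler_norml => /andP[_]; lra.
have H1 : M 0 (2 * d) <= 2 * d - 0 + d by apply: Mup; lra.
have H2 : M (L / 3) (L / 3 + d) <= L / 3 + d - L / 3 + d by apply: Mup; lra.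
have H3 : M (2 * L / 3) (2 * L / 3 + d) <= 2 * L / 3 + d - 2 * L / 3 + d by apply: Mup; lra.
have H4 : M (L - 2 * d) L <= L - (L - 2 * d) + d by apply: Mup; lra.
by clear -H1 H2 H3 H4; lra.
Qed.

(** The squared angle is at most 18 (1 - c), that is 9 times the squared chord; one factor [ell0] is
    then traded for 2 [lbar], which cancels the denominator. *)
Lemma lipschitz_chain_energy T (t : nat -> 'rV[R]_m) M : unit_chain T t -> 0 <= M ->
  (forall k, (1 <= k < nedges T)%N -> enorm (t k.+1 - t k) <= M * ell0 T k) ->
  chain_energy T t <= 9 * M ^+ 2 * L.
Proof.
move=> t1 M0 tM; rewrite /chain_energy.
apply: (@le_trans _ _ (2^-1 * \sum_(1 <= k < nedges T) 18 * M ^+ 2 * ell0 T k)).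
  apply: ler_wpM2l; first by rewrite invr_ge0.
  apply: ler_sum_nat0 => k kn; have lb := lbar_gt0 kn.
  have k1 : (1 <= k <= nedges T)%N by clear -kn; lia.
  have k2 : (1 <= k.+1 <= nedges T)%N by clear -kn; lia.
  have l0 := ell0_gt0 k1; have ll := ell0_le_lbar kn.
  rewrite ler_pdivrMr //; apply: (le_trans (acos_sqr_le (unit_chain_dot t1 kn))).
  have := dot_le_sqr (tM k kn); rewrite !dotE !t1 // (dotC (t k.+1)) exprMn => H.
  have : M ^+ 2 * ell0 T k ^+ 2 <= M ^+ 2 * (ell0 T k * (2 * lbar T k)).
    by apply: ler_wpM2l; [exact: sqr_ge0 | rewrite expr2; apply: ler_wpM2l; first exact: ltW].
  by lra.
rewrite -mulr_sumr; have : \sum_(1 <= k < nedges T) ell0 T k <= L.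
  have n1 := nedges_gt0 T L0.
  have -> : nedges T = (nedges T).-1.+1 by clear -n1; lia.
  by rewrite sum_ell0 -[leRHS](vtx_last T); apply: vtx_le; clear -n1; lia.
by move=> /(ler_wpM2l (_ : 0 <= 18 * M ^+ 2)); rewrite mulr_ge0 ?sqr_ge0 // => /(_ isT); lra.
Qed.

End Competitor.

Section CompetitorExistence.
Variables (R : realType) (m : nat) (L : R).
Hypotheses (m2 : (2 <= m)%N) (L0 : 0 < L).

Lemma cap_lipschitz (u u' z z' : 'rV[R]_m) : dot u u = 1 -> dot u' u' = 1 ->
  enorm z <= 1 / 2 -> enorm z' <= 1 / 2 ->
  enorm (cap u z - cap u' z') <= enorm (u - u') + 2 * enorm (z - z').
Proof.
move=> u1 u1' z2 z2'.
have q (y : 'rV[R]_m) : enorm y <= 1 / 2 -> dot y y <= 1 / 4.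
  by move=> /dot_le_sqr; lra.
have s0 := sqrtr_ge0 (1 - dot z z).
have s1 : Num.sqrt (1 - dot z z) <= 1.
  rewrite -(@ler_sqr _ _ 1) ?nnegrE // expr1n sqr_sqrtr; have := dot_ge0 z; have := q z z2; lra.
have := sqrt_dist_le (q z z2) (q z' z2').
rewrite (_ : cap u z - cap u' z' = Num.sqrt (1 - dot z z) *: (u - u') +
   ((Num.sqrt (1 - dot z z) - Num.sqrt (1 - dot z' z')) *: u' + (z - z'))); last first.
  by apply/rowP => i; rewrite /cap !mxE; ring.
move: (Num.sqrt (1 - dot z z)) (Num.sqrt (1 - dot z' z')) s0 s1 => s r s0 s1 sr.
apply: (le_trans (enormD _ _)); apply: lerD.
  by rewrite enormZ ger0_norm // ler_piMl ?enorm_ge0.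
apply: (le_trans (enormD _ _)); rewrite mulr_natl mulr2n lerD2r.
rewrite enormZ (unit_enorm u1') mulr1; apply: (le_trans sr).
have -> : dot z z - dot z' z' = dot (z + z') (z - z').
  by rewrite !dotE (dotC z' z); ring.
apply: (le_trans (cauchy_schwarz _ _)); rewrite ler_piMl ?enorm_ge0 //.
by apply: (le_trans (enormD _ _)); lra.
Qed.

Lemma tent_field_lipschitz (T : interval_partition L) (t : nat -> 'rV[R]_m) s k :
  unit_chain T t -> (1 <= k < nedges T)%N ->
  enorm (tent_field T t s k.+1 - tent_field T t s k) <=
  (ell0 T k + 2 * L * enorm (t k.+1 - t k)) * enorm s.
Proof.
move=> t1 kn; have k1 : (1 <= k <= nedges T)%N by clear -kn; lia.
have k2 : (1 <= k.+1 <= nedges T)%N by clear -kn; lia.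
rewrite (_ : _ - _ = (tent T k.+1 - tent T k) *: tproj (t k.+1) s +
  tent T k *: (dot (t k) s *: (t k - t k.+1) + dot (t k - t k.+1) s *: t k.+1)); last first.
  by rewrite dotBl; apply/rowP => i; rewrite /tent_field /tproj !mxE; ring.
have e0 := enorm_ge0 s; have d0 := enorm_ge0 (t k.+1 - t k).
rewrite mulrDl; apply: (le_trans (enormD _ _)); apply: lerD; rewrite enormZ.
  by apply: ler_pM; rewrite ?enorm_ge0 ?tent_lipschitz ?enorm_tproj ?t1.
rewrite ger0_norm ?tent_ge0 //.
rewrite (_ : 2 * L * _ * _ = L * (enorm (t k.+1 - t k) * enorm s + enorm (t k.+1 - t k) * enorm s)); last by ring.
apply: ler_pM; rewrite ?enorm_ge0 ?tent_ge0 ?tent_le //.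
apply: (le_trans (enormD _ _)); apply: lerD; rewrite enormZ.
  rewrite (enormBC (t k)) mulrC; apply: ler_wpM2l => //; apply: (le_trans (cauchy_schwarz _ _)).
  by rewrite unit_enorm ?t1 // mul1r.
rewrite unit_enorm ?t1 // mulr1; apply: (le_trans (cauchy_schwarz _ _)).
by rewrite enormBC.
Qed.

(** A zigzag with directions e, v, w whose mean is r e is sampled on T and then closed by
    [closing_correction]. The sampled chain and the correction are Lipschitz with constants
    independent of T, hence so is the energy bound. *)
Lemma competitor (q0 qL N0 NL : 'rV[R]_m) r : sphere N0 -> sphere NL ->
  0 <= r < 1 -> enorm (qL - q0) = r * L ->
  exists K h1 : R, [/\ 0 <= K, 0 < h1 & forall T : interval_partition L,
    mesh T <= h1 -> exists2 Q : polygon m T, feasible T q0 qL N0 NL Q &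
      energy Q <= K].
Proof.
move=> /sphere_dot N1 /sphere_dot NL1 /andP[r0 r1] qr; have Lp := L0.
have [e e1 qE] : exists2 e, dot e e = 1 & qL - q0 = (r * L) *: e.
  have [q0'|qn] := eqVneq (qL - q0) 0.
    by exists N0 => //; rewrite -qr q0' enorm0 scale0r.
  by have [e e1 qE] := normalize qn; exists e => //; rewrite -qr.
have [f f1 ef] := exists_orthogonal m2 e1.
(* C is the cosine of the angle between e and each of v and w, its value coming from (1 + 2 C) / 3 =
   r. As 0 <= r < 1 it lies strictly between -1 and 1, so e and v are not parallel. *)
have [C CE] : exists C, C = (3 * r - 1) / 2 by eexists.
have C1 : `|C| < 1 by rewrite ltr_norml; apply/andP; split; lra.
have C2 : C ^+ 2 <= 1.
  by rewrite -real_normK ?num_real // expr_le1 // ltW.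
have [S SE] : exists S, S ^+ 2 = 1 - C ^+ 2.
  by exists (Num.sqrt (1 - C ^+ 2)); rewrite sqr_sqrtr // subr_ge0.
pose v := C *: e + S *: f; pose w := C *: e - S *: f.
have v1 : dot v v = 1.
  rewrite /v !dotE e1 f1 (dotC f e) ef.
  by transitivity (C ^+ 2 + S ^+ 2); [ring | rewrite SE; ring].
have w1 : dot w w = 1.
  rewrite /w !dotE e1 f1 (dotC f e) ef.
  by transitivity (C ^+ 2 + S ^+ 2); [ring | rewrite SE; ring].
have ev : dot e v = C by rewrite /v !dotE e1 ef mulr0 addr0 mulr1.
have sumE : L / 3 *: (e + v + w) = qL - q0.
  rewrite qE (_ : r = (1 + 2 * C) / 3); last by rewrite CE; field.
  by apply/rowP => i; rewrite /v /w !mxE; field.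
have [c [c0 cE]] : exists c, 0 < c /\ c = L / 12 * (L / 6) * (1 - `|dot e v|).
  exists (L / 12 * (L / 6) * (1 - `|dot e v|)); split=> //.
  by rewrite ev !mulr_gt0 ?divr_gt0 // subr_gt0.
(* The last condition keeps the quadratic defect L (L rad)^2 below c rad / 2; the other half is left
   for the closing error of the zigzag. *)
have [rad [rad0 rad1 rad2 rad3]] : exists rad : R, [/\ 0 < rad, L * rad <= 1 / 2,
    4 * m%:R * L ^+ 2 * (L * rad) <= c & 2 * L ^+ 3 * rad <= c].
  have L3 : 0 < 2 * L ^+ 3 by rewrite mulr_gt0 // exprn_gt0.
  have M1 : 0 < 4 * m%:R * L ^+ 3 + 1.
    by apply: ltr_wpDl => //; rewrite mulr_ge0 // ltW // exprn_gt0.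
  exists (Num.min (1 / 2 / L) (Num.min (c / (4 * m%:R * L ^+ 3 + 1)) (c / (2 * L ^+ 3)))).
  set d := Num.min _ _.
  have d0 : 0 < d by rewrite !lt_min !divr_gt0.
  have da : d <= 1 / 2 / L by rewrite ge_min lexx.
  have db : d <= c / (4 * m%:R * L ^+ 3 + 1) by rewrite !ge_min lexx !orbT.
  have dc : d <= c / (2 * L ^+ 3) by rewrite !ge_min lexx !orbT.
  clearbody d; split => //.
  - by rewrite mulrC -ler_pdivlMr.
  - move: db; rewrite ler_pdivlMr //.
    by rewrite (_ : 4 * m%:R * L ^+ 2 * (L * d) = d * (4 * m%:R * L ^+ 3 + 1) - d); [lra | ring].
  - by rewrite mulrC -ler_pdivlMr.
(* 46 d <= c rad puts the closing error 23 d below c rad / 2. *)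
have [d [d0 d1 d2]] : exists d : R, [/\ 0 < d, 12 * d <= L & 46 * d <= c * rad].
  have cr : 0 < c * rad by rewrite mulr_gt0.
  exists (Num.min (L / 12) (c * rad / 46)).
  set d := Num.min _ _.
  have d0 : 0 < d by rewrite !lt_min !divr_gt0.
  have da : d <= L / 12 by rewrite ge_min lexx.
  have db : d <= c * rad / 46 by rewrite ge_min lexx orbT.
  by clearbody d; split => //; lra.
have d9 : 9 * d <= L by lra.
have [p [p1 [[pl pA pB] [pe pv pw]]]] := base_curve m2 d0 d9 N1 e1 v1 w1 NL1.
have [Lam [Lam0 LamE]] : exists Lam : R, 0 <= Lam /\ Lam = 16 / d.
  by exists (16 / d); split=> //; rewrite divr_ge0 // ltW.
(* By [cap_lipschitz] an increment is at most |dt| plus twice that of the tent field, and the latter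
   is at most rad times the edge length plus |dt|. *)
pose M := 3 * Lam + 2 * rad.
have M0 : 0 <= M by rewrite /M; lra.
exists (9 * M ^+ 2 * L), d; split => //; first by rewrite mulr_ge0 ?mulr_ge0 ?sqr_ge0 // ltW.
move=> T hT; have n0 := nedges_gt0 T L0.
pose t k := p (node T k).
have t1 : unit_chain T t by move=> k _; exact: p1.
have tc : tent_coercive T t c.
  rewrite cE; apply: (plateaus_coercive L0 t1 e1 v1 _ d0); try lra.
  - by move=> k _; apply: pe.
  - by move=> k _; apply: pv.
have tl k : (1 <= k < nedges T)%N -> enorm (t k.+1 - t k) <= Lam * ell0 T k.
  move=> kn; have k1 : (1 <= k <= nedges T)%N by clear -kn; lia.
  apply: (le_trans (pl _ _)); rewrite LamE nodeS; last by case/andP: k1.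
  by rewrite (addrC (node T k)) addrK ger0_norm // ltW // ell0_gt0.
have [||||||s s1 s2] := @closing_correction R m L T L0 t (fun=> 0) c 0 rad (qL - q0) t1 c0 tc.
- by move=> k _; rewrite dot0r.
- by move=> k _; rewrite enorm0.
- exact: ltW.
- by rewrite add0r.
- by rewrite add0r.
- rewrite add0r (_ : chain_sum T _ = chain_sum T t); last first.
    by apply: eq_bigr => k _; rewrite addr0.
  have Z : enorm (qL - q0 - chain_sum T t) <= 23 * d.
    rewrite -sumE; apply: (zigzag_sum_dist L0 t1 e1 v1 w1 hT d0 d9).
    + by move=> k _; apply: pe.
    + by move=> k _; apply: pv.
    + by move=> k _; apply: pw.
  have := ler_wpM2r (ltW rad0) rad3.
  rewrite (_ : 2 * L ^+ 3 * rad * rad = 2 * (L * (L * rad) ^+ 2)); last by ring.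
  by move: Z d2; clear; lra.
pose F k := cap (t k) (0 + tent_field T t s k).
have z2 k : (1 <= k <= nedges T)%N -> enorm (0 + tent_field T t s k) <= 1 / 2.
  move=> kn; rewrite add0r; apply: (le_trans (enorm_tent_field s t1 kn)).
  by apply: le_trans rad1; apply: ler_wpM2l => //; exact: ltW.
have F1 : unit_chain T F.
  move=> k kn; apply: cap_unit; first exact: t1.
    by rewrite add0r dot_tent_field.
  by have := dot_le_sqr (z2 k kn); lra.
have Fend k : tent T k = 0 -> F k = t k.
  by move=> tk; rewrite /F /tent_field tk scale0r addr0 cap0.
have fQ : feasible T q0 qL N0 NL (chain_polygon T q0 F).
  apply: feasible_chain => //.
  - rewrite Fend ?tent_first // /t node1 pA //; exact: ltW.
  - rewrite Fend ?tent_last // /t pB // node_last.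
    by have := @ell0_le_mesh _ _ T (nedges T); rewrite n0 leqnn => /(_ isT); lra.
  - by rewrite [chain_sum T F]s2 addrC subrK.
exists (chain_polygon T q0 F) => //; rewrite (feasible_energy fQ).
rewrite (_ : chain_energy T _ = chain_energy T F); last first.
  rewrite /chain_energy; congr (_ * _); apply: eq_big_nat => k kn.
  have k1 : (1 <= k <= nedges T)%N by clear -kn; lia.
  have k2 : (1 <= k.+1 <= nedges T)%N by clear -kn; lia.
  by rewrite !tau_chain.
apply: lipschitz_chain_energy => // k kn.
have k1 : (1 <= k <= nedges T)%N by clear -kn; lia.
have k2 : (1 <= k.+1 <= nedges T)%N by clear -kn; lia.
have l0 := ell0_gt0 k1.
have H := cap_lipschitz (t1 _ k2) (t1 _ k1) (z2 _ k2) (z2 _ k1).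
apply: (le_trans H); rewrite !add0r.
have H2 := tent_field_lipschitz s t1 kn.
have H3 := tl k kn.
have e0 := enorm_ge0 s; have dd0 := enorm_ge0 (t k.+1 - t k).
have H4 : (ell0 T k + 2 * L * enorm (t k.+1 - t k)) * enorm s <=
    ell0 T k * rad + enorm (t k.+1 - t k).
  rewrite mulrDl; apply: lerD; first by apply: ler_wpM2l => //; exact: ltW.
  rewrite (_ : 2 * L * _ * _ = enorm (t k.+1 - t k) * (2 * (L * enorm s))); last by ring.
  rewrite -[leRHS]mulr1; apply: ler_wpM2l => //.
  by have := ler_wpM2l (ltW L0) s1; lra.
by rewrite /M; move: H2 H3 H4; clear; lra.
Qed.

End CompetitorExistence.

(** * Estimates for polygons *)

Section PolygonEstimates.
Variables (R : realType) (L : R).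
Hypothesis L0 : 0 < L.

(** r = 1 / (1 + eta), and r = 0 for infinite eta; r < 1 is the only form in which eta enters the
    estimates. *)
Lemma excess_ratio (eta : \bar R) : (0 < eta)%E ->
  exists2 r : R, 0 <= r < 1 & forall m (q0 qL : 'rV[R]_m),
    excess L q0 qL = eta -> enorm (qL - q0) = r * L.
Proof.
rewrite /excess; case: eta => [e| |//].
  rewrite lte_fin => e0; exists (1 + e)^-1 => [|m q0 qL].
    by rewrite invr_ge0 invf_lt1; lra.
  case: eqVneq => // q [eE].
  have d0 : enorm (qL - q0) != 0.
    by apply: contra_neq q => /enorm_eq0/eqP; rewrite subr_eq0 => /eqP ->.
  have -> : 1 + e = L / enorm (qL - q0) by rewrite -eE; ring.
  by rewrite invf_div divfK // gt_eqF.
move=> _; exists 0 => [|m q0 qL]; first by rewrite lexx ltr01.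
by case: eqVneq => // -> _; rewrite subrr enorm0 mul0r.
Qed.

Lemma bigmax_nat_le (a b : nat) (f : nat -> R) x : 0 <= x ->
  (forall k, (a <= k < b)%N -> f k <= x) -> \big[Num.max/0]_(a <= k < b) f k <= x.
Proof.
by move=> x0 fx; rewrite big_nat_cond; apply: bigmax_le => // k /andP[/fx].
Qed.

Lemma sum_neighbours_le (T : interval_partition L) :
  \sum_(2 <= k < nedges T) (ell0 T k + lbar T k + lbar T k.-1) <= 3 * L.
Proof.
have n1 := nedges_gt0 T L0.
have [n2|n2] := leqP (nedges T) 2.
  by rewrite big_geq // mulr_ge0 // ltW.
have lb k : (1 <= k < nedges T)%N -> 0 <= lbar T k by move=> kn; apply/ltW/lbar_gt0.
have lbL := sum_lbar_le_L T L0.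
have A : \sum_(2 <= k < nedges T) ell0 T k <= L.
  rewrite -[leRHS](vtx_last T) -sum_ell0; apply: ler_sum_nat_sub; [by clear -n2; lia | by clear; lia |].
  by move=> k kn; apply/ltW/ell0_gt0; clear -kn; lia.
have B : \sum_(2 <= k < nedges T) lbar T k <= L.
  by apply: le_trans lbL; apply: ler_sum_nat_sub => //; clear -n2; lia.
have D : \sum_(2 <= k < nedges T) lbar T k.-1 <= L.
  apply: le_trans lbL; rewrite big_add1 /=.
  by apply: ler_sum_nat_sub => //; clear -n2; lia.
rewrite big_split /= [X in X + _]big_split /=.
by apply: le_trans (lerD (lerD A B) D) _; lra.
Qed.

(** Only comparability of neighbouring edges is retained; the minimum in the hypothesis is bounded
    by L. *)
Lemma almost_uniform_ratio (T : interval_partition L) C' k : almost_uniform T C' ->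
  (0 < k < nedges T)%N ->
  ell0 T k.+1 <= expR (`|C'| * L) * ell0 T k /\
  ell0 T k <= expR (`|C'| * L) * ell0 T k.+1.
Proof.
move=> au kn; have k1 : (1 <= k <= nedges T)%N by clear -kn; lia.
have k2 : (1 <= k.+1 <= nedges T)%N by clear -kn; lia.
have [l1 l2] := (ell0_gt0 k1, ell0_gt0 k2).
have lL : ell0 T k <= L.
  have : vtx T k <= L by rewrite -[leRHS](vtx_last T); apply: vtx_le; clear -kn; lia.
  by have := node_ge0 k1; rewrite /node /ell0; lra.
have b : `|ln (ell0 T k.+1 / ell0 T k)| <= `|C'| * L.
  apply: (le_trans (au k kn)); apply: (le_trans (ler_norm _)).
  rewrite normrM; apply: ler_wpM2l => //.
  rewrite ger0_norm ?le_min ?(ltW l1) ?(ltW l2) //.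
  by apply: le_trans lL; rewrite ge_min lexx.
move: b; rewrite ler_norml => /andP[b1 b2].
rewrite -!ler_pdivrMr //; split.
  by rewrite -[leLHS]lnK ?ler_expR // posrE divr_gt0.
rewrite -[leLHS]lnK ?posrE ?divr_gt0 // ler_expR -invf_div lnV ?posrE ?divr_gt0 //.
by rewrite lerNl.
Qed.

(** The jump of the second difference across I_k is bounded by the lengths of I_k and its
    neighbours. Summed, this is at most 3 L times the constant; divided by the length of I_k it is
    bounded only if the neighbours are not much longer, which gives the factor 2 + exp(|C'| L). *)
Lemma stationary_polygon_estimate (K r : R) : 0 <= K -> 0 <= r < 1 ->
  exists C h0 : R, [/\ 0 <= C, 0 < h0 & forall m (T : interval_partition L)
    (q0 qL N0 NL : 'rV[R]_m) (P : polygon m T), mesh T <= h0 ->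
    feasible T q0 qL N0 NL P -> energy P <= K -> enorm (qL - q0) = r * L ->
    stationary T (tau P) ->
    [/\ semi_w2oo P <= C, semi_tv3 P <= C & forall C', almost_uniform T C' ->
      semi_w3oo P <= C * (2 + expR (`|C'| * L))]].
Proof.
move=> K0 r01; have [C [h0 [C0 h0p H]]] := stationary_chain_estimate L0 K0 r01.
have CL : 0 <= C * (3 * L) by rewrite !mulr_ge0 // ltW.
exists (C + C * (3 * L)), h0; split => //; first exact: addr_ge0.
move=> m T q0 qL N0 NL P hT fP PK qr stP.
have [||B1 B2] := H m T (tau P) hT (feasible_unit fP) _ _ stP.
- by rewrite -(feasible_energy fP).
- by rewrite (feasible_sum fP) qr.
have D3E k : (2 <= k < nedges T)%N -> enorm (D3 P k) * ell0 T k =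
    enorm (bend T (tau P) k - bend T (tau P) k.-1).
  move=> kn; have kN : (1 <= k <= nedges T)%N by clear -kn; lia.
  have l0 := ell0_gt0 kN.
  rewrite /D3 /Dvtx (feasible_ell fP) // !(feasible_bend fP); first last.
  - by clear -kn; lia.
  - by clear -kn; lia.
  rewrite enormZ ger0_norm ?invr_ge0 ?(ltW l0) //.
  by rewrite mulrAC mulVf ?mul1r // gt_eqF.
split.
- apply: bigmax_nat_le => [|k kn]; first exact: addr_ge0.
  by rewrite (feasible_bend fP) //; apply: (le_trans (B1 k kn)); rewrite lerDl.
- rewrite /semi_tv3; apply: (@le_trans _ _ (C * (3 * L))); last by rewrite lerDr.
  apply: (@le_trans _ _ (\sum_(2 <= k < nedges T)
      C * (ell0 T k + lbar T k + lbar T k.-1))).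
    apply: ler_sum_nat0 => k kn; rewrite (feasible_ell fP); last by clear -kn; lia.
    by rewrite D3E //; exact: B2.
  by rewrite -mulr_sumr; apply: ler_wpM2l => //; exact: sum_neighbours_le.
- move=> C' au; have E0 := expR_gt0 (`|C'| * L).
  have E2 : 0 <= 2 + expR (`|C'| * L) by lra.
  apply: (@le_trans _ _ (C * (2 + expR (`|C'| * L)))); last first.
    by apply: ler_wpM2r => //; rewrite lerDl.
  apply: bigmax_nat_le => [|k kn]; first exact: mulr_ge0.
  have kN : (1 <= k <= nedges T)%N by clear -kn; lia.
  have l0 := ell0_gt0 kN.
  have [|A1 _] := almost_uniform_ratio (k := k) au; first by clear -kn; lia.
  have [|_ A2] := almost_uniform_ratio (k := k.-1) au; first by clear -kn; lia.
  have kE : k.-1.+1 = k by clear -kn; lia.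
  rewrite kE in A2.
  rewrite -(ler_pM2r l0) D3E //; apply: (le_trans (B2 k kn)).
  rewrite -mulrA; apply: ler_wpM2l => //.
  by rewrite /lbar kE; move: A1 A2; clear; lra.
Qed.

End PolygonEstimates.

Unset Implicit Arguments.

Theorem theorem3p3 (R : realType) (m : nat) (L : R) (eta : \bar R) (K : R)
    (L_gt0 : 0 < L) (eta_gt0 : (0 < eta)%E) (K_ge0 : 0 <= K) :
  (exists h0 : R, 0 < h0 /\
    (exists C : R, 0 <= C /\
      forall q0 qL N0 NL : 'rV[R]_m,
        sphere N0 -> sphere NL -> excess L q0 qL = eta ->
      forall T : interval_partition L, mesh T <= h0 ->
      forall P : polygon m T, critical q0 qL N0 NL P -> energy P <= K ->
        semi_w2oo P <= C /\ semi_tv3 P <= C) /\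
    (forall C' : R, exists C : R, 0 <= C /\
      forall q0 qL N0 NL : 'rV[R]_m,
        sphere N0 -> sphere NL -> excess L q0 qL = eta ->
      forall T : interval_partition L, mesh T <= h0 -> almost_uniform T C' ->
      forall P : polygon m T, critical q0 qL N0 NL P -> energy P <= K ->
        semi_w3oo P <= C)) /\
  ((2 <= m)%N ->
    forall q0 qL N0 NL : 'rV[R]_m,
      sphere N0 -> sphere NL -> excess L q0 qL = eta ->
    exists K2 : R, 0 <= K2 /\ exists h1 : R, 0 < h1 /\
      forall T : interval_partition L, mesh T <= h1 ->
        minimizers T q0 qL N0 NL `<=` apriori T q0 qL N0 NL K2).

Proof.
have [r r01 qr] := excess_ratio L_gt0 eta_gt0.
split.
  have [C [h [C0 h0 H]]] := stationary_polygon_estimate L_gt0 K_ge0 r01.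
  have K1 : 0 < 2 * K + 1 by lra.
  have crit q0 qL N0 NL (T : interval_partition L) (P : polygon m T) :
      mesh T <= Num.min h (1 / (2 * K + 1)) -> critical q0 qL N0 NL P ->
      energy P <= K -> stationary T (tau P).
    rewrite le_min ler_pdivlMr // => /andP[_ hT] cP PK; have [fP _ _] := cP.
    have mp := mesh_gt0 T L_gt0.
    have hK : 2 * K * mesh T <= 1 by lra.
    rewrite (feasible_energy fP) in PK.
    apply: (critical_stationary L_gt0 cP) => k kn.
    by case/andP: (dot_gtN1 (feasible_unit fP) PK hK kn).
  (* The second bound yields 2 K [mesh T] <= 1, so that no angle reaches pi at a polygon of energy
     at most K. *)
  exists (Num.min h (1 / (2 * K + 1))); split; first by rewrite lt_min h0 divr_gt0.
  split; last move=> C'.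
    exists C; split=> // q0 qL N0 NL _ _ exq T hT P cP PK.
    have stP := crit _ _ _ _ _ _ hT cP PK; have [fP _ _] := cP.
    move: hT; rewrite le_min => /andP[hT _].
    by have [] := H m T q0 qL N0 NL P hT fP PK (qr _ _ _ exq) stP.
  exists (C * (2 + expR (`|C'| * L))); split.
    by rewrite mulr_ge0 // addr_ge0 // expR_ge0.
  move=> q0 qL N0 NL _ _ exq T hT au P cP PK.
  have stP := crit _ _ _ _ _ _ hT cP PK; have [fP _ _] := cP.
  move: hT; rewrite le_min => /andP[hT _].
  by have [_ _ /(_ C' au)] := H m T q0 qL N0 NL P hT fP PK (qr _ _ _ exq) stP.
move=> m2 q0 qL N0 NL N01 NL1 exq.
(* The energy of the competitor takes the role of K: it bounds the energy of every minimizer on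
   every fine partition. *)
have [K' [h1 [K'0 h10 comp]]] := competitor m2 L_gt0 N01 NL1 r01 (qr _ _ _ exq).
have [C [h [C0 h0 H]]] := stationary_polygon_estimate L_gt0 K'0 r01.
have [c [h2 [c0 h20 coer]]] := bounded_energy_coercive L_gt0 K'0 r01.
have K1 : 0 < 2 * K' + 1 by lra.
exists C; split=> //; exists (Num.min (Num.min h1 h) (Num.min h2 (1 / (2 * K' + 1)))).
split; first by rewrite !lt_min h10 h0 h20 divr_gt0.
move=> T; rewrite !le_min ler_pdivlMr // => /andP[/andP[hT1 hT] /andP[hT2 hT3]] P minP.
have [fP minE] := minP.
have [Q fQ QK] := comp T hT1.
have PK : energy P <= K' := le_trans (minE Q fQ) QK.
have mp := mesh_gt0 T L_gt0.
have hK : 2 * K' * mesh T <= 1 by lra.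
have PK' := PK; rewrite (feasible_energy fP) in PK'.
have t1 := feasible_unit fP.
have tc : tent_coercive T (tau P) c.
  by apply: coer => //; rewrite (feasible_sum fP) (qr _ _ _ exq).
have stP : stationary T (tau P).
  apply: (minimizer_stationary L_gt0 minP c0 tc) => k kn.
  by case/andP: (dot_gtN1 t1 PK' hK kn).
by have [P1 P2 _] := H m T q0 qL N0 NL P hT fP PK (qr _ _ _ exq) stP; split.
Qed.
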